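(* Let $P,Q\in\mathbb{C}[x,y]$ with $Q\not\equiv 0$ and consider the differential equation $$(E)\qquad \frac{dy}{dx}=\frac{P(x,y)}{Q(x,y)}.$$ There exists a finite set of points $\Sigma_E\subset\mathbb{C}$ such that, for every local solution $y=f(x,x_0,y_0)$ of $(E)$, every non-algebroid singularity of $f(\cdot,x_0,y_0)$ over $\mathbb{C}$ projects into $\Sigma_E$ (that is, if a path $\gamma:[0,1]\to\mathbb{C}$ with $\gamma(0)=x_0$ leads $f(\cdot,x_0,y_0)$ to a singularity which is not algebroid, then $\gamma(1)\in\Sigma_E$).
   Context: Local solutions: if $(x_0,y_0)\in\mathbb{C}^2$ satisfies $Q(x_0,y_0)\neq0$, then $f(x,x_0,y_0)$ denotes the unique germ at $x_0$ of holomorphic function of $x$ which solves $(E)$ and takes the value $y_0$ at $x=x_0$. Singularities. Let $\Omega\subset\mathbb{C}$ be a connected open set (here $\Omega=\mathbb{C}$), $x_0\in\Omega$, and $f$ a germ of holomorphic function at $x_0$. Paths $\gamma:[0,1]\to\Omega$ are continuous with $\gamma(0)=x_0$. When $f$ admits an analytic continuation along $\gamma$ (with values in $\mathbb{C}$, in the usual sense via a chain of discs in $\Omega$), the germ obtained at $\gamma(1)$ is denoted $f_\gamma$ and called a determination of $f$ over $\gamma(1)$. For a subdomain $D\subset\Omega$, the multivalued function defined on $D$ by a germ is the collection of all its analytic continuations along paths in $D$. The path $\gamma$ leads $f$ to a singularity if $f$ admits an analytic continuation along $\gamma|_{[0,1-\delta]}$ for all $\delta>0$ but not along $\gamma$.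 Two such paths $\gamma,\gamma'$ with the same endpoint $x_1$ lead to the same singularity if for every neighbourhood $D$ of $x_1$ the determinations $f_{\gamma|_{[0,\tau]}}$ and $f_{\gamma'|_{[0,\tau]}}$ define the same multivalued function on $D$ for all $\tau$ sufficiently close to $1$. The singularities of $f$ over $\Omega$ are the equivalence classes; the class of $\gamma$ projects to $x_1=\gamma(1)$. The singularity defined by $\gamma$ is isolated if there is a disc $D$ centred at $x_1$ such that, for $\tau$ close to $1$, the determination $f_{\gamma|_{[0,\tau]}}$ admits an analytic continuation along every path in $D^*=D\setminus\{x_1\}$; the germs so obtained are the determinations of the singularity around $x_1$. The singularity is algebroid if it is isolated, has finitely many determinations around $x_1$ (over each point of $D^*$), and has a limit in $\overline{\mathbb{C}}=\mathbb{C}\cup\{\infty\}$, i.e. there is $y_1\in\overline{\mathbb{C}}$ such that for every path $\gamma'$ representing this singularity the value of $f_{\gamma'|_{[0,t]}}$ at $\gamma'(t)$ tends to $y_1$ as $t\to1$. (In particular poles are algebroid singularities.) *)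

(* Defs.v *)
From HB Require Import structures.
From mathcomp Require Import all_boot all_order all_algebra polyXY complex.
From mathcomp Require Import all_classical all_reals all_analysis.

Set Implicit Arguments.
Unset Strict Implicit.
Unset Printing Implicit Defensive.

Import Order.TTheory GRing.Theory Num.Theory.
Import numFieldNormedType.Exports.

Local Open Scope classical_set_scope.
Local Open Scope ring_scope.

(* Bundling R[i] as a numClosedFieldType gives it the topology of the modulus
   and its structure of normed space over itself. In this structure norms and
   radii of balls are elements of the field; [0 < r] entails that r is real. *)
Definition Cplx (R : realType) : numClosedFieldType := R[i].

Section AnalyticContinuation.
Variable R : realType.
Local Notation C := (Cplx R).

Definition holomorphic_on (A : set C) (f : C -> C) : Prop :=
  forall z, A z -> derivable f z (1 : C).

(* A germ at z is represented by any function C -> C having this germ. *)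
Definition germ_eq (z : C) (f g : C -> C) : Prop := \forall w \near z, f w = g w.

Definition germ (z : C) (f : C -> C) : set (C -> C) := [set g | germ_eq z f g].

(* Only the restriction of gamma to [0, 1] is meaningful. *)
Definition is_path (gamma : R -> C) : Prop := {within `[0, 1], continuous gamma}.

Definition path_in (D : set C) (gamma : R -> C) : Prop :=
  is_path gamma /\ (forall s, 0 <= s <= 1 -> D (gamma s)).

(* The germ of f at gamma 0 is continued along the restriction of gamma to
   [0, T] to the germ of g at gamma T: the discs D_0, ..., D_n carry
   holomorphic functions F_0, ..., F_n, consecutive ones agreeing on the
   intersection of their discs, and D_i contains gamma([t_i, t_(i+1)]). *)
Definition continuation (gamma : R -> C) (T : R) (f g : C -> C) : Prop :=
  exists (n : nat) (t : nat -> R) (c r : nat -> C) (F : nat -> C -> C),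
    [/\ [/\ t 0%N = 0, t n.+1 = T &
            forall i, (i <= n)%N -> t i <= t i.+1],
        forall i, (i <= n)%N ->
          [/\ 0 < r i,
              holomorphic_on (ball (c i) (r i)) (F i) &
              forall s, t i <= s <= t i.+1 -> ball (c i) (r i) (gamma s)],
        forall i, (i < n)%N ->
          forall z, ball (c i) (r i) z -> ball (c i.+1) (r i.+1) z ->
            F i z = F i.+1 z,
        germ_eq (gamma 0) f (F 0%N) &
        germ_eq (gamma T) (F n) g].

Definition continuable (gamma : R -> C) (T : R) (f : C -> C) : Prop :=
  exists g, continuation gamma T f g.

(* The multivalued function defined on D by the germ of f at z: its value at w
   is the set of all (representatives of) germs at w obtained by continuing
   this germ along paths in D. *)
Definition multivalued (D : set C) (z : C) (f : C -> C) (w : C) : set (C -> C) :=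
  [set g | exists sigma, [/\ path_in D sigma, sigma 0 = z, sigma 1 = w &
                             continuation sigma 1 f g]].

Definition leads_to_singularity (x0 : C) (f : C -> C) (gamma : R -> C) : Prop :=
  [/\ is_path gamma, gamma 0 = x0,
      forall delta : R, 0 < delta <= 1 -> continuable gamma (1 - delta) f &
      ~ continuable gamma 1 f].

(* To be used for two paths leading f to a singularity. *)
Definition same_singularity (f : C -> C) (gamma gamma' : R -> C) : Prop :=
  gamma 1 = gamma' 1 /\
  forall D : set C, open D -> connected D -> D (gamma 1) ->
    \forall tau \near 1^'-, forall g g',
      continuation gamma tau f g -> continuation gamma' tau f g' ->
      multivalued D (gamma tau) g = multivalued D (gamma' tau) g'.

Definition punctured_disc (x1 r : C) : set C := ball x1 r `\ x1.

Definition isolated_in (f : C -> C) (gamma : R -> C) (r : C) : Prop :=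
  \forall tau \near 1^'-, forall g, continuation gamma tau f g ->
    forall sigma, path_in (punctured_disc (gamma 1) r) sigma ->
      sigma 0 = gamma tau -> continuable sigma 1 g.

Definition finitely_determined_in (f : C -> C) (gamma : R -> C) (r : C) : Prop :=
  \forall tau \near 1^'-, forall g, continuation gamma tau f g ->
    forall z, punctured_disc (gamma 1) r z ->
      finite_set
        (germ z @` multivalued (punctured_disc (gamma 1) r) (gamma tau) g z).

(* [None] is the point at infinity. *)
Definition limit_along (f : C -> C) (gamma : R -> C)
    (y1 : one_point_compactification C) : Prop :=
  forall U, nbhs y1 U ->
    \forall t \near 1^'-, forall g, continuation gamma t f g ->
      U (Some (g (gamma t))).

Definition algebroid (x0 : C) (f : C -> C) (gamma : R -> C) : Prop :=
  (exists r : C, [/\ 0 < r, isolated_in f gamma r &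
                     finitely_determined_in f gamma r]) /\
  (exists y1 : one_point_compactification C, forall gamma',
     leads_to_singularity x0 f gamma' -> same_singularity f gamma gamma' ->
     limit_along f gamma' y1).

(* In P.[x, y] the outer variable of P : {poly {poly C}} is x. *)
Definition local_solution (P Q : {poly {poly C}}) (x0 y0 : C) (f : C -> C) : Prop :=
  f x0 = y0 /\
  \forall x \near x0, is_derive (x : C) (1 : C) f (P.[x, f x] / Q.[x, f x]).

End AnalyticContinuation.

(* Main.v *)
Require Import Defs.
From HB Require Import structures.
From mathcomp Require Import all_boot all_order all_algebra polyXY complex.
From mathcomp Require Import all_classical all_reals all_analysis.
From mathcomp Require Import ring lra.

Set Implicit Arguments.
Unset Strict Implicit.
Unset Printing Implicit Defensive.

Import Order.TTheory GRing.Theory Num.Theory.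
Import numFieldNormedType.Exports.

Local Open Scope classical_set_scope.
Local Open Scope ring_scope.


(** Painleve's argument. Dividing P and Q by their greatest common divisor over
C(x) leaves an equation q(x, y) y' = p(x, y) whose two sides have no common zero
over any x outside a finite set S ([coprime_form], [reduce_solution]). The set S
is enlarged so that the equation is equally tame at y = oo, in the coordinate
u = 1 / y ([infinity_form], [normal_form]). It is claimed that a singularity
over a point x1 outside S is algebroid.

If q(x1, y) <> 0, the Cauchy existence theorem with a uniform radius
([ode_exists]) provides solutions on one disc around x1 through all points near
(x1, y); if the values of the solution accumulated at y, one of them would
continue it to the end of the path. The values therefore leave every compact
set without zeros of q(x1, .). In particular they cannot cross small circles
around these zeros, nor large circles, so they converge to a zero or to oo
([no_crossing], [limit_exists]).

Around the limit s1, in a coordinate u of the sphere, the equation is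
q u' = p with p(x1, s1) <> 0, so that x is a holomorphic function X of u on
the integral curve: dX/du = q / p. All the germs of the solution met near the
end of the path are inverses of one and the same X, and X(s1) = x1
([integral_curve]). As X is not constant, there is a small disc around s1 on
whose boundary X stays at a distance delta from x1, and where X takes the value
x1 and has a zero derivative at most at s1 ([isolated_data]). The inverse germs
of X with values in this disc are preserved by continuation inside the disc of
radius delta around x1 ([branch_keep]), continue along every path that avoids
x1 ([branch_continuable]) and are finitely many over each point
([branch_unique], [fibre_finite]). Hence the singularity is isolated with
finitely many determinations. Since every determination near x1 has its values
near s1, the limit is determined by the multivalued functions on small discs,
thus common to all the paths leading to the singularity ([charts_disjoint]).

Holomorphic means complex differentiable at each point, without continuity of
the derivative. The function theory used above therefore starts from the
theorem of Goursat ([goursat]), which gives the Cauchy formula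
([cauchy_formula]), Taylor expansions ([taylor]), and from them the isolated
zeros, the identity theorem ([zero_dichotomy], [identity_seg]) and primitives
on discs ([primitive_ball]), on which Picard iteration rests ([picard]). *)

(** * The modulus and the topology of the complex numbers *)

Section Modulus.
Variable R : realType.
Local Notation C := (Cplx R).

(** A named copy of the embedding of the reals with values in [Cplx R], whose
topology and order are those in use. *)
Definition rc (x : R) : C := real_complex R x.
HB.instance Definition _ := GRing.RMorphism.copy rc (real_complex R).
(** The modulus as a real number. The norm of [Cplx R] has its values in [Cplx
R], whose order is only partial. *)
Definition nm (z : C) : R := Normc.normc z.

Lemma nmE (z : C) : `|z| = rc (nm z). Proof. by []. Qed.

Lemma ltrc (x y : R) : (rc x < rc y) = (x < y).
Proof. exact: ltcR. Qed.
Lemma lerc (x y : R) : (rc x <= rc y) = (x <= y).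
Proof. exact: lecR. Qed.

Lemma nmD z w : nm (z + w) <= nm z + nm w.
Proof. by rewrite -lerc rmorphD /= -!nmE ler_normD. Qed.
Lemma nmM z w : nm (z * w) = nm z * nm w.
Proof. exact: Normc.normcM. Qed.
Lemma nmV z : nm z^-1 = (nm z)^-1.
Proof. exact: Normc.normcV. Qed.
Lemma nmN z : nm (- z) = nm z.
Proof. exact: normcN. Qed.
Lemma nmB z w : nm (z - w) = nm (w - z).
Proof. by rewrite -nmN opprB. Qed.
Lemma nm_ge0 z : 0 <= nm z.
Proof. by rewrite -lerc -nmE rmorph0. Qed.
Lemma nm0 : nm 0 = 0. Proof. exact: Normc.normc0. Qed.
Lemma nm1 : nm 1 = 1. Proof. exact: Normc.normc1. Qed.
Lemma nm_eq0 z : (nm z == 0) = (z == 0).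
Proof.
by apply/eqP/eqP => [|->]; [exact: Normc.eq0_normc|exact: nm0].
Qed.
Lemma nm_gt0 z : (0 < nm z) = (z != 0).
Proof. by rewrite lt_neqAle nm_ge0 andbT eq_sym nm_eq0. Qed.
Lemma nmX z n : nm (z ^+ n) = nm z ^+ n.
Proof. by elim: n => [|n IH]; rewrite ?expr0 ?nm1 // !exprS nmM IH. Qed.
Lemma nmrc x : nm (rc x) = `|x|.
Proof. by rewrite /nm /= expr0n addr0 sqrtr_sqr. Qed.
Lemma nm_sub z w : nm z - nm w <= nm (z - w).
Proof. by rewrite lerBlDr (le_trans _ (nmD _ _)) // subrK. Qed.
Lemma nm_tri a b c : nm (a - c) <= nm (a - b) + nm (b - c).
Proof. by rewrite (le_trans _ (nmD _ _)) // addrA subrK. Qed.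

Lemma nm_le0 z w : nm (z - w) <= 0 -> z = w.
Proof.
by move=> h; apply/eqP; rewrite -subr_eq0 -nm_eq0 eq_le h nm_ge0.
Qed.
Lemma nm_small z w : (forall e : R, 0 < e -> nm (z - w) <= e) -> z = w.
Proof.
by move=> h; apply: nm_le0; apply/ler_addgt0Pl => e e0; rewrite addr0 h.
Qed.

Lemma gt0rc (e : C) : 0 < e -> exists2 r : R, 0 < r & e = rc r.
Proof.
case: e => a b; rewrite ltcE /= => /andP[/eqP -> a0].
by exists a.
Qed.

Lemma ballC (a r z : C) : ball a r z = (`|z - a| < r) :> Prop.
Proof. by rewrite -ball_normE /ball_ /= distrC. Qed.

Lemma ballrc (a : C) (r : R) z : ball a (rc r) z = (nm (z - a) < r) :> Prop.
Proof. by rewrite ballC nmE ltrc. Qed.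

Lemma nearC (a : C) (P : C -> Prop) :
  (\forall z \near a, P z) <-> exists2 r : R, 0 < r & forall z, nm (z - a) < r -> P z.
Proof.
split.
  move/nbhs_ballP => [e /= e0 eP]; have [r r0 er] := gt0rc e0.
  by exists r => // z zr; apply: eP; rewrite er ballrc.
move=> [r r0 rP]; apply/nbhs_ballP; exists (rc r) => /=.
  by rewrite -(rmorph0 rc) ltrc.
by move=> z; rewrite ballrc; exact: rP.
Qed.

Lemma nearR (a : R) (P : R -> Prop) :
  (\forall z \near a, P z) <-> exists2 r : R, 0 < r & forall z, `|z - a| < r -> P z.
Proof.
split.
  move/nbhs_ballP => [e /= e0 eP].
  by exists e => // z zr; apply: eP; rewrite -ball_normE /ball_ /= distrC.
move=> [r r0 rP]; apply/nbhs_ballP; exists r => //=.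
by move=> z; rewrite -ball_normE /ball_ /= distrC; exact: rP.
Qed.

(** The bound 0 <= T keeps all the parameters in the domain of a path. *)
Lemma near1m (P : R -> Prop) :
  (\forall t \near 1^'-, P t) <-> exists2 T : R, 0 <= T < 1 & forall t, T < t < 1 -> P t.
Proof.
split.
  move=> /nearR [r r0 rP]; exists (Num.max 0 (1 - r)).
    by rewrite le_max lexx /= gt_max ltr01 gtrBl.
  move=> t /andP[]; rewrite gt_max => /andP[t0 tr] t1.
  apply: rP => //; rewrite ltr_norml; apply/andP; split; lra.
move=> [T /andP[T0 T1] TP]; apply/nearR; exists (1 - T); first lra.
move=> t; rewrite ltr_norml => /andP[h1 h2] t1; apply: TP; lra.
Qed.

End Modulus.

(** The increment form of the derivative does not divide by the increment and is
thus stable under composition. *)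
Lemma is_deriveP (K : numFieldType) (f : K -> K) (x d : K) :
  is_derive x (1 : K) f d <->
  (forall e : K, 0 < e -> exists2 r : K, 0 < r &
     forall y, `|y - x| < r -> `|f y - f x - d * (y - x)| <= e * `|y - x|).
Proof.
split=> [[df vf]|H].
  move=> e e0; have := df; rewrite /derivable => /cvg_ex[l cl].
  have ld : l = d by rewrite -vf; apply/esym; exact: cvg_lim.
  move: cl; rewrite ld => /cvgrPdist_le /(_ e e0).
  move=> /nbhs_ballP[r /= r0 rP].
  exists r => // y yr; have [->|yx] := eqVneq y x.
    by rewrite !subrr mulr0 subr0 normr0 mulr0.
  have yx0 : y - x != 0 by rewrite subr_eq0.
  have := rP (y - x); rewrite -ball_normE /ball_ /= sub0r normrN => /(_ yr yx0).
  rewrite -ler_pdivrMr ?normr_gt0 // -normrV ?unitfE // -normrM; congr (_ <= _).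
  rewrite -normrN; congr (`|_|).
  rewrite [(y - x) *: _]mulr1 subrK.
  have -> : (y - x)^-1 *: (f y - f x) = (y - x)^-1 * (f y - f x) by [].
  by field.
have cl : (fun h : K => h^-1 *: ((f \o shift x) (h *: (1:K)) - f x)) @ 0^' --> d.
  apply/cvgrPdist_le => e e0; have [r r0 rP] := H e e0.
  apply/nbhs_ballP; exists r => //= h.
  rewrite -ball_normE /ball_ /= sub0r normrN => hr h0.
  have := rP (h + x); rewrite addrK => /(_ hr).
  rewrite -ler_pdivrMr ?normr_gt0 // -normrV ?unitfE // -normrM; congr (_ <= _).
  rewrite -normrN; congr (`|_|).
  rewrite /= [h *: _]mulr1.
  set u := f _ - f _; have -> : h^-1 *: u = h^-1 * u by [].
  by field.
by split; [apply/cvg_ex; exists d|exact: cvg_lim].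
Qed.

(** * Derivatives of functions of a real or complex variable *)

Section Drv.
Variable R : realType.
Local Notation C := (Cplx R).
Local Notation rc := (@rc R).
Local Notation nm := (@nm R).

(** The parameter space is embedded in the complex plane by [i]: the identity
for functions of a complex variable, [rc] for functions of a real one. Each rule
of calculus is proved once for both, and the chain rule covers holomorphic
functions along curves. *)
Definition drv (T : Type) (i : T -> C) (f : T -> C) (t : T) (d : C) : Prop :=
  forall e : R, 0 < e -> exists2 r : R, 0 < r & forall s, nm (i s - i t) < r ->
    nm (f s - f t - d * (i s - i t)) <= e * nm (i s - i t).

Section Rules.
Variables (T : Type) (i : T -> C).
Implicit Types (f g : T -> C) (t : T).

Lemma drv_cst c t : drv i (fun=> c) t 0.
Proof.
move=> e e0; exists 1 => // s _.
by rewrite subrr mul0r subrr nm0 mulr_ge0 ?nm_ge0 // ltW.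
Qed.

Lemma drv_id t : drv i i t 1.
Proof.
move=> e e0; exists 1 => // s _.
by rewrite mul1r subrr nm0 mulr_ge0 ?nm_ge0 // ltW.
Qed.

Lemma drv_lip f t d : drv i f t d ->
  exists2 r : R, 0 < r & forall s, nm (i s - i t) < r ->
    nm (f s - f t) <= (nm d + 1) * nm (i s - i t).
Proof.
move=> /(_ 1 ltr01)[r r0 H]; exists r => // s /H {}H.
rewrite -[f s - f t](subrK (d * (i s - i t))) (le_trans (nmD _ _)) //.
by rewrite nmM mulrDl mul1r addrC lerD2l -[X in _ <= X]mul1r.
Qed.

Lemma drv_cont f t d : drv i f t d -> forall e : R, 0 < e ->
  exists2 r : R, 0 < r & forall s, nm (i s - i t) < r -> nm (f s - f t) < e.
Proof.
move=> /drv_lip[r r0 H] e e0.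
have d0 : 0 < nm d + 1 by rewrite ltr_wpDl ?nm_ge0.
exists (Num.min r (e / (nm d + 1))); first by rewrite lt_min r0 divr_gt0.
move=> s; rewrite lt_min => /andP[/H {}H hs]; apply: le_lt_trans H _.
by rewrite mulrC -ltr_pdivlMr.
Qed.

Lemma drvD f g t d d' : drv i f t d -> drv i g t d' ->
  drv i (fun s => f s + g s) t (d + d').
Proof.
move=> Hf Hg e e0; have e2 : 0 < e / 2 by rewrite divr_gt0.
have [r r0 rP] := Hf _ e2; have [r' r0' rP'] := Hg _ e2.
exists (Num.min r r'); first by rewrite lt_min r0.
move=> s; rewrite lt_min => /andP[/rP h1 /rP' h2].
have -> : f s + g s - (f t + g t) - (d + d') * (i s - i t) =
  (f s - f t - d * (i s - i t)) + (g s - g t - d' * (i s - i t)) by ring.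
by apply: (le_trans (nmD _ _)); lra.
Qed.

Lemma drv_comp f t d (K : C -> C) k : drv i f t d -> drv id K (f t) k ->
  drv i (fun s => K (f s)) t (k * d).
Proof.
move=> Hf HK e e0.
have [r1 r10 H1] := drv_lip Hf.
have d0 : 0 < nm d + 1 by rewrite ltr_wpDl ?nm_ge0.
have k0 : 0 < nm k + 1 by rewrite ltr_wpDl ?nm_ge0.
have ed : 0 < e / 2 / (nm d + 1) by rewrite !divr_gt0.
have ek : 0 < e / 2 / (nm k + 1) by rewrite !divr_gt0.
have [r2 r20 H2] := HK _ ed.
have [r3 r30 H3] := Hf _ ek.
have [r4 r40 H4] := drv_cont Hf r20.
exists (Num.min r1 (Num.min r3 r4)); first by rewrite !lt_min r10 r30.
move=> s; rewrite !lt_min => /and3P[/H1 h1 /H3 h3 /H4 h4].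
have {}H2 := H2 _ h4.
have -> : K (f s) - K (f t) - k * d * (i s - i t) =
  (K (f s) - K (f t) - k * (f s - f t)) + k * (f s - f t - d * (i s - i t)) by ring.
apply: (le_trans (nmD _ _)).
set N := nm (i s - i t) in h1 h3 *.
have N0 : 0 <= N by exact: nm_ge0.
have A1 : nm (K (f s) - K (f t) - k * (f s - f t)) <= e / 2 * N.
  apply: (le_trans H2); rewrite -mulrA ler_pM2l ?divr_gt0 // mulrC.
  by rewrite ler_pdivrMr // mulrC.
have A2 : nm (k * (f s - f t - d * (i s - i t))) <= e / 2 * N.
  rewrite nmM; apply: (@le_trans _ _ (nm k * (e / 2 / (nm k + 1) * N))).
    by rewrite ler_wpM2l ?nm_ge0.
  have -> : nm k * (e / 2 / (nm k + 1) * N) = e / 2 * N * (nm k / (nm k + 1)) by ring.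
  rewrite -[X in _ <= X]mulr1 ler_wpM2l ?mulr_ge0 ?ler_pdivrMr ?mul1r //; lra.
lra.
Qed.

Lemma drvM f g t d d' : drv i f t d -> drv i g t d' ->
  drv i (fun s => f s * g s) t (d * g t + f t * d').
Proof.
move=> Hf Hg e e0.
set a := nm (f t) + nm (g t) + nm d + 1.
have a0 : 0 < a by rewrite ltr_wpDl // !addr_ge0 ?nm_ge0.
have e3 : 0 < e / 4 / a by rewrite !divr_gt0.
have [r1 r10 H1] := Hf _ e3; have [r2 r20 H2] := Hg _ e3.
have [r3 r30 H3] := drv_cont Hg e3.
have [r4 r40 H4] := drv_lip Hf.
exists (Num.min (Num.min r1 r2) (Num.min r3 r4)).
  by rewrite !lt_min r10 r20 r30.
move=> s; rewrite !lt_min => /andP[/andP[/H1 h1 /H2 h2] /andP[/H3 h3 /H4 h4]].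
have -> : f s * g s - f t * g t - (d * g t + f t * d') * (i s - i t) =
  (f s - f t - d * (i s - i t)) * g t + f t * (g s - g t - d' * (i s - i t))
  + (f s - f t) * (g s - g t) by ring.
set N := nm (i s - i t) in h1 h2 h4 *.
have N0 : 0 <= N by exact: nm_ge0.
have [ft gt dn] : [/\ 0 <= nm (f t), 0 <= nm (g t) & 0 <= nm d] by rewrite !nm_ge0.
have E : e / 4 * N = (e / 4 / a * N) * a by field; rewrite gt_eqF.
have eN : 0 <= e / 4 / a * N by rewrite mulr_ge0 // ltW.
have A1 : nm ((f s - f t - d * (i s - i t)) * g t) <= e / 4 * N.
  rewrite nmM E; apply: (le_trans (ler_wpM2r gt h1)).
  by apply: ler_wpM2l => //; rewrite /a; lra.
have A2 : nm (f t * (g s - g t - d' * (i s - i t))) <= e / 4 * N.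
  rewrite nmM E mulrC; apply: (le_trans (ler_wpM2r ft h2)).
  by apply: ler_wpM2l => //; rewrite /a; lra.
have A3 : nm ((f s - f t) * (g s - g t)) <= e / 4 * N.
  rewrite nmM E; apply: (le_trans (ler_pM (nm_ge0 _) (nm_ge0 _) h4 (ltW h3))).
  have -> : (nm d + 1) * N * (e / 4 / a) = e / 4 / a * N * (nm d + 1) by ring.
  by apply: ler_wpM2l => //; rewrite /a; lra.
apply: (le_trans (nmD _ _)); have := nmD ((f s - f t - d * (i s - i t)) * g t)
  (f t * (g s - g t - d' * (i s - i t))).
have : 0 <= e / 4 * N by rewrite mulr_ge0 // divr_ge0 // ltW.
lra.
Qed.

Lemma drvZ c f t d : drv i f t d -> drv i (fun s => c * f s) t (c * d).
Proof. by move=> h; have := drvM (drv_cst c t) h; rewrite mul0r add0r. Qed.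

Lemma drvN f t d : drv i f t d -> drv i (fun s => - f s) t (- d).
Proof.
by move=> /(drvZ (-1)); rewrite mulN1r; under eq_fun do rewrite mulN1r.
Qed.

Lemma drvB f g t d d' : drv i f t d -> drv i g t d' ->
  drv i (fun s => f s - g s) t (d - d').
Proof. by move=> hf hg; apply: drvD => //; exact: drvN. Qed.

Lemma drv_eq f t d d' : drv i f t d -> d = d' -> drv i f t d'.
Proof. by move=> + <-. Qed.

Lemma drv_near f g t d (r : R) : 0 < r ->
  (forall s, nm (i s - i t) < r -> f s = g s) -> drv i f t d -> drv i g t d.
Proof.
move=> r0 fg H e e0; have [r' r'0 H'] := H e e0.
exists (Num.min r r'); first by rewrite lt_min r0.
move=> s; rewrite lt_min => /andP[h /H'].
by rewrite (fg _ h) (fg t) // subrr nm0.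
Qed.

End Rules.

Lemma drv_inv (z : C) : z != 0 -> drv id (fun w => w^-1) z (- (z^-1 * z^-1)).
Proof.
move=> z0 e e0; have nz : 0 < nm z by rewrite nm_gt0.
exists (Num.min (nm z / 2) (e * nm z ^+ 3 / 2)).
  by rewrite lt_min !divr_gt0 //= mulr_gt0 ?exprn_gt0.
move=> w; rewrite lt_min => /andP[h1 h2].
have nw : nm z / 2 < nm w.
  by have := nm_sub z w; rewrite nmB; lra.
have nw0 : 0 < nm w by apply: lt_trans nw; rewrite divr_gt0.
have w0 : w != 0 by rewrite -nm_gt0.
have -> : w^-1 - z^-1 - - (z^-1 * z^-1) * (w - z) =
  (w - z) * (w - z) / (w * z * z) by field; rewrite w0 z0.
rewrite !nmM nmV !nmM -mulrA mulrC ler_wpM2r ?nm_ge0 //.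
rewrite ler_pdivrMr ?mulr_gt0 //; apply: (le_trans (ltW h2)).
have -> : e * nm z ^+ 3 / 2 = e * (nm z / 2 * nm z * nm z) by field.
by rewrite ler_wpM2l ?(ltW e0) // !ler_wpM2r ?(ltW nz) // ltW.
Qed.

Lemma drvV (T : Type) (i : T -> C) f t d : f t != 0 -> drv i f t d ->
  drv i (fun s => (f s)^-1) t (- (d / (f t * f t))).
Proof.
move=> ft H; apply: drv_eq (drv_comp H (drv_inv ft)) _.
by field.
Qed.

Lemma cdP (f : C -> C) z d : is_derive z (1 : C) f d <-> drv id f z d.
Proof.
rewrite is_deriveP; split=> H.
  move=> e e0; have e0' : 0 < rc e by rewrite -(rmorph0 rc) ltrc.
  have [r /gt0rc[r' r'0 ->] H'] := H _ e0'; exists r' => // s sr.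
  by rewrite -lerc rmorphM /= -!nmE; apply: H'; rewrite nmE ltrc.
move=> e /gt0rc[e' e0 ->]; have [r r0 H'] := H _ e0.
exists (rc r); first by rewrite -(rmorph0 rc) ltrc.
move=> y; rewrite nmE ltrc => /H'.
by rewrite !nmE -rmorphM lerc.
Qed.

Lemma derivP (f : C -> C) z : derivable f z (1 : C) <-> exists d, drv id f z d.
Proof.
split=> [df|[d /cdP[]//]].
by exists ('D_1 f z); apply/cdP; split.
Qed.

Lemma drv_uniq (f : C -> C) z d d' : drv id f z d -> drv id f z d' -> d = d'.
Proof. by move=> /cdP[_ <-] /cdP[_ <-]. Qed.

Lemma Re_nm (z : C) : `|complex.Re (z : R[i])| <= nm z.
Proof. by rewrite -lerc; exact: (normc_ge_Re z). Qed.

Lemma rd_Re (f : R -> C) t d : drv rc f t d ->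
  is_derive t (1 : R) (fun s => complex.Re (f s : R[i])) (complex.Re (d : R[i])).
Proof.
move=> H; apply/is_deriveP => e e0; have [r r0 H'] := H e e0.
exists r => // y; have := H' y; rewrite -rmorphB nmrc => h /h {}h.
apply: le_trans h; apply: le_trans (Re_nm _).
move: (f y) (f t) d {H H'} => [a b] [a' b'] [c c'] /=.
by rewrite mulr0 subr0.
Qed.

(** A unit factor turns the modulus of an increment into the real part of
another one, to which the real mean value theorem applies. *)
Lemma phase (z : C) : exists2 c : C, nm c = 1 & c * z = rc (nm z).
Proof.
have [->|z0] := eqVneq z 0.
  by exists 1; rewrite ?nm1 // nm0 mulr0 rmorph0.
exists (rc (nm z) / z); last by rewrite divfK.
by rewrite nmM nmV nmrc ger0_norm ?nm_ge0 // mulfV // nm_eq0.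
Qed.

(** The mean value inequality; it replaces all estimates of integrals, an
integral being an increment of a primitive. *)
Lemma rd_mvi (F f : R -> C) (a b M : R) : a <= b ->
  (forall t, a <= t <= b -> drv rc F t (f t)) ->
  (forall t, a <= t <= b -> nm (f t) <= M) ->
  nm (F b - F a) <= M * (b - a).
Proof.
move=> ab dF fM; have [c c1 cE] := phase (F b - F a).
pose g t := complex.Re (c * F t : R[i]).
pose dg t := complex.Re (c * f t : R[i]).
have gd t : a <= t <= b -> is_derive t (1 : R) g (dg t).
  by move=> /dF h; apply: (rd_Re (drvZ c h)).
have gd' x : x \in `]a, b[%R -> is_derive x (1 : R) g (dg x).
  by rewrite in_itv /= => /andP[/ltW ? /ltW ?]; apply: gd; apply/andP.
have gc : {within `[a, b], continuous g}.
  by apply: derivable_within_continuous => x; rewrite in_itv /= => /gd[].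
have [x xab gE] := MVT_segment ab gd' gc.
have -> : nm (F b - F a) = g b - g a.
  have -> : nm (F b - F a) = complex.Re (rc (nm (F b - F a)) : R[i]) by [].
  rewrite -cE mulrBr /g.
  by move: (c * F b) (c * F a) => [? ?] [? ?].
rewrite gE ler_wpM2r ?subr_ge0 //.
apply: (le_trans (ler_norm _)); apply: (le_trans (Re_nm _)).
by rewrite nmM c1 mul1r; apply: fM; move: xab; rewrite in_itv.
Qed.

End Drv.

(** * Primitives and the theorem of Goursat *)

Section Primitive.
Variable R : realType.
Local Notation C := (Cplx R).
Local Notation rc := (@rc R).
Local Notation nm := (@nm R).

Lemma nm_ReIm (z : C) : nm z <= `|complex.Re (z : R[i])| + `|complex.Im (z : R[i])|.
Proof.
rewrite -(@nmrc R (complex.Re _)) -(@nmrc R (complex.Im _)).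
have {1}-> : z = rc (complex.Re (z : R[i])) + (Complex 0 1 : R[i]) * rc (complex.Im (z : R[i])).
  case: z => a b.
  transitivity (Complex (a + (0 * b - 1 * 0)) (0 + (0 * 0 + 1 * b)) : R[i]) => //.
  by congr Complex; ring.
apply: (le_trans (nmD _ _)); rewrite nmM lerD2l.
by rewrite /nm /= expr0n expr1n add0r sqrtr1 mul1r.
Qed.

Lemma Im_nm (z : C) : `|complex.Im (z : R[i])| <= nm z.
Proof.
have -> : nm z = nm (- (z * (Complex 0 1 : R[i]))).
  by rewrite nmN nmM /nm /= expr0n expr1n add0r sqrtr1 mulr1.
apply: le_trans (Re_nm _); case: z => a b.
by rewrite /= mulr0 sub0r opprK mulr1.
Qed.

(** The base point -1 of the integral makes every t >= 0 an interior point,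
where the derivative is two-sided. *)
Lemma real_primitive (f : R -> R) : (forall t, {for t, continuous f}) ->
  exists F : R -> R, forall t : R, 0 <= t -> is_derive t (1 : R) F (f t).
Proof.
move=> fc; pose F x := (\int[lebesgue_measure]_(t in [set` `[(-1 : R), x]]) (f t))%R.
exists F => t t0.
have t1 : t < t + 1 by rewrite ltrDl.
have fi : lebesgue_measure.-integrable `[-1, t + 1] (EFin \o f).
  apply: continuous_compact_integrable; first exact: segment_compact.
  by apply: continuous_subspaceT => x; exact: fc.
have t2 : -1 < t by lra.
have [dF dFE] := continuous_FTC1_closed t1 fi t2 (fc t).
by split; [exact: dF|rewrite -derive1E].
Qed.

Lemma rd_cont (f : R -> C) t d : drv rc f t d -> forall e : R, 0 < e ->
  exists2 r : R, 0 < r & forall s, `|s - t| < r -> nm (f s - f t) < e.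
Proof.
move=> df e e0; have [r r0 H] := drv_cont df e0; exists r => // s.
by rewrite -nmrc rmorphB; exact: H.
Qed.

Lemma primitive (f : R -> C) : (forall t, exists d, drv rc f t d) ->
  exists F : R -> C, forall t, 0 <= t -> drv rc F t (f t).
Proof.
move=> df.
have [|F1 dF1] := @real_primitive (fun t => complex.Re (f t : R[i])).
  move=> t; have [d H] := df t; apply/cvgrPdist_lt => e e0; have [r r0 rP] := rd_cont H e0.
  apply/nearR; exists r => // z /rP; apply: le_lt_trans.
  rewrite nmB; apply: le_trans (Re_nm _).
  by move: (f t) (f z) => [? ?] [? ?].
have [|F2 dF2] := @real_primitive (fun t => complex.Im (f t : R[i])).
  move=> t; have [d H] := df t; apply/cvgrPdist_lt => e e0; have [r r0 rP] := rd_cont H e0.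
  apply/nearR; exists r => // z /rP; apply: le_lt_trans.
  rewrite nmB; apply: le_trans (Im_nm _).
  by move: (f t) (f z) => [? ?] [? ?].
exists (fun t => Complex (F1 t) (F2 t) : R[i]) => t t0 e e0.
have e2 : 0 < e / 2 by rewrite divr_gt0.
have [r1 r10 H1] := (is_deriveP _ _ _).1 (dF1 t t0) _ e2.
have [r2 r20 H2] := (is_deriveP _ _ _).1 (dF2 t t0) _ e2.
exists (Num.min r1 r2); first by rewrite lt_min r10.
move=> s; rewrite -rmorphB nmrc lt_min => /andP[/H1 h1 /H2 h2].
apply: (le_trans (nm_ReIm _)).
move: (f t) h1 h2 => [a b] /=; rewrite !mulr0 subr0 add0r => h1 h2.
lra.
Qed.

Lemma rd_lip (F f : R -> C) (M : R) : 
  (forall t, drv rc F t (f t)) -> (forall t, nm (f t) <= M) ->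
  forall a b, nm (F b - F a) <= M * `|b - a|.
Proof.
move=> dF fM a b; have [ab|/ltW ba] := leP a b.
  by rewrite ger0_norm ?subr_ge0 //; apply: (@rd_mvi _ F f).
rewrite nmB distrC ger0_norm ?subr_ge0 //; exact: (@rd_mvi _ F f).
Qed.

Lemma cd_mvi (F f : C -> C) (a b : C) (M : R) :
  (forall t : R, 0 <= t <= 1 -> drv id F (a + rc t * (b - a)) (f (a + rc t * (b - a)))) ->
  (forall t : R, 0 <= t <= 1 -> nm (f (a + rc t * (b - a))) <= M) ->
  nm (F b - F a) <= M * nm (b - a).
Proof.
move=> dF fM.
have := @rd_mvi _ (fun t => F (a + rc t * (b - a)))
  (fun t => f (a + rc t * (b - a)) * (b - a)) 0 1 (M * nm (b - a)) ler01.
rewrite rmorph1 rmorph0 mul0r mul1r addr0 subr0 mulr1.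
have -> : a + (b - a) = b by ring.
apply.
  move=> t /dF h.
  have := drv_comp (drvD (drv_cst rc a t) (drvM (drv_id rc t) (drv_cst rc (b - a) t))) h.
  by rewrite mulr0 addr0 mul1r add0r.
by move=> t /fM h; rewrite nmM ler_wpM2r ?nm_ge0.
Qed.

End Primitive.

Lemma nested_intervals (R : realType) (a l : nat -> R) :
  (forall n, [/\ 0 <= l n, a n <= a n.+1 & a n.+1 + l n.+1 <= a n + l n]) ->
  exists X, forall n, a n <= X <= a n + l n.
Proof.
move=> h; have nest n m : a n <= a (n + m)%N /\ a (n + m)%N + l (n + m)%N <= a n + l n.
  elim: m => [|m [i1 i2]]; first by rewrite addn0.
  by rewrite addnS; have [_ j1 j2] := h (n + m)%N; split; lra.
have ord n m : a n <= a m + l m.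
  have [nm|/ltnW mn] := leqP n m.
    by have [h1 _] := nest n (m - n)%N; have [h2 _ _] := h m; rewrite subnKC // in h1; lra.
  by have [_ h1] := nest m (n - m)%N; have [h2 _ _] := h n; rewrite subnKC // in h1; lra.
exists (sup (range a)) => n; apply/andP; split.
  by apply: ub_le_sup; [exists (a 0%N + l 0%N) => _ [m _ <-]|exists n].
by apply: ge_sup; [exists (a 0%N), 0%N|move=> _ [m _ <-]].
Qed.

Section Goursat.
Variable R : realType.
Local Notation C := (Cplx R).
Local Notation rc := (@rc R).
Local Notation nm := (@nm R).

Variables (k : C -> C) (H H1 H2 : R -> R -> C) (B : R) (Phi Psi : R -> R -> C).
Hypothesis dH1 : forall u v, drv rc (H^~ v) u (H1 u v).
Hypothesis dH2 : forall u v, drv rc (H u) v (H2 u v).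
Hypothesis B0 : 0 < B.
Hypothesis H1B : forall u v, nm (H1 u v) <= B.
Hypothesis H2B : forall u v, nm (H2 u v) <= B.
Hypothesis dk : forall u v, exists d, drv id k (H u v) d.
Hypothesis dPhi : forall v u : R, 0 <= u -> drv rc (Phi v) u (k (H u v) * H1 u v).
Hypothesis dPsi : forall u v : R, 0 <= v -> drv rc (Psi u) v (k (H u v) * H2 u v).

(** The integral of k dw over the image under H of the boundary of the square
with lower left corner (p, q) and side l, as increments of primitives along the
four sides. *)
Definition square_int p q l := (Phi q (p + l) - Phi q p) + (Psi (p + l) (q + l) - Psi (p + l) q)
  - (Phi (q + l) (p + l) - Phi (q + l) p) - (Psi p (q + l) - Psi p q).

Lemma H_lip u v p q : nm (H u v - H p q) <= B * (`|u - p| + `|v - q|).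
Proof.
apply: (le_trans (nm_tri _ (H p v) _)); rewrite mulrDr; apply: lerD.
  exact: (@rd_lip _ (H^~ v) (H1^~ v)).
exact: (@rd_lip _ (H p) (H2 p)).
Qed.

(** The affine part of k at H p q has a primitive K, whose increments along the
sides cancel; the remainder is o(l) on sides of length O(l). *)
Lemma square_int_local (p q e : R) : 0 <= p -> 0 <= q -> 0 < e -> exists2 r : R, 0 < r &
  forall p' q' l, 0 <= p' -> 0 <= q' -> p' <= p <= p' + l -> q' <= q <= q' + l -> l < r ->
    nm (square_int p' q' l) <= e * l ^+ 2.
Proof.
move=> p0 q0 e0; have [d dkw] := dk p q; set w := H p q in dkw.
have e80 : 0 < e / (8 * B ^+ 2) by rewrite divr_gt0 // mulr_gt0 // exprn_gt0.
have [r r0 rP] := dkw _ e80.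
exists (r / (2 * B)); first by rewrite divr_gt0 // mulr_gt0.
move=> p' q' l p'0 q'0 /andP[pp1 pp2] /andP[qq1 qq2] lr.
have l0 : 0 <= l by lra.
pose K z := k w * z + d / 2 * ((z - w) * (z - w)).
have dK z : drv id K z (k w + d * (z - w)).
  have h : drv id (fun z => z - w) z 1.
    by apply: drv_eq (drvB (drv_id id z) (drv_cst id w z)) _; rewrite subr0.
  apply: drv_eq (drvD (drvZ (k w) (drv_id id z)) (drvZ (d / 2) (drvM h h))) _.
  by rewrite mulr1 mul1r mulr1; field.
have est u v : p' <= u <= p' + l -> q' <= v <= q' + l ->
  nm (k (H u v) - (k w + d * (H u v - w))) <= e / (4 * B) * l.
  move=> /andP[u1 u2] /andP[v1 v2].
  have hl : nm (H u v - w) <= B * (2 * l).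
    apply: (le_trans (H_lip _ _ _ _)); rewrite ler_pM2l //.
    have : `|u - p| <= l by rewrite ler_norml; apply/andP; split; lra.
    have : `|v - q| <= l by rewrite ler_norml; apply/andP; split; lra.
    lra.
  have hr : nm (H u v - w) < r.
    apply: le_lt_trans hl _; move: lr; rewrite ltr_pdivlMr ?mulr_gt0 //; lra.
  rewrite opprD addrA; apply: (le_trans (rP _ hr)).
  apply: (@le_trans _ _ (e / (8 * B ^+ 2) * (B * (2 * l)))).
    by rewrite ler_pM2l.
  by rewrite le_eqVlt; apply/orP; left; apply/eqP; field; rewrite gt_eqF.
have side (F c c' : R -> C) t0 :
    (forall t, t0 <= t <= t0 + l -> drv rc F t (k (c t) * c' t)) ->
    (forall t, drv rc c t (c' t)) -> (forall t, nm (c' t) <= B) ->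
    (forall t, t0 <= t <= t0 + l -> nm (k (c t) - (k w + d * (c t - w))) <= e / (4 * B) * l) ->
    nm ((F (t0 + l) - F t0) - (K (c (t0 + l)) - K (c t0))) <= e / 4 * l ^+ 2.
  move=> dF dc cB ce.
  have -> : (F (t0 + l) - F t0) - (K (c (t0 + l)) - K (c t0)) =
     (F (t0 + l) - K (c (t0 + l))) - (F t0 - K (c t0)) by ring.
  have := @rd_mvi _ (fun t => F t - K (c t))
    (fun t => (k (c t) - (k w + d * (c t - w))) * c' t) t0 (t0 + l) (e / 4 * l).
  rewrite [_ + l - _]addrC addKr expr2 mulrA; apply; first lra.
    by move=> t ht; rewrite mulrBl; apply: drvB; [exact: dF|exact: drv_comp (dc t) (dK _)].
  move=> t ht; rewrite nmM; apply: (le_trans (ler_pM (nm_ge0 _) (nm_ge0 _) (ce _ ht) (cB _))).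
  by rewrite le_eqVlt; apply/orP; left; apply/eqP; field; rewrite gt_eqF.
have side1 v : q' <= v <= q' + l ->
  nm ((Phi v (p' + l) - Phi v p') - (K (H (p' + l) v) - K (H p' v))) <= e / 4 * l ^+ 2.
  move=> hv; apply: (side (Phi v) (H^~ v) (H1^~ v)) => // t ht; last exact: est.
  by apply: dPhi; lra.
have side2 u : p' <= u <= p' + l ->
  nm ((Psi u (q' + l) - Psi u q') - (K (H u (q' + l)) - K (H u q'))) <= e / 4 * l ^+ 2.
  move=> hu; apply: (side (Psi u) (H u) (H2 u)) => // t ht; last exact: est.
  by apply: dPsi; lra.
have hp : p' <= p' <= p' + l by lra.
have hpl : p' <= p' + l <= p' + l by lra.
have hq : q' <= q' <= q' + l by lra.
have hql : q' <= q' + l <= q' + l by lra.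
have [s1 s2] := (side1 _ hq, side2 _ hpl); have [s3 s4] := (side1 _ hql, side2 _ hp).
pose A1 := (Phi q' (p' + l) - Phi q' p') - (K (H (p' + l) q') - K (H p' q')).
pose A2 := (Psi (p' + l) (q' + l) - Psi (p' + l) q') - (K (H (p' + l) (q' + l)) - K (H (p' + l) q')).
pose A3 := (Phi (q' + l) (p' + l) - Phi (q' + l) p') - (K (H (p' + l) (q' + l)) - K (H p' (q' + l))).
pose A4 := (Psi p' (q' + l) - Psi p' q') - (K (H p' (q' + l)) - K (H p' q')).
have -> : square_int p' q' l = A1 + A2 - A3 - A4 by rewrite /square_int /A1 /A2 /A3 /A4; ring.
have t1 := nmD (A1 + A2 - A3) (- A4); have t2 := nmD (A1 + A2) (- A3).
have t3 := nmD A1 A2; rewrite !nmN in t1 t2.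
rewrite -/A1 in s1; rewrite -/A2 in s2; rewrite -/A3 in s3; rewrite -/A4 in s4.
lra.
Qed.

Lemma square_int_split p q l : square_int p q l = square_int p q (l / 2) + square_int (p + l / 2) q (l / 2)
  + square_int p (q + l / 2) (l / 2) + square_int (p + l / 2) (q + l / 2) (l / 2).
Proof.
have lE x : x + l / 2 + l / 2 = x + l by field.
by rewrite /square_int !lE; ring.
Qed.

(** Quadrisection: if the integral over a square exceeds c l^2, so does the
integral over one of its quarters; the nested squares shrink to a point where
this contradicts the local estimate. H replaces the usual inclusion of a
rectangle, so that a circle can be contracted directly. *)
Lemma goursat (p q l : R) : 0 <= p -> 0 <= q -> 0 < l -> square_int p q l = 0.
Proof.
move=> p0 q0 l0; apply/eqP; rewrite -nm_eq0; apply/negPn/negP => N0.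
have {}N0 : 0 < nm (square_int p q l) by rewrite lt_neqAle eq_sym N0 nm_ge0.
pose c := nm (square_int p q l) / (2 * l ^+ 2).
have c0 : 0 < c by rewrite divr_gt0 // mulr_gt0 ?exprn_gt0.
(* a square is a triple (p, q, l) *)
pose big (s : R * R * R) := c * s.2 ^+ 2 < nm (square_int s.1.1 s.1.2 s.2).
pose sub (s s' : R * R * R) := [/\ s'.2 = s.2 / 2, 
  s.1.1 <= s'.1.1 <= s.1.1 + s.2 / 2 & s.1.2 <= s'.1.2 <= s.1.2 + s.2 / 2].
have step s : exists s', 0 < s.2 -> big s -> big s' /\ sub s s'.
  case: s => [[x y] m]; rewrite /big /sub /=.
  have [m0|m0] := leP m 0; first by exists (0, 0, 0).
  set cm := c * (m / 2) ^+ 2.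
  have cE : c * m ^+ 2 = cm + cm + cm + cm by rewrite /cm; field.
  have [h1|h1] := ltP cm (nm (square_int x y (m / 2))).
    by exists (x, y, m / 2) => _ _ /=; split=> //; split => //; lra.
  have [h2|h2] := ltP cm (nm (square_int (x + m / 2) y (m / 2))).
    by exists (x + m / 2, y, m / 2) => _ _ /=; split=> //; split => //; lra.
  have [h3|h3] := ltP cm (nm (square_int x (y + m / 2) (m / 2))).
    by exists (x, y + m / 2, m / 2) => _ _ /=; split=> //; split => //; lra.
  exists (x + m / 2, y + m / 2, m / 2) => _ hb /=; split; last by split => //; lra.
  move: hb; rewrite square_int_split cE => hb.
  have t1 := nmD (square_int x y (m / 2) + square_int (x + m / 2) y (m / 2) + square_int x (y + m / 2) (m / 2))
    (square_int (x + m / 2) (y + m / 2) (m / 2)).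
  have t2 := nmD (square_int x y (m / 2) + square_int (x + m / 2) y (m / 2)) (square_int x (y + m / 2) (m / 2)).
  have t3 := nmD (square_int x y (m / 2)) (square_int (x + m / 2) y (m / 2)).
  by rewrite -/cm; lra.
have [nxt nxtP] := choice step.
pose s n := iter n nxt (p, q, l).
have sP n : 0 < (s n).2 /\ big (s n).
  elim: n => [|n [h1 h2]].
    split=> //; rewrite /big /=.
    have -> : c * l ^+ 2 = nm (square_int p q l) / 2 by rewrite /c; field; rewrite gt_eqF.
    lra.
  by have [h3 [h4 _ _]] := nxtP _ h1 h2; rewrite /s iterS h4 divr_gt0.
have sS n : sub (s n) (s n.+1) by have [h1 h2] := sP n; have [] := nxtP _ h1 h2.
have sl n : (s n).2 = l / 2 ^+ n.
  elim: n => [|n IH]; first by rewrite expr0 divr1.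
  by have [-> _ _] := sS n; rewrite IH exprS; field; rewrite expf_neq0 ?pnatr_eq0.
have [X Xn] : exists X, forall n, (s n).1.1 <= X <= (s n).1.1 + (s n).2.
  by apply: nested_intervals => n; have [h1 _] := sP n; have [h2 /andP[h3 h4] _] := sS n; split; lra.
have [Y Yn] : exists Y, forall n, (s n).1.2 <= Y <= (s n).1.2 + (s n).2.
  by apply: nested_intervals => n; have [h1 _] := sP n; have [h2 _ /andP[h3 h4]] := sS n; split; lra.
have s0 n : 0 <= (s n).1.1 /\ 0 <= (s n).1.2.
  elim: n => [|n [h1 h2]]; first by [].
  by have [_ /andP[h3 _] /andP[h4 _]] := sS n; split; [exact: le_trans h3|exact: le_trans h4].
have X0 : 0 <= X by have /andP[h _] := Xn 0%N; exact: le_trans h.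
have Y0 : 0 <= Y by have /andP[h _] := Yn 0%N; exact: le_trans h.
have [r r0 rP] := square_int_local X0 Y0 c0.
have [n nP] : exists n, (s n).2 < r.
  exists (Num.truncn (l / r)).+1; rewrite sl ltr_pdivrMr ?exprn_gt0 //.
  rewrite mulrC -ltr_pdivrMr //; apply: lt_trans (truncnS_gt _) _.
  by rewrite -natrX ltr_nat ltn_expl.
have [s1 s2] := s0 n; have [_] := sP n; rewrite /big ltNge => /negP; apply.
exact: rP.
Qed.

End Goursat.

(** * Integrals over a circle *)

Section Circle.
Variable R : realType.
Local Notation C := (Cplx R).
Local Notation rc := (@rc R).
Local Notation nm := (@nm R).

Definition ic : C := Complex 0 1 : R[i].
Definition ei (v : R) : C := Complex (cos v) (sin v) : R[i].

Lemma nm_ic : nm ic = 1.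
Proof. by rewrite /nm /= expr0n expr1n add0r sqrtr1. Qed.

Lemma nm_ei v : nm (ei v) = 1.
Proof. by rewrite /nm /= cos2Dsin2 sqrtr1. Qed.

Lemma ei_2pi : ei (pi *+ 2) = ei 0.
Proof. by rewrite /ei cos2pi sin2pi cos0 sin0. Qed.

Lemma drv_ReIm (F : R -> C) (f : R -> C) t :
  is_derive t (1 : R) (fun s => complex.Re (F s : R[i])) (complex.Re (f t : R[i])) ->
  is_derive t (1 : R) (fun s => complex.Im (F s : R[i])) (complex.Im (f t : R[i])) ->
  drv rc F t (f t).
Proof.
move=> h1 h2 e e0; have e2 : 0 < e / 2 by rewrite divr_gt0.
have [r1 r10 H1] := (is_deriveP _ _ _).1 h1 _ e2.
have [r2 r20 H2] := (is_deriveP _ _ _).1 h2 _ e2.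
exists (Num.min r1 r2); first by rewrite lt_min r10.
move=> s; rewrite -rmorphB nmrc lt_min => /andP[/H1 {}h1 /H2 {}h2].
apply: (le_trans (nm_ReIm _)).
move: (F s) (F t) (f t) h1 h2 => [c c'] [d d'] [a b] /=.
rewrite !mulr0 subr0 add0r => h1 h2; lra.
Qed.

Lemma drv_ei v : drv rc ei v (ic * ei v).
Proof.
have E t : ic * ei t = Complex (- sin t) (cos t) :> R[i].
  transitivity (Complex (0 * cos t - 1 * sin t) (0 * sin t + 1 * cos t) : R[i]) => //.
  by congr Complex; ring.
apply: (@drv_ReIm ei (fun v => ic * ei v)); rewrite E /=.
  exact: is_derive_cos.
exact: is_derive_sin.
Qed.

(** The integral over one turn, as the increment of some primitive; the value 0
is only taken when there is no primitive. *)
Definition circ (phi : R -> C) : C :=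
  if pselect (exists F : R -> C, forall v : R, 0 <= v -> drv rc F v (phi v)) is left h
  then sval (cid h) (pi *+ 2) - sval (cid h) 0 else 0.

Let pi2 : 0 <= pi *+ 2 :> R.
Proof. by rewrite mulrn_wge0 // ltW // pi_gt0. Qed.

Lemma circE (phi F : R -> C) : (forall v : R, 0 <= v -> drv rc F v (phi v)) ->
  circ phi = F (pi *+ 2) - F 0.
Proof.
move=> dF; rewrite /circ; case: pselect => [h|[]]; last by exists F.
case: cid => G /= dG; apply: nm_le0.
have -> : G (pi *+ 2) - G 0 - (F (pi *+ 2) - F 0) =
  (G (pi *+ 2) - F (pi *+ 2)) - (G 0 - F 0) by ring.
have := @rd_mvi R (fun v => G v - F v) (fun v => phi v - phi v) 0 (pi *+ 2) 0 pi2.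
rewrite mul0r; apply => t /andP[t0 _]; last by rewrite subrr nm0.
by apply: drvB; [exact: dG|exact: dF].
Qed.

Definition rdiff (phi : R -> C) := forall t, exists d, drv rc phi t d.

Lemma rdiffP (phi : R -> C) : rdiff phi -> exists F : R -> C, 
   (forall v : R, 0 <= v -> drv rc F v (phi v)) /\ circ phi = F (pi *+ 2) - F 0.
Proof. by move=> /primitive[F dF]; exists F; split => //; exact: circE. Qed.

Lemma rdiffD f g : rdiff f -> rdiff g -> rdiff (fun v => f v + g v).
Proof.
move=> hf hg t; have [d h] := hf t; have [d' h'] := hg t.
by exists (d + d'); exact: drvD.
Qed.
Lemma rdiffM f g : rdiff f -> rdiff g -> rdiff (fun v => f v * g v).
Proof.
move=> hf hg t; have [d h] := hf t; have [d' h'] := hg t.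
by exists (d * g t + f t * d'); exact: drvM.
Qed.
Lemma rdiff_cst c : rdiff (fun=> c).
Proof. by move=> t; exists 0; exact: drv_cst. Qed.
Lemma rdiffV f : (forall v, f v != 0) -> rdiff f -> rdiff (fun v => (f v)^-1).
Proof. by move=> f0 h t; have [d hd] := h t; exists (- (d / (f t * f t))); exact: drvV. Qed.
Lemma rdiffX f n : rdiff f -> rdiff (fun v => f v ^+ n).
Proof.
move=> h; elim: n => [|n IH].
  by under eq_fun do rewrite expr0; exact: rdiff_cst.
by under eq_fun do rewrite exprS; exact: rdiffM.
Qed.
Lemma rdiff_ei : rdiff ei.
Proof. by move=> t; exists (ic * ei t); exact: drv_ei. Qed.

Lemma circD f g : rdiff f -> rdiff g -> circ (fun v => f v + g v) = circ f + circ g.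
Proof.
move=> /rdiffP[F [dF ->]] /rdiffP[G [dG ->]].
rewrite (@circE _ (fun v => F v + G v)); first by ring.
by move=> v v0; apply: drvD; [exact: dF|exact: dG].
Qed.

Lemma circZ c f : rdiff f -> circ (fun v => c * f v) = c * circ f.
Proof.
move=> /rdiffP[F [dF ->]].
rewrite (@circE _ (fun v => c * F v)); first by ring.
by move=> v v0; apply: drvZ; exact: dF.
Qed.

Lemma circ_le f M : rdiff f -> (forall v, 0 <= v <= pi *+ 2 -> nm (f v) <= M) ->
  nm (circ f) <= M * (pi *+ 2).
Proof.
move=> /rdiffP[F [dF ->]] fM; rewrite -[X in _ * X]subr0.
by apply: (@rd_mvi _ F f) => // t /andP[t0 _]; exact: dF.
Qed.

Lemma rdiff_bounded f (b : R) : 0 <= b -> rdiff f ->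
  exists2 M, 0 <= M & forall v, 0 <= v <= b -> nm (f v) <= M.
Proof.
move=> b0 df; have cf : {within `[0, b], continuous (fun v => nm (f v))}.
  apply: continuous_subspaceT => x; apply/cvgrPdist_lt => e e0.
  have [d hd] := df x; have [r r0 rP] := rd_cont hd e0.
  apply/nearR; exists r => // z /rP; apply: le_lt_trans.
  rewrite ler_norml; have := nm_sub (f z) (f x); have := nm_sub (f x) (f z).
  by rewrite (nmB (f x)) => h1 h2; apply/andP; split; lra.
have [c _ cM] := EVT_max b0 cf.
by exists (nm (f c)); [exact: nm_ge0|move=> v hv; apply: cM; rewrite in_itv].
Qed.

(** Differentiation under the integral sign, from a second order bound that is
uniform over the circle. *)
Lemma circ_drv (g : C -> R -> C) (g' : R -> C) (b : C) (A r : R) : 0 < r ->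
  (forall w, nm (w - b) < r -> rdiff (g w)) -> rdiff g' ->
  (forall w v, nm (w - b) < r -> 0 <= v <= pi *+ 2 ->
     nm (g w v - g b v - g' v * (w - b)) <= A * nm (w - b) ^+ 2) ->
  drv id (fun w => circ (g w)) b (circ g').
Proof.
move=> r0 dg dg' est e e0.
have p0 : 0 < pi *+ 2 :> R by rewrite mulrn_wgt0 // pi_gt0.
pose A' := `|A| + 1.
have A0 : 0 < A' by rewrite ltr_wpDl.
exists (Num.min r (e / (A' * (pi *+ 2)))).
  by rewrite lt_min r0 divr_gt0 // mulr_gt0.
move=> w; rewrite lt_min => /andP[wr we].
have db := dg b; rewrite subrr nm0 in db.
have -> : circ (g w) - circ (g b) - circ g' * (w - b) =
  circ (fun v => g w v + (-1) * g b v + (- (w - b)) * g' v).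
  have h1 := dg _ wr; have h2 := db r0.
  have c1 := @rdiff_cst (-1); have c2 := @rdiff_cst (- (w - b)).
  rewrite circD; [|exact: rdiffD h1 (rdiffM c1 h2)|exact: rdiffM].
  rewrite circD //; last exact: rdiffM.
  by rewrite !circZ //; ring.
apply: (@le_trans _ _ (A' * nm (w - b) ^+ 2 * (pi *+ 2))).
  apply: circ_le.
    apply: rdiffD; first apply: rdiffD; [exact: dg|apply: rdiffM|apply: rdiffM] => //.
    - exact: rdiff_cst.
    - exact: db.
    exact: rdiff_cst.
  move=> v hv.
  have -> : g w v + -1 * g b v + - (w - b) * g' v = g w v - g b v - g' v * (w - b) by ring.
  apply: (le_trans (est _ _ wr hv)); rewrite ler_wpM2r ?exprn_ge0 ?nm_ge0 //.
  by apply: (le_trans (ler_norm _)); rewrite lerDl.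
rewrite /= expr2; move: we; rewrite ltr_pdivlMr ?mulr_gt0 // => we.
have -> : A' * (nm (w - b) * nm (w - b)) * (pi *+ 2) = (nm (w - b) * (A' * (pi *+ 2))) * nm (w - b) by ring.
by rewrite ler_wpM2r ?nm_ge0 // ltW.
Qed.

Section Kernel.
Variables (a : C) (r : R) (psi : R -> C).
Hypothesis r0 : 0 < r.
Hypothesis dpsi : rdiff psi.

Definition zt v := a + rc r * ei v.

Lemma zt_a v : nm (zt v - a) = r.
Proof. by rewrite /zt addrAC subrr add0r nmM nm_ei nmrc mulr1 gtr0_norm. Qed.

Lemma zt_b b v : r - nm (b - a) <= nm (zt v - b).
Proof. have := nm_tri (zt v) b a; rewrite zt_a; lra. Qed.

Lemma zt_neq b v : nm (b - a) < r -> zt v - b != 0.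
Proof. by move=> h; rewrite -nm_gt0; have := zt_b b v; lra. Qed.

Lemma rdiff_zt : rdiff zt.
Proof. by apply: rdiffD; [exact: rdiff_cst|apply: rdiffM; [exact: rdiff_cst|exact: rdiff_ei]]. Qed.

Lemma rdiff_ker b n : nm (b - a) < r -> rdiff (fun v => psi v / (zt v - b) ^+ n).
Proof.
move=> hb; apply: rdiffM => //; apply: rdiffV.
  by move=> v; rewrite expf_neq0 // zt_neq.
by apply: rdiffX; apply: rdiffD; [exact: rdiff_zt|exact: rdiff_cst].
Qed.

Lemma near_ker b w v (rho := r - nm (b - a)) : nm (b - a) < r -> nm (w - b) < rho / 2 ->
  [/\ nm (w - a) < r, (nm (zt v - w))^-1 <= 2 / rho & (nm (zt v - b))^-1 <= 2 / rho].
Proof.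
move=> hb hw; have rho0 : 0 < rho by rewrite subr_gt0.
have h1 : nm (w - a) < r by have := nm_tri w b a; rewrite /rho in rho0 hw *; lra.
split=> //.
  have h : rho / 2 <= nm (zt v - w).
    by have := nm_tri (zt v) w a; have := nm_tri w b a; rewrite zt_a /rho in rho0 hw *; lra.
  have -> : 2 / rho = (rho / 2)^-1 by field; rewrite gt_eqF.
  by rewrite lef_pV2 ?posrE ?divr_gt0 //; apply: lt_le_trans h; rewrite divr_gt0.
have h : rho / 2 <= nm (zt v - b) by have := zt_b b v; rewrite /rho in rho0 *; lra.
have -> : 2 / rho = (rho / 2)^-1 by field; rewrite gt_eqF.
by rewrite lef_pV2 ?posrE ?divr_gt0 //; apply: lt_le_trans h; rewrite divr_gt0.
Qed.

(** A Cauchy integral is differentiable whatever the continuous density;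
together with the next lemma this shows that the derivative of a holomorphic
function is holomorphic. *)
Lemma ker1_drv b : nm (b - a) < r ->
  drv id (fun w => circ (fun v => psi v / (zt v - w) ^+ 1)) b (circ (fun v => psi v / (zt v - b) ^+ 2)).
Proof.
move=> hb; have [M M0 psiM] := rdiff_bounded pi2 dpsi.
set rho := r - nm (b - a); have rho0 : 0 < rho by rewrite subr_gt0.
apply: (@circ_drv _ _ _ (M * ((2 / rho) * (2 / rho) ^+ 2)) (rho / 2)).
- by rewrite divr_gt0.
- by move=> w hw; apply: rdiff_ker; have [] := near_ker 0 hb hw.
- exact: rdiff_ker.
move=> w v hw hv; have [wa h1 h2] := near_ker v hb hw.
have [n1 n2] := (zt_neq v wa, zt_neq v hb).
have -> : psi v / (zt v - w) ^+ 1 - psi v / (zt v - b) ^+ 1 - psi v / (zt v - b) ^+ 2 * (w - b) =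
  psi v * ((zt v - w)^-1 * (zt v - b)^-1 ^+ 2) * (w - b) ^+ 2.
  by field; rewrite n1 n2.
rewrite 3!nmM 2!nmX 2!nmV; apply: ler_wpM2r; first by rewrite exprn_ge0 ?nm_ge0.
apply: ler_pM; rewrite ?mulr_ge0 ?exprn_ge0 ?invr_ge0 ?nm_ge0 //; first exact: psiM.
apply: ler_pM; rewrite ?exprn_ge0 ?invr_ge0 ?nm_ge0 //.
by rewrite lerXn2r ?nnegrE ?invr_ge0 ?nm_ge0 // divr_ge0 // ltW.
Qed.

Lemma ker2_drv b : nm (b - a) < r ->
  drv id (fun w => circ (fun v => psi v / (zt v - w) ^+ 2)) b (circ (fun v => 2 * (psi v / (zt v - b) ^+ 3))).
Proof.
move=> hb; have [M M0 psiM] := rdiff_bounded pi2 dpsi.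
set rho := r - nm (b - a); have rho0 : 0 < rho by rewrite subr_gt0.
have [q0 rho2] : 0 <= 2 / rho /\ 0 < rho / 2 by rewrite !divr_ge0 ?divr_gt0 // ltW.
apply: (@circ_drv _ _ _ (M * ((2 / rho) ^+ 2 * (2 / rho) ^+ 2 + 2 * ((2 / rho) * (2 / rho) ^+ 3))) (rho / 2)) => //.
- by move=> w hw; apply: rdiff_ker; have [] := near_ker 0 hb hw.
- by apply: rdiffM; [exact: rdiff_cst|exact: rdiff_ker].
move=> w v hw hv; have [wa h1 h2] := near_ker v hb hw.
have [n1 n2] := (zt_neq v wa, zt_neq v hb).
have -> : psi v / (zt v - w) ^+ 2 - psi v / (zt v - b) ^+ 2 - 2 * (psi v / (zt v - b) ^+ 3) * (w - b) =
  psi v * ((zt v - w)^-1 ^+ 2 * (zt v - b)^-1 ^+ 2 + 2 * ((zt v - w)^-1 * (zt v - b)^-1 ^+ 3)) * (w - b) ^+ 2.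
  by field; rewrite n1 n2.
rewrite 2!nmM [nm ((w - b) ^+ 2)]nmX; apply: ler_wpM2r; first by rewrite exprn_ge0 ?nm_ge0.
apply: ler_pM; rewrite ?nm_ge0 //; first exact: psiM.
have i1 : 0 <= nm (zt v - w)^-1 by exact: nm_ge0.
have i2 : 0 <= nm (zt v - b)^-1 by exact: nm_ge0.
have n2_ : nm (2 : C) = 2 by have := @nmrc R 2; rewrite rmorph_nat => ->; rewrite ger0_norm.
rewrite -nmV in h1; rewrite -nmV in h2.
apply: (le_trans (nmD _ _)); rewrite [nm (_ ^+ 2 * _)]nmM [nm (2 * _)]nmM [nm (_ * _ ^+ 3)]nmM !nmX n2_; apply: lerD.
  by apply: ler_pM; rewrite ?exprn_ge0 // lerXn2r.
by rewrite ler_pM2l //; apply: ler_pM; rewrite ?exprn_ge0 // lerXn2r.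
Qed.

End Kernel.
End Circle.

(** * The Cauchy formula *)

Section Cauchy.
Variable R : realType.
Local Notation C := (Cplx R).
Local Notation rc := (@rc R).
Local Notation nm := (@nm R).
Local Notation zt := (@zt R).
Local Notation ic := (ic R).

Definition dz (r : R) (v : R) : C := rc r * (ic * ei v).

Lemma drv_zt a r v : drv rc (zt a r) v (dz r v).
Proof. by apply: drv_eq (drvD (drv_cst rc a v) (drvZ (rc r) (drv_ei v))) _; rewrite add0r. Qed.

Lemma rdiff_dz r : rdiff (dz r).
Proof.
apply: rdiffM; first exact: rdiff_cst.
by apply: rdiffM; [exact: rdiff_cst|exact: rdiff_ei].
Qed.

Lemma nm_dz r v : 0 < r -> nm (dz r v) = r.
Proof. by move=> r0; rewrite /dz 2!nmM nm_ei nm_ic nmrc !mulr1 gtr0_norm. Qed.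

Definition W2pi : C := ic * rc (pi *+ 2).

Lemma W2pi_neq0 : W2pi != 0.
Proof.
have p0 : 0 < pi *+ 2 :> R by rewrite mulrn_wgt0 // pi_gt0.
by rewrite -nm_gt0 nmM nm_ic nmrc mul1r gtr0_norm.
Qed.

Lemma seg_ball (a b : C) (r t : R) : nm (b - a) < r -> 0 <= t <= 1 -> nm (a + rc t * (b - a) - a) < r.
Proof.
move=> h /andP[t0 t1]; rewrite addrAC subrr add0r nmM nmrc ger0_norm //.
by apply: le_lt_trans h; rewrite ler_piMl ?nm_ge0.
Qed.

(** The integral does not depend on b, since its derivative in b is the integral
of an exact form; at b = a it is computed directly. *)
Lemma circ_kernel a r b : 0 < r -> nm (b - a) < r ->
  circ (fun v => dz r v / (zt a r v - b) ^+ 1) = W2pi.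
Proof.
move=> r0 hb.
have E0 : circ (fun v => dz r v / (zt a r v - a) ^+ 1) = W2pi.
  have dF v : 0 <= v -> drv rc (fun v => ic * rc v) v (dz r v / (zt a r v - a) ^+ 1).
    move=> _; apply: drv_eq (drvZ ic (drv_id rc v)) _.
    rewrite /zt /dz addrAC subrr add0r mulr1 expr1 mulrCA mulfK //.
    by rewrite mulf_neq0 // -nm_gt0 ?nm_ei // nmrc gtr0_norm.
  by rewrite (circE dF) rmorph0 mulr0 subr0.
rewrite -[RHS]E0; apply: nm_le0.
have := @cd_mvi _ (fun b => circ (fun v => dz r v / (zt a r v - b) ^+ 1))
  (fun b => circ (fun v => dz r v / (zt a r v - b) ^+ 2)) a b 0.
rewrite mul0r; apply => t ht; first exact: (ker1_drv r0 (@rdiff_dz r) (seg_ball hb ht)).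
have hw := seg_ball hb ht; set w := a + _ in hw *.
have dF v : 0 <= v -> drv rc (fun v => - (zt a r v - w)^-1) v (dz r v / (zt a r v - w) ^+ 2).
  move=> _; have n0 := zt_neq r0 v hw.
  have h := drvN (drvV (f := fun v => zt a r v - w) n0 (drvB (drv_zt a r v) (drv_cst rc w v))).
  apply: drv_eq h _.
  by rewrite subr0 opprK expr2.
by rewrite (circE dF) /zt ei_2pi subrr nm0.
Qed.

Section Formula.
Variables (f : C -> C) (a b : C) (Rd r : R).
Hypothesis df : forall z, nm (z - a) < Rd -> exists d, drv id f z d.
Hypothesis r0 : 0 < r.
Hypothesis rRd : r < Rd.
Hypothesis hb : nm (b - a) < r.

Let zeta := zt a r.
Let dzeta := dz r.

Lemma rdiff_fzt : rdiff (fun v => f (zeta v) * dzeta v).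
Proof.
apply: rdiffM; last exact: rdiff_dz.
move=> t; have [|d hd] := df (z := zeta t); first by rewrite /zeta zt_a.
by exists (d * dzeta t); exact: drv_comp (drv_zt a r t) hd.
Qed.

Let p0 : 0 < pi *+ 2 :> R.
Proof. by rewrite mulrn_wgt0 // pi_gt0. Qed.

(* the contraction is w = b + T(u) (zeta - b), where T is smooth on the whole
   line, T(0) = 1, and T tends to 0 without vanishing *)
Let T (u : R) : C := rc ((1 + u * u)^-1).
Let T1 (u : R) : C := rc (- (u + u) * ((1 + u * u)^-1 * (1 + u * u)^-1)).

Let q0 u : 0 < 1 + u * u :> R.
Proof. by rewrite ltr_wpDr // -expr2 sqr_ge0. Qed.

Let T_drv u : drv rc T u (T1 u).
Proof.
have h : drv rc (fun u : R => 1 + rc u * rc u) u (rc (u + u)).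
  apply: drv_eq (drvD (drv_cst rc 1 u) (drvM (drv_id rc u) (drv_id rc u))) _.
  by rewrite add0r mul1r mulr1 rmorphD.
have E v : T v = (1 + rc v * rc v)^-1 by rewrite /T fmorphV rmorphD rmorph1 rmorphM.
rewrite (_ : T = fun v => (1 + rc v * rc v)^-1); last by apply/funext.
have n0 : 1 + rc u * rc u != 0.
  by have := q0 u; rewrite lt0r => /andP[+ _]; rewrite -(fmorph_eq0 rc) rmorphD rmorph1 rmorphM.
apply: drv_eq (drvV (f := fun u : R => 1 + rc u * rc u) n0 h) _.
have -> : 1 + rc u * rc u = rc (1 + u * u) by rewrite rmorphD rmorph1 rmorphM.
by rewrite /T1 mulNr rmorphN rmorphM rmorphM fmorphV invfM.
Qed.

Let T_bd (u : R) : (0 : R) < (1 + u * u)^-1 <= 1.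
Proof. by rewrite invr_gt0 q0 invf_le1 ?q0 // lerDl -expr2 sqr_ge0. Qed.

Let T1_bd u : nm (T1 u) <= 1.
Proof.
rewrite /T1 nmrc normrM normrN -invfM normfV.
have h : 0 < (1 + u * u) * (1 + u * u) by rewrite mulr_gt0.
rewrite (gtr0_norm h) ler_pdivrMr // mul1r.
have h1 : `|u + u| <= 1 + u * u.
  have := sqr_ge0 (u - 1); have := sqr_ge0 (u + 1).
  by rewrite ler_norml => h1 h2; apply/andP; split; lra.
apply: (le_trans h1); rewrite -[X in X <= _]mulr1 ler_pM2l //.
by rewrite lerDl -expr2 sqr_ge0.
Qed.

Let H (u v : R) : C := b + T u * (zeta v - b).

Let H_ball u v : nm (H u v - a) < Rd.
Proof.
have /andP[t0 t1] := T_bd u; set t := (1 + u * u)^-1 in t0 t1.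
have -> : H u v - a = (1 - rc t) * (b - a) + rc t * (zeta v - a) by rewrite /H /T -/t; ring.
apply: (le_lt_trans (nmD _ _)); rewrite !nmM -(rmorph1 rc) -rmorphB !nmrc /zeta zt_a //.
rewrite (gtr0_norm t0) ger0_norm ?subr_ge0 //.
apply: le_lt_trans rRd; have := nm_ge0 (b - a).
have h : (1 - t) * nm (b - a) <= (1 - t) * r by rewrite ler_wpM2l ?subr_ge0 // ltW.
lra.
Qed.

Let ztb_le v : nm (zeta v - b) <= 2 * r.
Proof.
have := nm_tri (zeta v) a b; rewrite /zeta zt_a // (nmB a) => h.
by apply: (le_trans h); rewrite mulr_natl mulr2n lerD2l ltW.
Qed.

Let ztb_neq v : zeta v - b != 0.
Proof. exact: zt_neq. Qed.

Let T_neq u : T u != 0.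
Proof. by rewrite /T fmorph_eq0; have /andP[] := T_bd u; case: ltgtP. Qed.

Let Hb_neq u v : H u v - b != 0.
Proof. by rewrite /H addrAC subrr add0r mulf_neq0. Qed.

Let dH1 u v : drv rc (H^~ v) u (T1 u * (zeta v - b)).
Proof.
apply: drv_eq (drvD (drv_cst rc b u) (drvM (T_drv u) (drv_cst rc (zeta v - b) u))) _.
by rewrite add0r mulr0 addr0.
Qed.

Let dH2 u v : drv rc (H u) v (T u * dzeta v).
Proof.
apply: drv_eq (drvD (drv_cst rc b v) (drvZ (T u) (drvB (drv_zt a r v) (drv_cst rc b v)))) _.
by rewrite add0r subr0.
Qed.

Let k w := f w / (w - b).

Let dk u v : exists d, drv id k (H u v) d.
Proof.
have [d hd] := df (H_ball u v).
eexists; apply: drvM hd _; apply: drvV; first exact: Hb_neq.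
exact: drvB (drv_id id _) (drv_cst id b _).
Qed.

Let kH u v : k (H u v) * (T u * dzeta v) = f (H u v) * (dzeta v / (zeta v - b) ^+ 1).
Proof.
have h := T_neq u; have h' := ztb_neq v.
have -> : k (H u v) = f (H u v) / (T u * (zeta v - b)).
  by rewrite /k; congr (_ / _); rewrite /H; ring.
move: (T u) (zeta v - b) (f (H u v)) (dzeta v) h h' => t z fz dv h h'.
by field; rewrite h h'.
Qed.

Let I u := circ (fun v => f (H u v) * (dzeta v / (zeta v - b) ^+ 1)).

Let dfH u : rdiff (fun v => f (H u v) * (dzeta v / (zeta v - b) ^+ 1)).
Proof.
apply: rdiffM; last exact: rdiff_ker r0 (@rdiff_dz r) _ _ hb.
move=> t; have [d hd] := df (H_ball u t).
by eexists; exact: drv_comp (dH2 u t) hd.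
Qed.

Let I_step u : 0 <= u -> I (u + pi *+ 2) = I u.
Proof.
move=> u0.
have /choice[Phi dPhi] : forall v, exists F : R -> C, forall u : R, 0 <= u ->
    drv rc F u (k (H u v) * (T1 u * (zeta v - b))).
  move=> v; apply: primitive => t.
  have h1 : exists d, drv rc (fun u => k (H u v)) t d.
    by have [d hd] := dk t v; eexists; exact: drv_comp (dH1 t v) hd.
  have h2 : exists d, drv rc (fun u => T1 u * (zeta v - b)) t d.
    have T1E : T1 = fun u => - (rc u + rc u) * (T u * T u).
      by apply/funext => s; rewrite /T1 rmorphM rmorphN rmorphD rmorphM.
    rewrite T1E; eexists; apply: drvM (drv_cst rc _ t).
    apply: drvM (drvN (drvD (drv_id rc t) (drv_id rc t))) _.
    exact: drvM (T_drv t) (T_drv t).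
  by have [d1 e1] := h1; have [d2 e2] := h2; eexists; exact: drvM e1 e2.
have /choice[Psi dPsi] : forall u, exists F : R -> C, forall v : R, 0 <= v ->
    drv rc F v (k (H u v) * (T u * dzeta v)).
  move=> w; apply: primitive => t.
  have := @dfH w t; rewrite (_ : (fun v => f (H w v) * _) = fun v => k (H w v) * (T w * dzeta v)) //.
  by apply/funext => v; rewrite kH.
have IE w : I w = Psi w (pi *+ 2) - Psi w 0.
  by rewrite -(circE (dPsi w)); congr circ; apply/funext => v; rewrite kH.
have B0 : 0 < 2 * r by rewrite mulr_gt0.
have H1B s v : nm (T1 s * (zeta v - b)) <= 2 * r.
  by rewrite nmM -[X in _ <= X]mul1r ler_pM ?nm_ge0.
have H2B s v : nm (T s * dzeta v) <= 2 * r.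
  rewrite nmM /dzeta nm_dz // nmrc; have /andP[h1 h2] := T_bd s.
  by rewrite gtr0_norm // ler_pM2r //; lra.
have := goursat dH1 dH2 B0 H1B H2B dk dPhi dPsi u0 (lexx 0) p0.
rewrite /square_int add0r -!IE => /eqP.
have -> : Phi (pi *+ 2) (u + pi *+ 2) - Phi (pi *+ 2) u = Phi 0 (u + pi *+ 2) - Phi 0 u.
  apply: nm_le0.
  have -> : Phi (pi *+ 2) (u + pi *+ 2) - Phi (pi *+ 2) u - (Phi 0 (u + pi *+ 2) - Phi 0 u) =
    (Phi (pi *+ 2) (u + pi *+ 2) - Phi 0 (u + pi *+ 2)) - (Phi (pi *+ 2) u - Phi 0 u) by ring.
  have := @rd_mvi R (fun u => Phi (pi *+ 2) u - Phi 0 u) (fun=> 0) u (u + pi *+ 2) 0.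
  rewrite mul0r; apply; [by rewrite lerDl ltW| |by move=> *; rewrite nm0].
  move=> t /andP[t1 _]; have t0 : 0 <= t by exact: le_trans u0 t1.
  apply: drv_eq (drvB (dPhi _ _ t0) (dPhi _ _ t0)) _.
  have E : zeta (pi *+ 2) = zeta 0 by rewrite /zeta /zt ei_2pi.
  by rewrite /H E subrr.
set A := Phi 0 _ - _; have -> : A + I (u + pi *+ 2) - A - I u = I (u + pi *+ 2) - I u by ring.
by rewrite subr_eq0 => /eqP.
Qed.

(** Contract the circle to b. The integral of f(w) / (w - b) is unchanged by
Goursat's theorem, because the two sides of the square that correspond to the
angles 0 and 2 pi have the same image; in the limit f(w) tends to f(b). *)
Lemma cauchy_formula : circ (fun v => f (zeta v) * dzeta v / (zeta v - b) ^+ 1) = f b * W2pi.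
Proof.
have -> : circ (fun v => f (zeta v) * dzeta v / (zeta v - b) ^+ 1) = I 0.
  rewrite /I; congr circ; apply/funext => v; rewrite mulrA; congr (f _ * _ / _).
  by rewrite /H /T mulr0 addr0 invr1 rmorph1 mul1r addrC subrK.
have In n : I 0 = I ((pi *+ 2) *+ n).
  elim: n => [|n IH]; [by rewrite mulr0n|rewrite IH].
  by rewrite (mulrSr (pi *+ 2) n) I_step // mulrn_wge0 // ltW.
rewrite -(@circ_kernel a r b) //.
set K := circ _; apply: nm_small => e e0.
have [M M0 hM] := rdiff_bounded (ltW p0) (rdiff_ker r0 (@rdiff_dz r) 1 hb).
have M1 : 0 < M + 1 by lra.
have ba : nm (b - a) < Rd by exact: lt_trans hb rRd.
have [d hd] := df ba.
have e1 : 0 < e / ((M + 1) * (pi *+ 2)) by rewrite divr_gt0 // mulr_gt0.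
have [dl dl0 dlP] := drv_cont hd e1.
have [n nP] : exists n, (1 + (pi *+ 2) *+ n * ((pi *+ 2) *+ n))^-1 * (2 * r) < dl.
  pose n := (Num.truncn (2 * r / dl)).+1; exists n; have hn := truncnS_gt (2 * r / dl).
  have pn : n%:R <= (pi *+ 2) *+ n :> R.
    rewrite lerMn2r; apply/orP; right.
    by have := @pi_ge2 R; rewrite mulr2n; lra.
  have q := q0 ((pi *+ 2) *+ n).
  rewrite [X in X < _]mulrC ltr_pdivrMr // [X in _ < X]mulrC -ltr_pdivrMr //.
  apply: (lt_le_trans hn).
  apply: (le_trans pn); set x := _ *+ n; have := sqr_ge0 (x - 1).
  have x0 : 0 <= x by rewrite mulrn_wge0 // ltW.
  by rewrite expr2; nra.
rewrite (In n) /K -circZ; last exact: rdiff_ker r0 (@rdiff_dz r) _ _ hb.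
set u := _ *+ n in nP *.
have -> : I u - circ (fun v => f b * (dzeta v / (zeta v - b) ^+ 1)) =
  circ (fun v => (f (H u v) - f b) * (dzeta v / (zeta v - b) ^+ 1)).
  have hk := rdiff_ker r0 (@rdiff_dz r) 1 hb.
  rewrite (_ : (fun v => (f (H u v) - f b) * _) = fun v =>
    f (H u v) * (dzeta v / (zeta v - b) ^+ 1) + (- 1) * (f b * (dzeta v / (zeta v - b) ^+ 1))); last first.
    by apply/funext => v; ring.
  have hc := rdiffM (@rdiff_cst R (f b)) hk.
  rewrite (circD (dfH u) (rdiffM (@rdiff_cst R (- 1)) hc)) (circZ (-1) hc) /I.
  by ring.
have -> : e = (e / ((M + 1) * (pi *+ 2)) * (M + 1)) * (pi *+ 2).
  by rewrite -mulrA divfK // mulf_neq0 // gt_eqF.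
apply: circ_le.
  rewrite (_ : (fun v => _) = fun v => f (H u v) * (dzeta v / (zeta v - b) ^+ 1) + (- f b) * (dzeta v / (zeta v - b) ^+ 1)); last first.
    by apply/funext => v; ring.
  apply: rdiffD; first exact: dfH.
  apply: rdiffM; first exact: rdiff_cst.
  exact: rdiff_ker r0 (@rdiff_dz r) _ _ hb.
move=> v hv; rewrite nmM; apply: ler_pM; rewrite ?nm_ge0 //.
  apply/ltW/dlP; apply: le_lt_trans nP.
  rewrite /H addrAC subrr add0r nmM nmrc gtr0_norm; last by have /andP[] := T_bd u.
  by rewrite ler_pM2l //; have /andP[] := T_bd u.
by apply: (le_trans (hM _ hv)); lra.
Qed.

End Formula.
End Cauchy.

(** * Taylor expansions and the identity theorem *)

Section RealInduction.
Variable R : realType.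

(** Induction on a real interval: a property that spreads to the right near
every point of the interval, from points on its left included, holds at the end.
*)
Lemma real_ind (P : R -> Prop) (a b : R) : a <= b -> P a ->
  (forall s, a <= s <= b -> exists2 e : R, 0 < e & forall s1 s2, a <= s1 -> s1 <= s2 -> s2 <= b ->
     `|s1 - s| < e -> `|s2 - s| < e -> P s1 -> P s2) -> P b.
Proof.
move=> ab Pa step.
pose S := [set t | a <= t <= b /\ P t].
have Sa : S a by split => //; rewrite lexx.
have Sb : has_ubound S by exists b => t [/andP[]].
have hs : has_sup S by split; [exists a|].
pose s := sup S.
have as_ : a <= s by apply: ub_le_sup.
have sb : s <= b by apply: ge_sup; [exists a|move=> t [/andP[]]].
have [|e e0 H] := step s; first by rewrite as_.
have [s1 [/andP[a1 b1] P1] hs1] := sup_adherent e0 hs.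
have s1s : s1 <= s by apply: ub_le_sup => //; split => //; rewrite a1.
pose s2 := Num.min b (s + e / 2).
have s2b : s2 <= b by rewrite ge_min lexx.
have s2s : s <= s2 by rewrite le_min sb /=; lra.
have P2 : P s2.
  apply: (H s1 s2) => //; first exact: le_trans s2s.
    by rewrite ltr_norml -/s in hs1 *; apply/andP; split; lra.
  have : s2 <= s + e / 2 by rewrite ge_min lexx orbT.
  by rewrite ltr_norml => h; apply/andP; split; lra.
have : s2 <= s.
  apply: ub_le_sup => //; split => //; rewrite s2b andbT; exact: le_trans s2s.
rewrite ge_min => /orP[bs|]; last by lra.
by have -> : b = s2 by apply/eqP; rewrite eq_le s2b andbT (le_trans bs).
Qed.

Lemma real_ind_all (P : R -> Prop) (a b : R) : P a ->
  (forall s, a <= s <= b -> exists2 e : R, 0 < e & forall s1 s2, a <= s1 -> s1 <= s2 -> s2 <= b ->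
     `|s1 - s| < e -> `|s2 - s| < e -> P s1 -> P s2) -> forall t, a <= t <= b -> P t.
Proof.
move=> Pa step t /andP[a_t tb]; apply: (@real_ind P a t) => // s /andP[sa st].
have [|e e0 H] := step s; first by rewrite sa (le_trans st).
exists e => // s1 s2 h1 h2 h3; apply: H => //; exact: le_trans tb.
Qed.

End RealInduction.

Section Consequences.
Variable R : realType.
Local Notation C := (Cplx R).
Local Notation rc := (@rc R).
Local Notation nm := (@nm R).

Definition hol_ball (f : C -> C) (a : C) (rho : R) := forall z, nm (z - a) < rho -> exists d, drv id f z d.

Lemma hol_ballS f a rho b sg : hol_ball f a rho -> nm (b - a) + sg <= rho -> hol_ball f b sg.
Proof.
move=> df h z hz; apply: df.
by apply: (le_lt_trans (nm_tri z b a)); apply: lt_le_trans h; rewrite addrC ltrD2l.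
Qed.

Lemma between (x y : R) : x < y -> exists2 r, x < r & r < y.
Proof. by move=> xy; exists ((x + y) / 2); lra. Qed.

Lemma drv_hol f a rho : hol_ball f a rho -> 
  exists2 f', (forall z, nm (z - a) < rho -> drv id f z (f' z)) & hol_ball f' a rho.
Proof.
move=> df.
have /choice[f' f'P] : forall z, exists d, nm (z - a) < rho -> drv id f z d.
  move=> z; have [h|h] := boolP (nm (z - a) < rho); last by exists 0.
  by have [d hd] := df z h; exists d.
exists f' => // b hb.
have [r br rr] := between hb.
have r0 : 0 < r by exact: le_lt_trans (nm_ge0 _) br.
pose psi v := f (zt a r v) * dz r v.
have dpsi : rdiff psi := rdiff_fzt df r0 rr.
have fE w : nm (w - a) < r -> (W2pi R)^-1 * circ (fun v => psi v / (zt a r v - w) ^+ 1) = f w.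
  by move=> hw; rewrite (cauchy_formula df r0 rr hw) mulrC mulfK // W2pi_neq0.
have hn w : nm (w - a) < r -> 0 < r - nm (w - a) by rewrite subr_gt0.
have near_ w z : nm (w - a) < r -> nm (z - w) < r - nm (w - a) -> nm (z - a) < r.
  by move=> h1 h2; have := nm_tri z w a; lra.
have f'E w : nm (w - a) < r -> (W2pi R)^-1 * circ (fun v => psi v / (zt a r v - w) ^+ 2) = f' w.
  move=> hw; apply: (@drv_uniq _ f w); last by apply: f'P; exact: lt_trans rr.
  apply: drv_near (hn _ hw) _ (drvZ (W2pi R)^-1 (ker1_drv r0 dpsi hw)) => z hz.
  exact/fE/near_/hz.
exists ((W2pi R)^-1 * circ (fun v => 2 * (psi v / (zt a r v - b) ^+ 3))).
apply: drv_near (hn _ br) _ (drvZ (W2pi R)^-1 (ker2_drv r0 dpsi br)) => z hz.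
exact/f'E/near_/hz.
Qed.

(** The remainder of the geometric series of the Cauchy kernel is kept explicit.
This bound, without any convergence statement, is all that the applications
need. *)
Lemma taylor f a rho r : hol_ball f a rho -> 0 < r -> r < rho -> exists (c : nat -> C) (A : R), 0 <= A /\
  forall n b, nm (b - a) < r -> nm (f b - \sum_(k < n) c k * (b - a) ^+ k) <=
    A * (nm (b - a) / r) ^+ n / (r - nm (b - a)).
Proof.
move=> df r0 rr.
pose psi v := f (zt a r v) * dz r v.
have dpsi : rdiff psi := rdiff_fzt df r0 rr.
have p0 : 0 <= pi *+ 2 :> R by rewrite mulrn_wge0 // ltW // pi_gt0.
have [M M0 hM] := rdiff_bounded p0 dpsi.
pose W := W2pi R.
have W0 : W != 0 by exact: W2pi_neq0.
exists (fun k => W^-1 * circ (fun v => psi v / (zt a r v - a) ^+ k.+1)).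
exists (nm W^-1 * M * (pi *+ 2)); split; first by rewrite !mulr_ge0 ?nm_ge0.
move=> n b hb.
have aa : nm (a - a) < r by rewrite subrr nm0.
have dker k : rdiff (fun v => psi v / (zt a r v - a) ^+ k / (zt a r v - b)).
  apply: rdiffM; first exact: rdiff_ker.
  apply: rdiffV; first by move=> v; exact: zt_neq.
  by apply: rdiffD; [exact: rdiff_zt|exact: rdiff_cst].
have E : f b = \sum_(k < n) W^-1 * circ (fun v => psi v / (zt a r v - a) ^+ k.+1) * (b - a) ^+ k
  + (b - a) ^+ n * (W^-1 * circ (fun v => psi v / (zt a r v - a) ^+ n / (zt a r v - b))).
  elim: n => [|n IH].
    rewrite big_ord0 add0r expr0 mul1r.
    have -> : f b = W^-1 * circ (fun v => psi v / (zt a r v - b) ^+ 1).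
      by rewrite (cauchy_formula df r0 rr hb) mulrC mulfK.
    by congr (_ * circ _); apply/funext => v; rewrite expr0 divr1.
  rewrite big_ord_recr /= IH -addrA; congr (_ + _).
  have -> : circ (fun v => psi v / (zt a r v - a) ^+ n / (zt a r v - b)) =
    circ (fun v => psi v / (zt a r v - a) ^+ n.+1) + 
    (b - a) * circ (fun v => psi v / (zt a r v - a) ^+ n.+1 / (zt a r v - b)).
    rewrite -circZ // -circD //; last 2 first.
    - exact: rdiff_ker.
    - by apply: rdiffM; first exact: rdiff_cst.
    congr circ; apply/funext => v.
    have n1 := zt_neq r0 v hb; have n2 := zt_neq r0 v aa.
    have n3 : (zt a r v - a) ^+ n != 0 by rewrite expf_neq0.
    by rewrite exprS; field; rewrite n1 n2 n3.
  by rewrite exprS; ring.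
rewrite {1}E addrAC subrr add0r nmM nmX nmM.
set x := nm (b - a) in hb *.
have x0 : 0 <= x by exact: nm_ge0.
have h : nm (circ (fun v => psi v / (zt a r v - a) ^+ n / (zt a r v - b))) <=
   (M / r ^+ n / (r - x)) * (pi *+ 2).
  apply: circ_le => // v hv; rewrite 2!nmM !nmV nmX zt_a //.
  apply: ler_pM; rewrite ?mulr_ge0 ?invr_ge0 ?nm_ge0 ?exprn_ge0 ?(ltW r0) //.
    by rewrite ler_pM2r ?invr_gt0 ?exprn_gt0 // hM.
  rewrite lef_pV2 ?posrE ?subr_gt0 //; first exact: zt_b.
  by rewrite nm_gt0 zt_neq.
have -> : nm W^-1 * M * (pi *+ 2) * (x / r) ^+ n / (r - x) =
  x ^+ n * (nm W^-1 * (M / r ^+ n / (r - x) * (pi *+ 2))).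
  by rewrite expr_div_n; ring.
by rewrite ler_wpM2l ?exprn_ge0 // ler_wpM2l ?nm_ge0.
Qed.

Lemma small_pow (q e : R) : 0 <= q < 1 -> 0 < e -> exists N, forall n, (N <= n)%N -> q ^+ n < e.
Proof.
move=> /andP[q0 q1] e0.
have h : (fun n => q ^+ n) @ \oo --> (0 : R) by apply: cvg_expr; rewrite ger0_norm.
have /cvgrPdist_lt /(_ e e0) [N _ NP] := h.
exists N => n /NP /=; rewrite sub0r normrN ger0_norm ?exprn_ge0 //.
Qed.

(** If some Taylor coefficient at a is nonzero, the first such term dominates
near a. Otherwise f is bounded by the remainders, which tend to 0 on every
smaller disc. *)
Lemma zero_dichotomy f a rho : 0 < rho -> hol_ball f a rho ->
  (forall z, nm (z - a) < rho -> f z = 0) \/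
  (exists2 e : R, 0 < e & forall z, 0 < nm (z - a) < e -> f z != 0).
Proof.
move=> rho0 df; have [iso|niso] := pselect (exists2 e : R, 0 < e & forall z, 0 < nm (z - a) < e -> f z != 0).
  by right.
left=> z hz; have [r zr rr] := between hz.
have r0 : 0 < r by exact: le_lt_trans (nm_ge0 _) zr.
have [c [A [A0 T]]] := taylor df r0 rr.
have c0 : forall k, c k = 0.
  move=> k; apply/eqP/negPn/negP => ck; apply: niso.
  have ex : exists k, c k != 0 by exists k.
  pose n := ex_minn ex.
  have [cn nmin] : c n != 0 /\ forall k, (k < n)%N -> c k = 0.
    rewrite /n; case: ex_minnP => m cm mmin; split => // j jm.
    by apply/eqP; apply/negPn/negP => /mmin; rewrite leqNgt jm.
  (* the remainder after the first nonzero term c n is at most x^(n+1) L *)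
pose L := A / r ^+ n.+1 * (2 / r).
  have L0 : 0 <= L by rewrite !mulr_ge0 ?invr_ge0 ?exprn_ge0 // ltW.
  have cn0 : 0 < nm (c n) by rewrite nm_gt0.
  exists (Num.min (r / 2) (nm (c n) / (L + 1))).
    by rewrite lt_min !divr_gt0 // ltr_wpDl.
  move=> w /andP[w0]; rewrite lt_min => /andP[w1 w2]; apply/negP => /eqP fw.
  have wr : nm (w - a) < r by lra.
  have := T n.+1 w wr; rewrite fw sub0r nmN big_ord_recr /= big1 ?add0r; last first.
    by move=> i _; rewrite nmin ?mul0r.
  rewrite nmM nmX leNgt => /negP; apply.
  set x := nm (w - a) in w0 w1 w2 wr *.
  have -> : A * (x / r) ^+ n.+1 / (r - x) = (x * (A / r ^+ n.+1 / (r - x))) * x ^+ n.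
    by rewrite expr_div_n exprS; ring.
  rewrite ltr_pM2r ?exprn_gt0 //.
  apply: (@le_lt_trans _ _ (x * L)).
    rewrite ler_pM2l // /L ler_wpM2l //; first by rewrite divr_ge0 // exprn_ge0 // ltW.
    have -> : 2 / r = (r / 2)^-1 by field; rewrite gt_eqF.
    by rewrite lef_pV2 ?posrE ?divr_gt0 ?subr_gt0 //; lra.
  move: w2; rewrite ltr_pdivlMr ?ltr_wpDl // => w2; apply: le_lt_trans w2.
  by rewrite ler_pM2l // lerDl.
set x := nm (z - a) in hz zr *.
have rx : 0 < r - x by rewrite subr_gt0.
apply: nm_small => e e0; rewrite subr0.
have xr : 0 <= x / r < 1 by rewrite divr_ge0 ?nm_ge0 ?(ltW r0) //= ltr_pdivrMr // mul1r.
have e1 : 0 < e / (A / (r - x) + 1) by rewrite divr_gt0 // ltr_wpDl // divr_ge0 // ltW.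
have [n nP] := small_pow xr e1.
have := T n z zr; rewrite big1 ?subr0; last by move=> i _; rewrite c0 mul0r.
move=> h; apply: (le_trans h); rewrite -/x.
have Ar : 0 <= A / (r - x) by rewrite divr_ge0 // ltW.
have := nP n (leqnn n); rewrite ltr_pdivlMr ?ltr_wpDl // => hq.
apply: le_trans (ltW hq).
have -> : A * (x / r) ^+ n / (r - x) = (x / r) ^+ n * (A / (r - x)) by ring.
have /andP[xr0 _] := xr.
by rewrite ler_wpM2l ?exprn_ge0 // lerDl.
Qed.

(** The zero germ spreads along the segment: at a point of the segment where it
arrives, the zeros of f are not isolated. *)
Lemma identity_seg f z0 z1 :
  (forall t : R, 0 <= t <= 1 -> exists2 rho : R, 0 < rho & hol_ball f (z0 + rc t * (z1 - z0)) rho) ->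
  (exists2 e : R, 0 < e & forall z, nm (z - z0) < e -> f z = 0) ->
  exists2 e : R, 0 < e & forall z, nm (z - z1) < e -> f z = 0.
Proof.
move=> df f0; have [->//|z01] := eqVneq z1 z0.
have D0 : 0 < nm (z1 - z0) by rewrite nm_gt0 subr_eq0.
pose P (t : R) := exists2 e : R, 0 < e & forall z, nm (z - (z0 + rc t * (z1 - z0))) < e -> f z = 0.
suff : P 1 by rewrite /P rmorph1 mul1r addrC subrK.
apply: (@real_ind _ P 0 1) => //; first by rewrite /P rmorph0 mul0r addr0.
have dist (s t : R) : nm (z0 + rc t * (z1 - z0) - (z0 + rc s * (z1 - z0))) = `|t - s| * nm (z1 - z0).
  rewrite -nmrc -nmM rmorphB; congr (nm _); ring.
move=> s hs; have [rho rho0 dfs] := df s hs.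
have [all0|[e e0 iso]] := zero_dichotomy rho0 dfs.
  exists (rho / nm (z1 - z0)); first by rewrite divr_gt0.
  move=> s1 s2 _ _ _ _; rewrite ltr_pdivlMr // => h _.
  exists (rho - `|s2 - s| * nm (z1 - z0)); first by rewrite subr_gt0.
  move=> z hz; apply: all0.
  by have := nm_tri z (z0 + rc s2 * (z1 - z0)) (z0 + rc s * (z1 - z0)); rewrite dist; lra.
exists (e / nm (z1 - z0)); first by rewrite divr_gt0.
move=> s1 s2 _ _ _; rewrite ltr_pdivlMr // => h _ [e' e'0 H]; exfalso.
set w := z0 + rc s1 * (z1 - z0) in H.
have ne : e - nm (w - (z0 + rc s * (z1 - z0))) > 0 by rewrite dist subr_gt0.
set c := z0 + rc s * (z1 - z0) in iso ne.
(* a point near w but different from the isolated zero *)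
have [wc|wc] := eqVneq w c.
  pose m := Num.min e e' / 2.
  have m0 : 0 < m by rewrite divr_gt0 // lt_min e0.
  have mE : m < e /\ m < e'.
    have : Num.min e e' <= e by rewrite ge_min lexx.
    have : Num.min e e' <= e' by rewrite ge_min lexx orbT.
    by rewrite /m in m0 *; lra.
  have nn : nm (c + rc m - c) = m by rewrite addrAC subrr add0r nmrc gtr0_norm.
  have := iso (c + rc m); rewrite nn m0 /= => /(_ mE.1) /eqP; apply.
  by apply: H; rewrite wc nn; exact: mE.2.
have := iso w; rewrite nm_gt0 subr_eq0 wc /= -subr_gt0 => /(_ ne) /eqP; apply.
by apply: H; rewrite subrr nm0.
Qed.

Lemma nm_complete (u : nat -> C) :
  (forall e : R, 0 < e -> exists N, forall m n, (N <= m)%N -> (N <= n)%N -> nm (u m - u n) <= e) ->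
  exists l, forall e : R, 0 < e -> exists N, forall n, (N <= n)%N -> nm (u n - l) <= e.
Proof.
move=> cu.
have real_lim (v : nat -> R) : (forall e : R, 0 < e -> exists N, forall m n, (N <= m)%N -> (N <= n)%N -> `|v m - v n| <= e) ->
  exists l, forall e : R, 0 < e -> exists N, forall n, (N <= n)%N -> `|v n - l| <= e.
  move=> cv; have : cvgn v.
    apply/cauchy_cvgP; apply: cauchy_exP => e e0.
    have [|N NP] := cv (e / 2); first by rewrite divr_gt0.
    exists (v N); exists N => // n /= Nn; rewrite -ball_normE /ball_ /=.
    by apply: (le_lt_trans (NP _ _ (leqnn N) Nn)); lra.
  move=> /cvg_ex[l /cvgrPdist_le vl]; exists l => e e0.
  have [N _ NP] := vl e e0; exists N => n /NP /=; by rewrite distrC.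
have [|a ha] := real_lim (fun n => complex.Re (u n : R[i])).
  move=> e /cu[N NP]; exists N => m n hm hn; apply: le_trans (NP m n hm hn).
  by apply: le_trans (Re_nm _); move: (u m) (u n) => [? ?] [? ?].
have [|b hb] := real_lim (fun n => complex.Im (u n : R[i])).
  move=> e /cu[N NP]; exists N => m n hm hn; apply: le_trans (NP m n hm hn).
  by apply: le_trans (Im_nm _); move: (u m) (u n) => [? ?] [? ?].
exists (Complex a b : R[i]) => e e0; have e2 : 0 < e / 2 by rewrite divr_gt0.
have [N1 h1] := ha _ e2; have [N2 h2] := hb _ e2; exists (maxn N1 N2) => n.
rewrite geq_max => /andP[/h1 {}h1 /h2 {}h2]; apply: (le_trans (nm_ReIm _)).
by move: (u n) h1 h2 => [? ?] /= h1 h2; lra.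
Qed.

Lemma uniform_limit (U : C -> Prop) (F : nat -> C -> C) :
  (forall e : R, 0 < e -> exists N, forall m n z, (N <= m)%N -> (N <= n)%N -> U z ->
     nm (F m z - F n z) <= e) ->
  exists G, forall e : R, 0 < e -> exists N, forall n z, (N <= n)%N -> U z -> nm (F n z - G z) <= e.
Proof.
move=> cau; have /choice[G GP] : forall z, exists l, U z ->
    forall e : R, 0 < e -> exists N, forall n, (N <= n)%N -> nm (F n z - l) <= e.
  move=> z; have [hz|nz] := pselect (U z); last by exists 0.
  have [|l hl] := @nm_complete (fun n => F n z); last by exists l.
  by move=> e /cau[N NP]; exists N => m n hm hn; exact: NP.
exists G => e e0; have [N NP] := cau e e0; exists N => n z hn hz.
apply/ler_addgt0Pl => d d0; have [N' N'P] := GP z hz d d0.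
have h1 := N'P (maxn N N') (leq_maxr _ _).
have h2 := NP n (maxn N N') z hn (leq_maxl _ _) hz.
by have := nm_tri (F n z) (F (maxn N N') z) (G z); lra.
Qed.

End Consequences.

(** * Limits and primitives of holomorphic functions *)

Section Ode.
Variable R : realType.
Local Notation C := (Cplx R).
Local Notation rc := (@rc R).
Local Notation nm := (@nm R).

Lemma ball_conv (a z w : C) (r t : R) : nm (z - a) < r -> nm (w - a) < r -> 0 <= t <= 1 ->
  nm (z + rc t * (w - z) - a) < r.
Proof.
move=> hz hw /andP[t0 t1].
have -> : z + rc t * (w - z) - a = (1 - rc t) * (z - a) + rc t * (w - a) by ring.
apply: (le_lt_trans (nmD _ _)); rewrite !nmM -(rmorph1 rc) -rmorphB !nmrc.
rewrite (ger0_norm t0) ger0_norm ?subr_ge0 //.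
have [->|t0'] := eqVneq t 0; first by rewrite subr0 mul1r mul0r addr0.
have tt : 0 < t by rewrite lt_neqAle eq_sym t0'.
have h1 : (1 - t) * nm (z - a) <= (1 - t) * r by rewrite ler_wpM2l ?subr_ge0 // ltW.
have h2 : t * nm (w - a) < t * r by rewrite ltr_pM2l.
lra.
Qed.

Lemma mvi_ball (F f : C -> C) a r M z w : (forall z, nm (z - a) < r -> drv id F z (f z)) ->
  (forall z, nm (z - a) < r -> nm (f z) <= M) -> nm (z - a) < r -> nm (w - a) < r ->
  nm (F z - F w) <= M * nm (z - w).
Proof.
move=> dF fM hz hw.
by apply: (@cd_mvi R F f) => t ht; [apply: dF|apply: fM]; exact: ball_conv.
Qed.

Lemma identity_conv (U : C -> Prop) f z0 z1 :
  (forall z w t, U z -> U w -> 0 <= t <= 1 -> U (z + rc t * (w - z))) ->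
  (forall z, U z -> exists2 rho : R, 0 < rho & hol_ball f z rho) -> U z0 -> U z1 ->
  (exists2 e : R, 0 < e & forall z, nm (z - z0) < e -> f z = 0) -> f z1 = 0.
Proof.
move=> cU dU U0 U1 f0.
have [|e e0 h] := @identity_seg R f z0 z1 _ f0; last by apply: h; rewrite subrr nm0.
by move=> t ht; apply/dU/cU.
Qed.

Lemma hol_ball_near f a r z : hol_ball f a r -> nm (z - a) < r -> exists2 rho : R, 0 < rho & hol_ball f z rho.
Proof.
move=> df hz; exists (r - nm (z - a)); first by rewrite subr_gt0.
by apply: hol_ballS df _; lra.
Qed.

Lemma identity_ball f a r z0 z1 : hol_ball f a r -> nm (z0 - a) < r -> nm (z1 - a) < r ->
  (exists2 e : R, 0 < e & forall z, nm (z - z0) < e -> f z = 0) -> f z1 = 0.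
Proof.
move=> df h0 h1; apply: (@identity_conv (fun z => nm (z - a) < r)) => //.
  by move=> *; exact: ball_conv.
by move=> z hz; exact: hol_ball_near df hz.
Qed.

(** Termwise differentiation. By the mean value inequality applied to
differences, a uniform bound on F' gives a Lipschitz bound on F. *)
Lemma dlim (F f : nat -> C -> C) (g : C -> C) a r z0 y0 : nm (z0 - a) < r ->
  (forall n z, nm (z - a) < r -> drv id (F n) z (f n z)) -> (forall n, F n z0 = y0) ->
  (forall e : R, 0 < e -> exists N, forall n z, (N <= n)%N -> nm (z - a) < r -> nm (f n z - g z) <= e) ->
  exists G, [/\ G z0 = y0, forall z, nm (z - a) < r -> drv id G z (g z) &
    forall e : R, 0 < e -> exists N, forall n z, (N <= n)%N -> nm (z - a) < r -> nm (F n z - G z) <= e].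
Proof.
move=> h0 dF F0 fg.
have r0 : 0 < r by exact: le_lt_trans (nm_ge0 _) h0.
have cau (e : R) : 0 < e -> exists N, forall m n z w, (N <= m)%N -> (N <= n)%N ->
    nm (z - a) < r -> nm (w - a) < r -> nm ((F m z - F n z) - (F m w - F n w)) <= e * nm (z - w).
  move=> e0; have [|N NP] := fg (e / 2); first by rewrite divr_gt0.
  exists N => m n z w hm hn; apply: (@mvi_ball (fun z => F m z - F n z) (fun z => f m z - f n z)).
    by move=> v hv; apply: drvB; exact: dF.
  move=> v hv; have := nm_tri (f m v) (g v) (f n v); have := NP m v hm hv.
  by have := NP n v hn hv; rewrite (nmB (g v)); lra.
have cau0 (e : R) : 0 < e -> exists N, forall m n z, (N <= m)%N -> (N <= n)%N ->
    nm (z - a) < r -> nm (F m z - F n z) <= e.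
  move=> e0; have [|N NP] := cau (e / (2 * r)); first by rewrite divr_gt0 // mulr_gt0.
  exists N => m n z hm hn hz; have := NP m n z z0 hm hn hz h0.
  rewrite !F0 subrr subr0 => h; apply: (le_trans h).
  rewrite mulrAC ler_pdivrMr ?mulr_gt0 // ler_pM2l //.
  by have := nm_tri z a z0; rewrite (nmB a); lra.
have [G unif] := uniform_limit cau0.
have G0 : G z0 = y0.
  apply/eqP; rewrite -subr_eq0 -nm_eq0 eq_le nm_ge0 andbT; apply/ler_addgt0Pl => e e0.
  have [N NP] := unif e e0; rewrite addr0 nmB -(F0 N); exact: NP.
exists G; split => // z hz e e0.
have e4 : 0 < e / 4 by rewrite divr_gt0.
have [N1 c1] := cau _ e4; have [N2 c2] := fg _ e4.
set n := maxn N1 N2.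
have lim w : nm (w - a) < r -> nm ((G w - F n w) - (G z - F n z)) <= e / 4 * nm (w - z).
  move=> hw; apply/ler_addgt0Pl => d d0.
  have [|N NP] := unif (d / 2); first by rewrite divr_gt0.
  have h1 := NP (maxn N N1) w (leq_maxl _ _) hw.
  have h2 := NP (maxn N N1) z (leq_maxl _ _) hz.
  have h3 := c1 (maxn N N1) n w z (leq_maxr _ _) (leq_maxl _ _) hw hz.
  set X := F (maxn N N1) in h1 h2 h3.
  have -> : G w - F n w - (G z - F n z) = - (X w - G w) + (X z - G z) + (X w - F n w - (X z - F n z)) by ring.
  apply: (le_trans (nmD _ _)); have := nmD (- (X w - G w)) (X z - G z).
  by rewrite nmN; lra.
have [r1 r10 r1P] := dF n z hz _ e4.
exists (Num.min r1 (r - nm (z - a))); first by rewrite lt_min r10 subr_gt0.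
move=> w; rewrite lt_min => /andP[/r1P h1 h2].
have hw : nm (w - a) < r by have := nm_tri w z a; lra.
have h3 := lim w hw.
have h4 : nm ((f n z - g z) * (w - z)) <= e / 4 * nm (w - z).
  by rewrite nmM ler_wpM2r ?nm_ge0 // c2 // leq_maxr.
have -> : G w - G z - g z * (w - z) = (G w - F n w - (G z - F n z)) +
  (F n w - F n z - f n z * (w - z)) + (f n z - g z) * (w - z) by ring.
apply: (le_trans (nmD _ _)); have := nmD (G w - F n w - (G z - F n z)) (F n w - F n z - f n z * (w - z)).
by have := nm_ge0 (w - z); nra.
Qed.

Lemma drvX (T : Type) (i : T -> C) (f : T -> C) t d n : drv i f t d ->
  drv i (fun s => f s ^+ n.+1) t (n.+1%:R * f t ^+ n * d).
Proof.
move=> hf; elim: n => [|n IH].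
  by under eq_fun do rewrite expr1; apply: drv_eq hf _; rewrite expr0 !mul1r.
under eq_fun do rewrite exprS; apply: drv_eq (drvM hf IH) _.
by rewrite -[n.+2%:R]natr1 exprS; ring.
Qed.

Lemma drv_sum (T : Type) (i : T -> C) (f : nat -> T -> C) t (d : nat -> C) n :
  (forall k, drv i (f k) t (d k)) -> drv i (fun s => \sum_(k < n) f k s) t (\sum_(k < n) d k).
Proof.
move=> h; elim: n => [|n IH].
  by under eq_fun do rewrite big_ord0; rewrite big_ord0; exact: drv_cst.
by under eq_fun do rewrite big_ord_recr; rewrite big_ord_recr; exact: drvD.
Qed.

(** Primitives of the Taylor polynomials converge on a smaller disc. *)
Lemma primitive_ball_lt f a rho r : hol_ball f a rho -> 0 < r -> r < rho ->
  exists2 F, F a = 0 & forall z, nm (z - a) < r -> drv id F z (f z).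
Proof.
move=> df r0 rr; have [s rs sr] := between rr.
have s0 : 0 < s by exact: lt_trans rs.
have [c [A [A0 T]]] := taylor df s0 sr.
pose F n z := \sum_(k < n) c k / k.+1%:R * (z - a) ^+ k.+1.
have [||||G [G0 dG _]] := @dlim F (fun n z => \sum_(k < n) c k * (z - a) ^+ k) f a r a 0; last by exists G.
- by rewrite subrr nm0.
- move=> n z hz; apply: (@drv_sum _ id (fun k z => c k / k.+1%:R * (z - a) ^+ k.+1) z (fun k => c k * (z - a) ^+ k)) => k.
  have h : drv id (fun z => z - a) z 1.
    by apply: drv_eq (drvB (drv_id id z) (drv_cst id a z)) _; rewrite subr0.
  apply: drv_eq (drvZ (c k / k.+1%:R) (drvX k h)) _.
  by rewrite mulr1 mulrA divfK // pnatr_eq0.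
- by move=> n; rewrite /F big1 // => k _; rewrite subrr exprS mul0r mulr0.
move=> e e0.
have q : 0 <= r / s < 1 by rewrite divr_ge0 ?(ltW r0) ?(ltW s0) //= ltr_pdivrMr // mul1r.
have sr0 : 0 < s - r by rewrite subr_gt0.
have Ar : 0 <= A / (s - r) by rewrite divr_ge0 // ltW.
have e1 : 0 < e / (A / (s - r) + 1) by rewrite divr_gt0 // ltr_wpDl.
have [N NP] := small_pow q e1; exists N => n z hn hz; rewrite nmB.
have zs : nm (z - a) < s by exact: lt_trans rs.
apply: (le_trans (T n z zs)); have := NP n hn.
rewrite ltr_pdivlMr ?ltr_wpDl // => hq; apply: le_trans (ltW hq).
have /andP[q0 _] := q.
apply: (@le_trans _ _ ((r / s) ^+ n * (A / (s - r)))).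
  have -> : A * (nm (z - a) / s) ^+ n / (s - nm (z - a)) = (nm (z - a) / s) ^+ n * (A / (s - nm (z - a))) by ring.
  apply: ler_pM; rewrite ?exprn_ge0 ?divr_ge0 ?nm_ge0 ?(ltW s0) ?subr_ge0 ?(ltW zs) //.
    by rewrite lerXn2r ?nnegrE ?divr_ge0 ?nm_ge0 ?(ltW r0) ?(ltW s0) // ler_pM2r ?invr_gt0 // ltW.
  by rewrite ler_wpM2l // lef_pV2 ?posrE ?subr_gt0 //; lra.
by rewrite ler_wpM2l ?exprn_ge0 // lerDl.
Qed.

(** The primitives on smaller discs that vanish at the centre agree with each
other and can be glued, so no part of the disc is lost; this is needed to
iterate. *)
Lemma primitive_ball f a rho : hol_ball f a rho ->
  exists F, forall z, nm (z - a) < rho -> drv id F z (f z).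
Proof.
move=> df; have [rho0|rho0] := leP rho 0.
  by exists (fun=> 0) => z hz; have := nm_ge0 (z - a); rewrite leNgt (lt_le_trans hz).
have /choice[Fr FrP] : forall r : R, exists F, 0 < r -> r < rho -> F a = 0 /\
    forall z, nm (z - a) < r -> drv id F z (f z).
  move=> r; have [r0|r0] := ltP 0 r; last by exists (fun=> 0).
  have [rr|rr] := ltP r rho; last by exists (fun=> 0).
  by have [F F0 dF] := primitive_ball_lt df r0 rr; exists F.
have agree r s z : 0 < r -> r < rho -> 0 < s -> s < rho -> nm (z - a) < r -> nm (z - a) < s -> Fr r z = Fr s z.
  move=> r0 rr s0 sr zr zs; have [F0 dF] := FrP r r0 rr; have [G0 dG] := FrP s s0 sr.
  apply: nm_le0.
  have := @mvi_ball (fun z => Fr r z - Fr s z) (fun=> 0) a (Num.min r s) 0 z a.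
  rewrite F0 G0 !subrr subr0 mul0r nm0; apply => //.
  - move=> w; rewrite lt_min => /andP[h1 h2].
    by apply: drv_eq (drvB (dF _ h1) (dG _ h2)) _; rewrite subrr.
  - by rewrite lt_min zr.
  by rewrite lt_min r0.
pose rad (z : C) := (nm (z - a) + rho) / 2.
exists (fun z => Fr (rad z) z) => z hz.
have radP w : nm (w - a) < rho -> [/\ 0 < rad w, rad w < rho & nm (w - a) < rad w].
  by move=> hw; rewrite /rad; have := nm_ge0 (w - a); split; lra.
have [p1 p2 p3] := radP z hz.
have hd : 0 < rad z - nm (z - a) by rewrite subr_gt0.
have [_ dF] := FrP _ p1 p2.
apply: drv_near hd _ (dF _ p3) => w hw.
have wr : nm (w - a) < rad z by have := nm_tri w z a; lra.
have [q1 q2 q3] := radP w (lt_trans wr p2).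
exact: agree.
Qed.

(** With K s <= 1/2 the mean value inequality halves the bound on w over the
disc of radius s, again and again. *)
Lemma gronwall (w w' : C -> C) z0 (r K : R) : 0 < r ->
  (forall z, nm (z - z0) < r -> drv id w z (w' z)) ->
  (forall z, nm (z - z0) < r -> nm (w' z) <= K * nm (w z)) -> w z0 = 0 ->
  exists2 e : R, 0 < e & forall z, nm (z - z0) < e -> w z = 0.
Proof.
move=> r0 dw wK w0.
have zz : nm (z0 - z0) < r by rewrite subrr nm0.
have [r1 r10 h1] := drv_cont (dw _ zz) ltr01.
pose K' := `|K| + 1.
have K0 : 0 < K' by rewrite ltr_wpDl.
pose s := Num.min r (Num.min r1 (1 / (2 * K'))).
have s0 : 0 < s by rewrite !lt_min r0 r10 divr_gt0 // mulr_gt0.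
have sr : s <= r by rewrite ge_min lexx.
have sr1 : s <= r1 by rewrite !ge_min lexx orbT.
have sK : K' * s <= 2^-1.
  have : s <= 1 / (2 * K') by rewrite !ge_min lexx !orbT.
  rewrite ler_pdivlMr ?mulr_gt0 //; lra.
have bd n z : nm (z - z0) < s -> nm (w z) <= 2^-1 ^+ n.
  elim: n z => [|n IH] z hz.
    by have := h1 z; rewrite w0 subr0 expr0 => h; apply/ltW/h; exact: lt_le_trans hz sr1.
  have := @mvi_ball w w' z0 s (K' * 2^-1 ^+ n) z z0.
  rewrite w0 subr0 => h; apply: (le_trans (h _ _ hz _)).
  - by move=> v hv; apply: dw; exact: lt_le_trans sr.
  - move=> v hv; apply: (le_trans (wK _ (lt_le_trans hv sr))).
    apply: (@le_trans _ _ (K' * nm (w v))).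
      rewrite ler_wpM2r ?nm_ge0 //; apply: (le_trans (ler_norm _)).
      by rewrite lerDl.
    by rewrite ler_pM2l // IH.
  - by rewrite subrr nm0.
  rewrite exprS mulrAC ler_wpM2r ?exprn_ge0 ?invr_ge0 //.
  by apply: le_trans sK; rewrite ler_pM2l // ltW.
exists s => // z /(bd _) hz; apply: nm_small => e e0; rewrite subr0.
have q : 0 <= (2^-1 : R) < 1 by rewrite invr_ge0 ler0n /= invf_lt1 // ltr1n.
by have [N NP] := small_pow q e0; apply: (le_trans (hz N)); apply/ltW/NP.
Qed.

End Ode.

(** * The Cauchy existence theorem *)

Section Picard.
Variable R : realType.
Local Notation C := (Cplx R).
Local Notation rc := (@rc R).
Local Notation nm := (@nm R).

(** The radius only depends on the bounds for F, not on the initial point, and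
the solution is defined on a disc with fixed centre x1: a solution starting near
x1 is also defined at x1. *)
Lemma picard (F : C -> C -> C) (x1 y1 : C) (a b M L : R) : 0 < a -> 0 < b ->
  (forall x y, nm (x - x1) < a -> nm (y - y1) < b -> nm (F x y) <= M) ->
  (forall x y y', nm (x - x1) < a -> nm (y - y1) < b -> nm (y' - y1) < b ->
     nm (F x y - F x y') <= L * nm (y - y')) ->
  (forall u x d, nm (x - x1) < a -> nm (u x - y1) < b -> drv id u x d ->
     exists d', drv id (fun x => F x (u x)) x d') ->
  exists2 rho : R, 0 < rho <= a & forall w y, nm (w - x1) < rho -> nm (y - y1) < b / 2 ->
    exists H, H w = y /\ forall z, nm (z - x1) < rho ->
      nm (H z - y1) < b /\ drv id H z (F z (H z)).
Proof.
move=> a0 b0 FM FL Fd.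
have M0 : 0 <= M.
  by apply: le_trans (FM x1 y1 _ _); rewrite ?nm_ge0 // subrr nm0.
pose L' := `|L| + 1; have L0 : 0 < L' by rewrite ltr_wpDl.
have LL : L <= L' by apply: (le_trans (ler_norm _)); rewrite lerDl.
(* 2 rho M <= b / 4 keeps the iterates within 3 b / 4 of y1, and 2 rho L <= 1 / 2
   makes the iteration a contraction *)
pose rho := Num.min a (Num.min (b / (8 * (M + 1))) (1 / (4 * L'))).
have M1 : 0 < M + 1 by rewrite ltr_wpDl.
have rho0 : 0 < rho by rewrite !lt_min a0 !divr_gt0 // mulr_gt0.
have rhoa : rho <= a by rewrite ge_min lexx.
have rhoM : M * (2 * rho) <= b / 4.
  have : rho <= b / (8 * (M + 1)) by rewrite !ge_min lexx orbT.
  rewrite ler_pdivlMr ?mulr_gt0 // => h.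
  have : 0 <= M * rho by rewrite mulr_ge0 // ltW.
  lra.
have rhoL : L' * (2 * rho) <= 2^-1.
  have : rho <= 1 / (4 * L') by rewrite !ge_min lexx !orbT.
  rewrite ler_pdivlMr ?mulr_gt0 //; lra.
exists rho; first by rewrite rho0.
move=> w y hw hy.
pose good (u : C -> C) := forall z, nm (z - x1) < rho ->
  nm (u z - y1) < b /\ exists d, drv id u z d.
have dist z : nm (z - x1) < rho -> nm (z - w) <= 2 * rho.
  by move=> hz; have := nm_tri z x1 w; rewrite (nmB x1); lra.
have /choice[nxt nxtP] : forall u, exists u', good u -> [/\ good u', u' w = y &
   forall z, nm (z - x1) < rho -> drv id u' z (F z (u z))].
  move=> u; have [gu|] := pselect (good u); last by move=> ngu; exists u.
  have dFu : hol_ball (fun z => F z (u z)) x1 rho.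
    move=> z hz; have [h1 [d hd]] := gu z hz.
    by apply: Fd hd; rewrite // (lt_le_trans hz).
  have [G dG] := primitive_ball dFu.
  exists (fun z => G z + (y - G w)) => _.
  have dG' z : nm (z - x1) < rho -> drv id (fun z => G z + (y - G w)) z (F z (u z)).
    by move=> hz; apply: drv_eq (drvD (dG z hz) (drv_cst id (y - G w) z)) _; rewrite addr0.
  split => //; last by ring.
  move=> z hz; split; last by eexists; exact: dG'.
  have := @mvi_ball R G _ x1 rho M z w dG _ hz hw.
  have FMu v : nm (v - x1) < rho -> nm (F v (u v)) <= M.
    by move=> hv; apply: FM; [exact: lt_le_trans rhoa|exact: (gu v hv).1].
  move=> /(_ FMu) h; have := dist z hz => hd.
  have -> : G z + (y - G w) - y1 = (G z - G w) + (y - y1) by ring.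
  have h2 : M * nm (z - w) <= M * (2 * rho) by rewrite ler_wpM2l.
  by have := nmD (G z - G w) (y - y1); lra.
pose H n := iter n nxt (fun=> y).
have gH n : good (H n).
  elim: n => [|n IH]; last by rewrite /H iterS; have [] := nxtP _ IH.
  by move=> z hz; split; [rewrite /H /=; lra|exists 0; exact: drv_cst].
have dH n z : nm (z - x1) < rho -> drv id (H n.+1) z (F z (H n z)).
  by rewrite /H iterS; have [_ _] := nxtP _ (gH n); apply.
have Hw n : H n w = y.
  by case: n => [|n] //; rewrite /H iterS; have [] := nxtP _ (gH n).
have FL' x u v : nm (x - x1) < rho -> nm (u - y1) < b -> nm (v - y1) < b ->
    nm (F x u - F x v) <= L' * nm (u - v).
  move=> hx hu hv; apply: (le_trans (FL _ _ _ (lt_le_trans hx rhoa) hu hv)).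
  by rewrite ler_wpM2r ?nm_ge0.
have diff n z : nm (z - x1) < rho -> nm (H n.+1 z - H n z) <= 2 * b * 2^-1 ^+ n.
  elim: n z => [|n IH] z hz.
    have := nm_tri (H 1%N z) y1 (H 0%N z); have [h1 _] := gH 1%N z hz.
    by have [h2 _] := gH 0%N z hz; rewrite (nmB y1) expr0 mulr1; lra.
  have := @mvi_ball R (fun z => H n.+2 z - H n.+1 z) (fun z => F z (H n.+1 z) - F z (H n z)) x1 rho
    (L' * (2 * b * 2^-1 ^+ n)) z w.
  rewrite !Hw subrr subr0 => h; apply: (le_trans (h _ _ hz hw)).
  - by move=> v hv; apply: drvB; exact: dH.
  - move=> v hv; apply: (le_trans (FL' _ _ _ hv (gH _ v hv).1 (gH _ v hv).1)).
    by rewrite ler_pM2l // IH.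
  apply: (@le_trans _ _ (L' * (2 * b * 2^-1 ^+ n) * (2 * rho))).
    by rewrite ler_wpM2l ?dist // !mulr_ge0 ?exprn_ge0 ?invr_ge0 // ltW.
  have -> : L' * (2 * b * 2^-1 ^+ n) * (2 * rho) = 2 * b * 2^-1 ^+ n * (L' * (2 * rho)) by ring.
  rewrite exprSr [X in _ <= X]mulrA ler_wpM2l // !mulr_ge0 ?exprn_ge0 ?invr_ge0 //; exact: ltW.
have diffk n k z : nm (z - x1) < rho -> nm (H (n + k)%N z - H n z) <= 4 * b * 2^-1 ^+ n * (1 - 2^-1 ^+ k).
  move=> hz; elim: k => [|k IH]; first by rewrite addn0 subrr nm0 expr0 subrr mulr0.
  apply: (le_trans (nm_tri _ (H (n + k)%N z) _)); rewrite addnS.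
  apply: (le_trans (lerD (diff _ _ hz) IH)); rewrite exprD exprS.
  rewrite le_eqVlt; apply/orP; left; apply/eqP.
  by field; rewrite ?expf_neq0 ?pnatr_eq0.
have q : 0 <= (2^-1 : R) < 1 by rewrite invr_ge0 ler0n /= invf_lt1 // ltr1n.
have /andP[q0 _] := q.
have cauH (e : R) : 0 < e -> exists N, forall n k z, (N <= n)%N -> nm (z - x1) < rho ->
    nm (H (n + k)%N z - H n z) <= e.
  move=> e0; have [|N NP] := small_pow q (e := e / (4 * b)); first by rewrite divr_gt0 // mulr_gt0.
  exists N => n k z /NP hn hz; apply: (le_trans (diffk n k z hz)).
  move: hn; rewrite ltr_pdivlMr ?mulr_gt0 // mulrC => hn.
  have hk : 0 <= 2^-1 ^+ k :> R by rewrite exprn_ge0.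
  have hb : 0 <= 4 * b * 2^-1 ^+ n by rewrite !mulr_ge0 ?exprn_ge0 // ltW.
  by nra.
have [|G unif] := @uniform_limit R (fun z => nm (z - x1) < rho) H.
  move=> e e0; have [|N NP] := cauH (e / 2); first by rewrite divr_gt0.
  exists N => m n z hm hn hz; have h1 := NP N (m - N)%N z (leqnn N) hz.
  have h2 := NP N (n - N)%N z (leqnn N) hz; rewrite !subnKC // in h1 h2.
  by have := nm_tri (H m z) (H N z) (H n z); rewrite (nmB (H N z)); lra.
have Gb z : nm (z - x1) < rho -> nm (G z - y1) < b.
  move=> hz; have [|N NP] := unif (b / 8); first by rewrite divr_gt0.
  have := NP N.+1 z (leqnSn N) hz; have h := dH N.
  have := @mvi_ball R (H N.+1) (fun z => F z (H N z)) x1 rho M z w h _ hz hw.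
  have FMu v : nm (v - x1) < rho -> nm (F v (H N v)) <= M.
    by move=> hv; apply: FM; [exact: lt_le_trans rhoa|exact: (gH N v hv).1].
  move=> /(_ FMu); rewrite Hw => h1 h2.
  have h3 : M * nm (z - w) <= M * (2 * rho) by rewrite ler_wpM2l // dist.
  have := nm_tri (G z) (H N.+1 z) y1; have := nm_tri (H N.+1 z) y y1.
  by rewrite (nmB (G z) (H _ z)); lra.
have [|||K [Kw dK HK]] := @dlim R (fun n => H n.+1) (fun n z => F z (H n z)) (fun z => F z (G z)) x1 rho w y hw.
- by move=> n z; exact: dH.
- by move=> n; exact: Hw.
- move=> e e0; have [|N NP] := unif (e / L'); first by rewrite divr_gt0.
  exists N => n z hn hz; apply: (le_trans (FL' _ _ _ hz (gH n z hz).1 (Gb z hz))).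
  by rewrite mulrC -ler_pdivlMr // NP.
- have KG z : nm (z - x1) < rho -> K z = G z.
    move=> hz; apply: nm_small => e e0.
    have e2 : 0 < e / 2 by rewrite divr_gt0.
    have [N1 h1] := unif _ e2; have [N2 h2] := HK _ e2.
    have := h1 (maxn N1 N2).+1 z; rewrite leqW ?leq_maxl // => /(_ isT hz).
    have := h2 (maxn N1 N2) z; rewrite leq_maxr => /(_ isT hz).
    have := nm_tri (K z) (H (maxn N1 N2).+1 z) (G z).
    by rewrite (nmB (K z) (H _ z)); lra.
  exists K; split=> // z hz; rewrite KG //; split; first exact: Gb.
  exact: dK.
Qed.

End Picard.

(** * Polynomials in two variables, polynomial equations *)

Section BivariatePolynomials.
Variable R : realType.
Local Notation C := (Cplx R).
Local Notation rc := (@rc R).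
Local Notation nm := (@nm R).

(** Evaluation of the outer variable at x and of the inner one at y, as in the
statement of the theorem. *)
Definition ev (P : {poly {poly C}}) (x y : C) : C := P.[x, y].

Lemma poly_drv (T : Type) (i : T -> C) (p : {poly C}) (v : T -> C) t d : drv i v t d ->
  exists d', drv i (fun s => p.[v s]) t d'.
Proof.
move=> dv; elim/poly_ind: p => [|p c [d' IH]].
  by exists 0; under eq_fun do rewrite horner0; exact: drv_cst.
eexists; under eq_fun do rewrite hornerMXaddC.
exact: drvD (drvM IH dv) (drv_cst i c t).
Qed.

Lemma ev_drv (T : Type) (i : T -> C) (P : {poly {poly C}}) (u v : T -> C) t d e :
  drv i u t d -> drv i v t e -> exists d', drv i (fun s => ev P (u s) (v s)) t d'.
Proof.
move=> du dv; rewrite /ev; elim/poly_ind: P => [|P c [d' IH]].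
  by exists 0; under eq_fun do rewrite !horner0; exact: drv_cst.
have [e' dc] := poly_drv c dv.
eexists; under eq_fun do rewrite hornerMXaddC hornerD hornerM hornerC.
exact: drvD (drvM IH du) dc.
Qed.

(** A common bound L for F and for its Lipschitz constant on the polydisc of
radius B; such functions are stable under sums and products. *)
Definition lipb (B L : R) (F : C -> C -> C) := 0 <= L /\ forall x y x' y',
  nm x <= B -> nm y <= B -> nm x' <= B -> nm y' <= B ->
  nm (F x y - F x' y') <= L * (nm (x - x') + nm (y - y')) /\ nm (F x y) <= L.

Lemma lipb_cst B c : exists L, lipb B L (fun _ _ => c).
Proof.
exists (nm c); split=> [|*]; first exact: nm_ge0.
by rewrite subrr nm0 mulr_ge0 ?addr_ge0 ?nm_ge0.
Qed.

Lemma lipb_fst B : 0 <= B -> exists L, lipb B L (fun x _ => x).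
Proof.
move=> B0; exists (B + 1); split=> [|x y x' y' hx hy hx' hy']; first lra.
by have := nm_ge0 (x - x'); have := nm_ge0 (y - y'); split; last lra; nra.
Qed.

Lemma lipb_snd B : 0 <= B -> exists L, lipb B L (fun _ y => y).
Proof.
move=> B0; exists (B + 1); split=> [|x y x' y' hx hy hx' hy']; first lra.
by have := nm_ge0 (x - x'); have := nm_ge0 (y - y'); split; last lra; nra.
Qed.

Lemma lipbD B F G : (exists L, lipb B L F) -> (exists L, lipb B L G) ->
  exists L, lipb B L (fun x y => F x y + G x y).
Proof.
move=> [L [L0 hF]] [K [K0 hG]]; exists (L + K); split; first exact: addr_ge0.
move=> x y x' y' h1 h2 h3 h4; have [f1 f2] := hF _ _ _ _ h1 h2 h3 h4.
have [g1 g2] := hG _ _ _ _ h1 h2 h3 h4; split.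
  have -> : F x y + G x y - (F x' y' + G x' y') = (F x y - F x' y') + (G x y - G x' y') by ring.
  by apply: (le_trans (nmD _ _)); rewrite mulrDl lerD.
by apply: (le_trans (nmD _ _)); rewrite lerD.
Qed.

Lemma lipbM B F G : (exists L, lipb B L F) -> (exists L, lipb B L G) ->
  exists L, lipb B L (fun x y => F x y * G x y).
Proof.
move=> [L [L0 hF]] [K [K0 hG]]; exists (L * K + L * K); split; first by rewrite addr_ge0 ?mulr_ge0.
move=> x y x' y' h1 h2 h3 h4; have [f1 f2] := hF _ _ _ _ h1 h2 h3 h4.
have [g1 g2] := hG _ _ _ _ h1 h2 h3 h4; have [_ f3] := hF _ _ _ _ h3 h4 h1 h2; split; last first.
  rewrite nmM; apply: (@le_trans _ _ (L * K)); last by rewrite lerDl mulr_ge0.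
  by rewrite ler_pM ?nm_ge0.
have -> : F x y * G x y - F x' y' * G x' y' = (F x y - F x' y') * G x y + F x' y' * (G x y - G x' y') by ring.
apply: (le_trans (nmD _ _)); rewrite !nmM [X in _ <= X]mulrDl; apply: lerD.
  rewrite mulrAC; apply: ler_pM; rewrite ?nm_ge0 //.
by rewrite -mulrA; apply: ler_pM; rewrite ?nm_ge0.
Qed.

Lemma lipb_ev B P : 0 <= B -> exists L, lipb B L (ev P).
Proof.
move=> B0; rewrite /ev; elim/poly_ind: P => [|P c IH].
  have [L h] := lipb_cst B 0; exists L.
  by rewrite (_ : (fun x y => _) = fun _ _ => 0) //; apply/funext => x; apply/funext => y; rewrite !horner0.
have hc : exists L, lipb B L (fun _ y => c.[y]).
  elim/poly_ind: c => [|p c IHp].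
    have [L h] := lipb_cst B 0; exists L.
    by rewrite (_ : (fun x y => _) = fun _ _ => 0) //; apply/funext => x; apply/funext => y; rewrite horner0.
  have [L h] := lipbD (lipbM IHp (lipb_snd B0)) (lipb_cst B c); exists L.
  rewrite (_ : (fun x y => _) = fun _ y => p.[y] * y + c) //.
  by apply/funext => x; apply/funext => y; rewrite hornerMXaddC.
have [L h] := lipbD (lipbM IH (lipb_fst B0)) hc; exists L.
rewrite (_ : (fun x y => _) = fun x y => P.[x, y] * x + c.[y]) //.
by apply/funext => x; apply/funext => y; rewrite hornerMXaddC hornerD hornerM hornerC.
Qed.

(** The equation q(x, y) y' = p(x, y) at the point x, free of division. *)
Definition ode (P Q : {poly {poly C}}) (g : C -> C) (x : C) :=
  exists d, drv id g x d /\ ev Q x (g x) * d = ev P x (g x).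

(** Near (x1, y1) the modulus of Q is bounded below, so P / Q is bounded and
Lipschitz there, and Picard iteration applies. *)
Lemma ode_exists (P Q : {poly {poly C}}) (x1 y1 : C) (e : R) : 0 < e -> ev Q x1 y1 != 0 ->
  exists (rho eta : R), [/\ 0 < rho <= e, 0 < eta & forall w y, nm (w - x1) < rho -> nm (y - y1) < eta ->
    exists H, H w = y /\ forall z, nm (z - x1) < rho ->
      [/\ nm (H z - y1) < e, ev Q z (H z) != 0 & ode P Q H z]].
Proof.
move=> e0 Q0; have q0 : 0 < nm (ev Q x1 y1) by rewrite nm_gt0.
pose B := nm x1 + nm y1 + e.
have B0 : 0 <= B by rewrite !addr_ge0 ?nm_ge0 // ltW.
have [L [L0 QL]] := lipb_ev Q B0; have [K [K0 PK]] := lipb_ev P B0.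
set q := nm (ev Q x1 y1) in q0.
(* on the polydisc of radius a the value of Q varies by at most half of its
   modulus at the centre *)
pose a := Num.min e (q / (4 * (L + 1))).
have L1 : 0 < L + 1 by rewrite ltr_wpDl.
have a0 : 0 < a by rewrite lt_min e0 divr_gt0 // mulr_gt0.
have ae : a <= e by rewrite ge_min lexx.
have aq : L * (2 * a) <= q / 2.
  have : a <= q / (4 * (L + 1)) by rewrite ge_min lexx orbT.
  rewrite ler_pdivlMr ?mulr_gt0 // => h.
  have : 0 <= L * a by rewrite mulr_ge0 // ltW.
  lra.
have Bx x : nm (x - x1) < a -> nm x <= B.
  by move=> h; have := nm_sub x x1; have := nm_ge0 y1; rewrite /B; lra.
have By y : nm (y - y1) < a -> nm y <= B.
  by move=> h; have := nm_sub y y1; have := nm_ge0 x1; rewrite /B; lra.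
have [Bx1 By1] : nm x1 <= B /\ nm y1 <= B by rewrite Bx ?By ?subrr ?nm0.
have Qlow x y : nm (x - x1) < a -> nm (y - y1) < a -> q / 2 <= nm (ev Q x y).
  move=> hx hy; have [h _] := QL _ _ _ _ Bx1 By1 (Bx _ hx) (By _ hy).
  rewrite (nmB x1) (nmB y1) in h; have := nm_sub (ev Q x1 y1) (ev Q x y); rewrite -/q => h'.
  have : L * (nm (x - x1) + nm (y - y1)) <= L * (2 * a) by rewrite ler_wpM2l //; lra.
  lra.
have Qn0 x y : nm (x - x1) < a -> nm (y - y1) < a -> ev Q x y != 0.
  by move=> hx hy; rewrite -nm_gt0; have := Qlow _ _ hx hy; lra.
have Qinv x y : nm (x - x1) < a -> nm (y - y1) < a -> nm (ev Q x y)^-1 <= 2 / q.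
  move=> hx hy; have := Qlow _ _ hx hy; rewrite nmV => h.
  have -> : 2 / q = (q / 2)^-1 by field; rewrite gt_eqF.
  by rewrite lef_pV2 ?posrE ?divr_gt0 // (lt_le_trans _ h) // divr_gt0.
have qi : 0 <= 2 / q by rewrite divr_ge0 // ltW.
have [|||rho /andP[rho0 rhoa] H] := @picard R (fun x y => ev P x y / ev Q x y) x1 y1 a a
  (K * (2 / q)) (K * (2 / q) + K * L * (2 / q) ^+ 2) a0 a0.
- move=> x y hx hy; rewrite nmM; apply: ler_pM; rewrite ?nm_ge0 ?Qinv //.
  by have [] := PK _ _ _ _ (Bx _ hx) (By _ hy) Bx1 By1.
- move=> x y y' hx hy hy'.
  have [p1 _] := PK _ _ _ _ (Bx _ hx) (By _ hy) (Bx _ hx) (By _ hy').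
  have [q1 _] := QL _ _ _ _ (Bx _ hx) (By _ hy) (Bx _ hx) (By _ hy').
  have [_ p2] := PK _ _ _ _ (Bx _ hx) (By _ hy') (Bx _ hx) (By _ hy').
  rewrite subrr nm0 add0r in p1 q1.
  have [n1 n2] := (Qn0 _ _ hx hy, Qn0 _ _ hx hy').
  have [i1 i2] := (Qinv _ _ hx hy, Qinv _ _ hx hy').
  have -> : ev P x y / ev Q x y - ev P x y' / ev Q x y' =
    (ev P x y - ev P x y') / ev Q x y - ev P x y' * (ev Q x y - ev Q x y') * ((ev Q x y)^-1 * (ev Q x y')^-1).
    by field; rewrite n1 n2.
  apply: (le_trans (nmD _ _)); rewrite nmN [X in _ <= X]mulrDl; apply: lerD.
    by rewrite nmM [X in _ <= X]mulrAC; apply: ler_pM; rewrite ?nm_ge0.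
  rewrite 3!nmM; have -> : K * L * (2 / q) ^+ 2 * nm (y - y') = K * (L * nm (y - y')) * (2 / q * (2 / q)).
    by ring.
  apply: ler_pM; rewrite ?mulr_ge0 ?nm_ge0 //; first by apply: ler_pM; rewrite ?nm_ge0.
  by apply: ler_pM; rewrite ?nm_ge0.
- move=> u x d hx hu du.
  have [d1 h1] := ev_drv P (drv_id id x) du; have [d2 h2] := ev_drv Q (drv_id id x) du.
  by eexists; apply: drvM h1 _; apply: drvV h2; exact: Qn0.
exists rho, (a / 2); split; [by rewrite rho0 (le_trans rhoa)|by rewrite divr_gt0|].
move=> w y hw hy; have [G [Gw GP]] := H w y hw hy; exists G; split=> // z hz.
have [h1 h2] := GP z hz; have za : nm (z - x1) < a by exact: lt_le_trans rhoa.
split; [exact: lt_le_trans ae|exact: Qn0|].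
by exists (ev P z (G z) / ev Q z (G z)); split => //; rewrite mulrC divfK // Qn0.
Qed.

End BivariatePolynomials.

(** * Analytic continuation along a path *)

Section Continuation.
Variable R : realType.
Local Notation C := (Cplx R).
Local Notation rc := (@rc R).
Local Notation nm := (@nm R).

Definition sgerm (z : C) (f g : C -> C) := exists2 e : R, 0 < e & forall w, nm (w - z) < e -> f w = g w.

Lemma sgermP z f g : germ_eq z f g <-> sgerm z f g.
Proof. exact: nearC. Qed.

Lemma sgerm_refl z f : sgerm z f f.
Proof. by exists 1. Qed.
Lemma sgerm_sym z f g : sgerm z f g -> sgerm z g f.
Proof. by move=> [e e0 h]; exists e => // w /h. Qed.
Lemma sgerm_trans z f g h : sgerm z f g -> sgerm z g h -> sgerm z f h.
Proof.
move=> [e e0 h1] [e' e'0 h2]; exists (Num.min e e'); first by rewrite lt_min e0.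
by move=> w; rewrite lt_min => /andP[/h1 -> /h2].
Qed.
Lemma sgerm_at z f g : sgerm z f g -> f z = g z.
Proof. by move=> [e e0 h]; apply: h; rewrite subrr nm0. Qed.

Lemma sgerm_drv z f g d : sgerm z f g -> drv id f z d -> drv id g z d.
Proof. by move=> [e e0 h] df; exact: (drv_near e0 h df). Qed.

Lemma sgerm_open z f g : sgerm z f g -> exists2 e : R, 0 < e & forall w, nm (w - z) < e -> sgerm w f g.
Proof.
move=> [e e0 h]; exists e => // w hw; exists (e - nm (w - z)); first by rewrite subr_gt0.
by move=> v hv; apply: h; have := nm_tri v w z; lra.
Qed.

(** The identity theorem in terms of germs. *)
Lemma sgerm_ball f g a r z0 z1 : hol_ball f a r -> hol_ball g a r -> nm (z0 - a) < r -> nm (z1 - a) < r ->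
  sgerm z0 f g -> sgerm z1 f g.
Proof.
move=> df dg h0 h1 [e e0 he].
have dfg : hol_ball (fun z => f z - g z) a r.
  by move=> z hz; have [d hd] := df z hz; have [d' hd'] := dg z hz; eexists; exact: drvB hd hd'.
exists (r - nm (z1 - a)); first by rewrite subr_gt0.
move=> w hw; apply/eqP; rewrite -subr_eq0; apply/eqP.
apply: (@identity_ball R (fun z => f z - g z) a r z0) => //.
  by have := nm_tri w z1 a; lra.
by exists e => // z /he ->; rewrite subrr.
Qed.

Lemma holoP (c : C) (r : R) (F : C -> C) : holomorphic_on (ball c (rc r)) F <-> hol_ball F c r.
Proof.
split=> [h z hz|h z]; first by apply/derivP/h; rewrite ballrc.
by rewrite ballrc => hz; apply/derivP/h.
Qed.

(** Continuity on [0, 1] only: nothing is known of a path elsewhere. *)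
Definition path_cont (gamma : R -> C) := forall s : R, 0 <= s <= 1 -> forall e : R, 0 < e ->
  exists2 eta : R, 0 < eta & forall s', 0 <= s' <= 1 -> `|s' - s| < eta -> nm (gamma s' - gamma s) < e.

Lemma is_pathP gamma : is_path gamma -> path_cont gamma.
Proof.
move=> /subspace_continuousP h s hs e e0.
have hs' : `[0, 1]%classic s by rewrite /= in_itv.
have U : nbhs (gamma s) [set z | nm (z - gamma s) < e] by apply/nearC; exists e.
have /nearR[eta eta0 H] := h s hs' _ U.
by exists eta => // s' hs'' /H; apply; rewrite /= in_itv.
Qed.

Lemma is_path_cst c : is_path (fun=> c : C).
Proof. by apply: continuous_subspaceT => x; exact: cvg_cst. Qed.

(** A continuous family of germs along the path: near each parameter the germs
are those of a single holomorphic function. Unlike a chain of discs, such a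
family can be restricted, glued and compared pointwise. *)
Definition germ_fam (gamma : R -> C) (a b : R) (G : R -> C -> C) := forall s, a <= s <= b ->
  exists F (e eta : R), [/\ 0 < e, 0 < eta, hol_ball F (gamma s) e &
    forall s', a <= s' <= b -> `|s' - s| < eta -> nm (gamma s' - gamma s) < e /\ sgerm (gamma s') (G s') F].

Lemma fam_sub gamma a b a' b' G : germ_fam gamma a b G -> a <= a' -> b' <= b -> germ_fam gamma a' b' G.
Proof.
move=> h aa bb s /andP[s1 s2]; have [|F [e [eta [e0 eta0 dF hF]]]] := h s.
  by rewrite (le_trans aa) // (le_trans s2).
exists F, e, eta; split => // s' /andP[s1' s2']; apply: hF.
by rewrite (le_trans aa) // (le_trans s2').
Qed.

Lemma fam_geq gamma a b G G' : germ_fam gamma a b G -> (forall s, a <= s <= b -> sgerm (gamma s) (G s) (G' s)) ->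
  germ_fam gamma a b G'.
Proof.
move=> h hG s hs; have [F [e [eta [e0 eta0 dF hF]]]] := h s hs.
exists F, e, eta; split => // s' hs' h'; have [h1 h2] := hF s' hs' h'; split => //.
exact: sgerm_trans (sgerm_sym (hG _ hs')) h2.
Qed.

Lemma fam_hol gamma a b G s : germ_fam gamma a b G -> a <= s <= b -> exists2 e : R, 0 < e & hol_ball (G s) (gamma s) e.
Proof.
move=> h hs; have [F [e [eta [e0 eta0 dF hF]]]] := h s hs.
have [|_ gF] := hF s hs; first by rewrite subrr normr0.
have [e' e'0 g'] := sgerm_open (sgerm_sym gF).
exists (Num.min e e'); first by rewrite lt_min e0.
move=> z; rewrite lt_min => /andP[h1 h2]; have [d hd] := dF z h1.
by exists d; exact: sgerm_drv (g' _ h2) hd.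
Qed.

Lemma fam_cst gamma a b c r F : path_cont gamma -> 0 <= a -> b <= 1 -> hol_ball F c r ->
  (forall s, a <= s <= b -> nm (gamma s - c) < r) -> germ_fam gamma a b (fun=> F).
Proof.
move=> pg a0 b1 dF h s /andP[h1 h2].
have hs : nm (gamma s - c) < r by apply: h; rewrite h1.
have e0 : 0 < r - nm (gamma s - c) by rewrite subr_gt0.
have hs01 : 0 <= s <= 1 by rewrite (le_trans a0) // (le_trans h2).
have [eta eta0 he] := pg s hs01 _ e0.
exists F, (r - nm (gamma s - c)), eta; split => //.
  by apply: hol_ballS dF _; lra.
move=> s' /andP[h1' h2'] hss; split; last exact: sgerm_refl.
by apply: he; rewrite // (le_trans a0) // (le_trans h2').
Qed.

Lemma fam_cat gamma a b c G G' : path_cont gamma -> 0 <= a -> a <= b -> b <= c -> c <= 1 ->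
  germ_fam gamma a b G -> germ_fam gamma b c G' -> sgerm (gamma b) (G b) (G' b) ->
  germ_fam gamma a c (fun s => if s <= b then G s else G' s).
Proof.
move=> pg a0 ab bc c1 hG hG' gb s /andP[as_ sc].
have [sb|bs|sb] := ltgtP s b.
- have [|F [e [eta [e0 eta0 dF hF]]]] := hG s; first by rewrite as_ ltW.
  exists F, e, (Num.min eta (b - s)); split => //; first by rewrite lt_min eta0 subr_gt0.
  move=> s' /andP[h1 h2]; rewrite lt_min => /andP[h3 h4].
  have s'b : s' <= b by move: h4; rewrite ltr_norml => /andP[_]; lra.
  by rewrite s'b; apply: hF; rewrite // h1.
- have [|F [e [eta [e0 eta0 dF hF]]]] := hG' s; first by rewrite ltW.
  exists F, e, (Num.min eta (s - b)); split => //; first by rewrite lt_min eta0 subr_gt0.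
  move=> s' /andP[h1 h2]; rewrite lt_min => /andP[h3 h4].
  have s'b : b < s' by move: h4; rewrite ltr_norml => /andP[]; lra.
  by rewrite leNgt s'b /=; apply: hF; rewrite // ltW.
subst s; have [|F [e [eta [e0 eta0 dF hF]]]] := hG b; first by rewrite ab lexx.
have [|F' [e' [eta' [e'0 eta'0 dF' hF']]]] := hG' b; first by rewrite lexx bc.
have [||_ gF] := hF b; [by rewrite ab lexx|by rewrite subrr normr0|].
have [||_ gF'] := hF' b; [by rewrite lexx bc|by rewrite subrr normr0|].
have [d d0 FF] := sgerm_open (sgerm_trans (sgerm_sym gF) (sgerm_trans gb gF')).
have b01 : 0 <= b <= 1 by rewrite (le_trans a0) // (le_trans bc).
have m0 : 0 < Num.min e d by rewrite lt_min e0.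
have [eta2 eta20 he2] := pg b b01 _ m0.
exists F, (Num.min e d), (Num.min eta2 (Num.min eta eta')); split => //.
- by rewrite !lt_min eta20 eta0.
- by move=> z; rewrite lt_min => /andP[/dF].
move=> s' /andP[h1 h2]; rewrite !lt_min => /and3P[h3 h4 h5].
have s'01 : 0 <= s' <= 1 by rewrite (le_trans a0) // (le_trans h2).
have := he2 s' s'01 h3; rewrite lt_min => /andP[n1 n2]; rewrite n1 n2; split => //.
case: leP => hb; first by have [] := hF s' _ h4; rewrite // h1.
have [|_ g1] := hF' s' _ h5; first by rewrite ltW.
exact: sgerm_trans g1 (sgerm_sym (FF _ n2)).
Qed.

(** By induction on the number of discs, gluing at the subdivision points: two
consecutive discs both contain the image of such a point, and there the two
functions have the same germ. *)
Lemma chain_fam gamma (n : nat) (t : nat -> R) (c : nat -> C) (r : nat -> R) (F : nat -> C -> C) : path_cont gamma ->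
  0 <= t 0%N -> t n.+1 <= 1 -> (forall i, (i <= n)%N -> t i <= t i.+1) ->
  (forall i, (i <= n)%N -> hol_ball (F i) (c i) (r i) /\
     forall s, t i <= s <= t i.+1 -> nm (gamma s - c i) < r i) ->
  (forall i, (i < n)%N -> forall z, nm (z - c i) < r i -> nm (z - c i.+1) < r i.+1 -> F i z = F i.+1 z) ->
  exists G, [/\ germ_fam gamma (t 0%N) (t n.+1) G, sgerm (gamma (t 0%N)) (G (t 0%N)) (F 0%N),
    sgerm (gamma (t n.+1)) (G (t n.+1)) (F n) & t 0%N <= t n.+1].
Proof.
move=> pg t0; elim: n => [|n IH] t1 tS hF hFF.
  have [dF h] := hF 0%N isT; exists (fun=> F 0%N); split; try exact: sgerm_refl.
    exact: fam_cst dF h.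
  exact: tS.
have tn := tS n.+1 (leqnn _).
have [||||G [fG G0 Gn ttn]] := IH.
- exact: le_trans tn t1.
- by move=> i hi; apply: tS; exact: leqW.
- by move=> i hi; apply: hF; exact: leqW.
- by move=> i hi; apply: hFF; exact: leqW.
have [dF h] := hF n.+1 (leqnn _); have [dFn hn] := hF n (leqnSn _).
have tn0 : 0 <= t n.+1 by exact: le_trans ttn.
have fc := fam_cst pg tn0 t1 dF h.
have p1 : nm (gamma (t n.+1) - c n) < r n by apply: hn; rewrite lexx tS //.
have p2 : nm (gamma (t n.+1) - c n.+1) < r n.+1 by apply: h; rewrite lexx tn.
have gFF : sgerm (gamma (t n.+1)) (F n) (F n.+1).
  exists (Num.min (r n - nm (gamma (t n.+1) - c n)) (r n.+1 - nm (gamma (t n.+1) - c n.+1))).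
    by rewrite lt_min !subr_gt0 p1.
  move=> w; rewrite lt_min => /andP[w1 w2]; apply: (hFF n) => //.
    by have := nm_tri w (gamma (t n.+1)) (c n); lra.
  by have := nm_tri w (gamma (t n.+1)) (c n.+1); lra.
have fcat := fam_cat pg t0 ttn tn t1 fG fc (sgerm_trans Gn gFF).
exists (fun s => if s <= t n.+1 then G s else F n.+1); split => //.
- by rewrite ttn.
- have [h'|h'] := leP (t n.+2) (t n.+1); last exact: sgerm_refl.
  have -> : t n.+2 = t n.+1 by apply/eqP; rewrite eq_le h' tn.
  exact: sgerm_trans Gn gFF.
exact: le_trans tn.
Qed.

Lemma cont_fam gamma T f g : path_cont gamma -> T <= 1 -> continuation gamma T f g ->
  0 <= T /\ exists G, [/\ germ_fam gamma 0 T G, sgerm (gamma 0) (G 0) f & sgerm (gamma T) (G T) g].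
Proof.
move=> pg T1 [n [t [c [r [F [[t0 tT tS] hF hFF f0 gT]]]]]].
have /choice[r' r'P] : forall i, exists r' : R, (i <= n)%N -> r i = rc r'.
  move=> i; have [hi|hi] := leqP i n; last by exists 0.
  by have [r0 _ _] := hF i hi; have [r' _ ->] := gt0rc r0; exists r'.
have [|||||G [fG G0 Gn ttn]] := @chain_fam gamma n t c r' F pg.
- by rewrite t0.
- by rewrite tT.
- exact: tS.
- move=> i hi; have [_ h1 h2] := hF i hi; rewrite r'P // in h1 h2; split; first exact/holoP.
  by move=> s /h2; rewrite ballrc.
- move=> i hi z h1 h2; apply: (hFF i hi); rewrite r'P ?ballrc //; exact: ltnW.
rewrite t0 tT in fG G0 Gn ttn; split => //; exists G; split => //.
  by apply: sgerm_trans G0 (sgerm_sym _); exact/sgermP.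
by apply: sgerm_trans Gn _; exact/sgermP.
Qed.

Lemma cont_geqr gamma T f g g' : continuation gamma T f g -> sgerm (gamma T) g g' -> continuation gamma T f g'.
Proof.
move=> [n [t [c [r [F [h1 h2 h3 h4 h5]]]]]] h; exists n, t, c, r, F.
apply: And5 h1 h2 h3 h4 _.
by apply/sgermP; apply: sgerm_trans h; exact/sgermP.
Qed.

Lemma cont_geql gamma T f f' g : continuation gamma T f g -> sgerm (gamma 0) f f' -> continuation gamma T f' g.
Proof.
move=> [n [t [c [r [F [h1 h2 h3 h4 h5]]]]]] h; exists n, t, c, r, F.
apply: And5 h1 h2 h3 _ h5.
by apply/sgermP; apply: sgerm_trans (sgerm_sym h) _; exact/sgermP.
Qed.

Lemma cont0 gamma f (e : R) : 0 < e -> hol_ball f (gamma 0) e -> continuation gamma 0 f f.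
Proof.
move=> e0 df; exists 0%N, (fun=> 0), (fun=> gamma 0), (fun=> rc e), (fun=> f); split.
- by split.
- move=> i _; split; first by rewrite -(rmorph0 rc) ltrc.
    exact/holoP.
  by move=> s hs; rewrite ballrc; have -> : s = 0; [by apply/eqP; rewrite eq_le andbC; exact: hs|rewrite subrr nm0].
- by [].
- exact/sgermP/sgerm_refl.
- exact/sgermP/sgerm_refl.
Qed.

(** A disc is added at the end of a chain. The identity theorem on the
intersection of two discs, which is convex, gives the agreement that a chain
requires. *)
Lemma cont_ext gamma T T' f g G c (r : R) : continuation gamma T f g -> T <= T' -> hol_ball G c r ->
  (forall s, T <= s <= T' -> nm (gamma s - c) < r) -> sgerm (gamma T) g G -> continuation gamma T' f G.
Proof.
move=> [n [t [cc [rr [F [[t0 tT tS] hF hFF f0 gT]]]]]] TT dG hG gG.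
have hT : nm (gamma T - c) < r by apply: hG; rewrite lexx TT.
have r0 : 0 < r by exact: le_lt_trans (nm_ge0 _) hT.
exists n.+1, (fun i => if (i <= n.+1)%N then t i else T'), (fun i => if (i <= n)%N then cc i else c),
  (fun i => if (i <= n)%N then rr i else rc r), (fun i => if (i <= n)%N then F i else G); split.
- split => //; first by rewrite ltnn.
  move=> i hi; rewrite hi ltnS; move: hi; rewrite leq_eqVlt => /orP[/eqP ->|hi].
    by rewrite ltnn tT.
  by rewrite ltnS in hi; rewrite hi; exact: tS.
- move=> i hi; have [->|{}hi] : i = n.+1 \/ (i <= n)%N.
    by move: hi; rewrite leq_eqVlt ltnS => /orP[/eqP|]; [left|right].
    rewrite ltnn leqnn ltnn tT; split; first by rewrite -(rmorph0 rc) ltrc.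
      exact/holoP.
    by move=> s hs; rewrite ballrc; exact: hG.
  rewrite hi (leqW hi) ltnS hi; exact: hF.
- move=> i; rewrite ltnS => hi z; rewrite hi; move: hi; rewrite leq_eqVlt => /orP[/eqP ->|hi]; last first.
    by rewrite hi; exact: hFF.
  rewrite ltnn => h1; rewrite ballrc => h2.
  have [rn0 hFn hsn] := hF n (leqnn _); have [r' r'0 rE] := gt0rc rn0.
  rewrite rE in h1 hFn hsn; rewrite ballrc in h1; have {}hFn := (holoP _ _ _).1 hFn.
  apply/eqP; rewrite -subr_eq0; apply/eqP.
  have hTn : nm (gamma T - cc n) < r'.
    have := hsn T; rewrite ballrc; apply; rewrite tT lexx andbT -tT; exact: tS.
  apply: (@identity_conv R (fun z => nm (z - cc n) < r' /\ nm (z - c) < r) (fun z => F n z - G z) (gamma T)) => //.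
  + by move=> z1 z2 s [a1 a2] [b1 b2] hs; split; exact: ball_conv.
  + move=> w [w1 w2]; have [e1 e10 d1] := hol_ball_near hFn w1; have [e2 e20 d2] := hol_ball_near dG w2.
    exists (Num.min e1 e2); first by rewrite lt_min e10.
    move=> v; rewrite lt_min => /andP[/d1[a ha] /d2[b hb]]; eexists; exact: drvB ha hb.
  have [e e0 he] := sgerm_trans ((sgermP _ _ _).1 gT) gG.
  by exists e => // w /he ->; rewrite subrr.
- exact: f0.
- by rewrite ltnn; exact/sgermP/sgerm_refl.
Qed.

(** Conversely, a family of germs can be covered by a chain of discs, by real
induction. *)
Lemma fam_cont gamma T G : 0 <= T -> germ_fam gamma 0 T G -> continuation gamma T (G 0) (G T).
Proof.
move=> T0 fG; apply: (@real_ind _ (fun t => continuation gamma t (G 0) (G t)) 0 T); first exact: T0.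
  have [|e e0 h] := fam_hol (s := 0) fG; first by rewrite lexx.
  exact: cont0 h.
move=> s hs; have [F [e [eta [e0 eta0 dF hF]]]] := fG s hs.
exists eta; first exact: eta0.
move=> s1 s2 s10 s12 s2T h1 h2 c1.
have [|_ g1] := hF s1 _ h1; first by rewrite s10 (le_trans s12).
have [|_ g2] := hF s2 _ h2; first by rewrite (le_trans s10).
apply: cont_geqr (sgerm_sym g2); apply: (cont_ext c1 s12 dF _ g1) => s' /andP[h3 h4].
have [] // := hF s'; first by rewrite (le_trans s10) // (le_trans h4).
by move: h1 h2; rewrite !ltr_norml => /andP[? ?] /andP[? ?]; apply/andP; split; lra.
Qed.

(** The form in which identities between holomorphic functions are continued
analytically. *)
Lemma fam_ind gamma a b G (P : R -> (C -> C) -> Prop) : germ_fam gamma a b G ->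
  (forall s f g, sgerm (gamma s) f g -> P s f -> P s g) ->
  (forall s F (e : R), a <= s <= b -> 0 < e -> hol_ball F (gamma s) e -> sgerm (gamma s) (G s) F ->
     (exists2 eta : R, 0 < eta & forall s', a <= s' <= b -> `|s' - s| < eta -> nm (gamma s' - gamma s) < e) ->
     exists2 eta : R, 0 < eta & forall s1 s2, a <= s1 -> s1 <= s2 -> s2 <= b ->
       `|s1 - s| < eta -> `|s2 - s| < eta -> P s1 F -> P s2 F) ->
  P a (G a) -> forall s, a <= s <= b -> P s (G s).
Proof.
move=> fG Pg Pl Pa; apply: real_ind_all => // s hs.
have [F [e [eta [e0 eta0 dF hF]]]] := fG s hs.
have [|_ gF] := hF s hs; first by rewrite subrr normr0.
have [|eta' eta'0 H] := Pl s F e hs e0 dF gF.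
  by exists eta => // s' h1 h2; have [] := hF s' h1 h2.
exists (Num.min eta eta'); first by rewrite lt_min eta0.
move=> s1 s2 as1 s12 s2b; rewrite !lt_min => /andP[h1 h1'] /andP[h2 h2'] P1.
have [|_ g1] := hF s1 _ h1; first by rewrite as1 (le_trans s12).
have [|_ g2] := hF s2 _ h2; first by rewrite (le_trans as1).
by apply: (Pg _ _ _ (sgerm_sym g2)); apply: (H s1 s2) => //; exact: (Pg _ _ _ g1).
Qed.

Lemma fam_unique gamma a b G G' : germ_fam gamma a b G -> germ_fam gamma a b G' -> sgerm (gamma a) (G a) (G' a) ->
  forall s, a <= s <= b -> sgerm (gamma s) (G s) (G' s).
Proof.
move=> fG fG' ga.
have := @fam_ind gamma a b G (fun s f => sgerm (gamma s) f (G' s)) fG; apply => //.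
  by move=> s f g h1 h2; exact: sgerm_trans (sgerm_sym h1) h2.
move=> s F e hs e0 dF _ [eta eta0 he].
have [F' [e' [eta' [e'0 eta'0 dF' hF']]]] := fG' s hs.
exists (Num.min eta eta'); first by rewrite lt_min eta0.
move=> s1 s2 as1 s12 s2b; rewrite !lt_min => /andP[h1 h1'] /andP[h2 h2'] P1.
have s1b : a <= s1 <= b by rewrite as1 (le_trans s12).
have as2 : a <= s2 <= b by rewrite (le_trans as1).
have [n1 g1] := hF' s1 s1b h1'; have [n2 g2] := hF' s2 as2 h2'.
apply: sgerm_trans (sgerm_sym g2).
apply: (@sgerm_ball F F' (gamma s) (Num.min e e') (gamma s1)).
- by move=> z; rewrite lt_min => /andP[/dF].
- by move=> z; rewrite lt_min => /andP[_ /dF'].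
- by rewrite lt_min n1 he.
- by rewrite lt_min n2 he.
exact: sgerm_trans P1 g1.
Qed.

Lemma cont_unique gamma T f g g' : path_cont gamma -> T <= 1 ->
  continuation gamma T f g -> continuation gamma T f g' -> sgerm (gamma T) g g'.
Proof.
move=> pg T1 /(cont_fam pg T1)[T0 [G [fG G0 GT]]] /(cont_fam pg T1)[_ [G' [fG' G'0 G'T]]].
apply: sgerm_trans (sgerm_sym GT) (sgerm_trans _ G'T).
apply: fam_unique fG fG' (sgerm_trans G0 (sgerm_sym G'0)) _ _.
by rewrite T0 lexx.
Qed.

(** The continuations along the initial segments of the path fit together, by
uniqueness, into one family over [0, 1). *)
Lemma leads_fam x0 f gamma : leads_to_singularity x0 f gamma -> path_cont gamma ->
  exists g : R -> C -> C, [/\ forall T, T < 1 -> germ_fam gamma 0 T g, sgerm (gamma 0) f (g 0) &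
    forall T h, T < 1 -> continuation gamma T f h -> sgerm (gamma T) (g T) h].
Proof.
move=> [_ _ hc _] pg.
have /choice[g gP] : forall t : R, exists g, 0 <= t < 1 -> continuation gamma t f g.
  move=> t; have [ht|ht] := boolP (0 <= t < 1); last by exists f.
  have [|g hg] := hc (1 - t); first by lra.
  by exists g; rewrite opprB addrC subrK in hg.
exists g; have uniq T h : T < 1 -> continuation gamma T f h -> sgerm (gamma T) (g T) h.
  move=> T1 ch; have [T0 _] := cont_fam pg (ltW T1) ch.
  by apply: cont_unique (ltW T1) _ ch => //; apply: gP; rewrite T0.
split=> // [T T1|].
  have [T0|T0] := leP 0 T; last first.
    by move=> s /andP[s0 sT]; have := le_lt_trans (le_trans s0 sT) T0; rewrite ltxx.
  have [|_ [G [fG G0 GT]]] := cont_fam pg (ltW T1) (gP T _); first by rewrite T0.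
  apply: (fam_geq fG) => s /andP[s0 sT]; apply: sgerm_sym; apply: uniq; first exact: le_lt_trans T1.
  exact: (cont_geql (fam_cont s0 (fam_sub fG (lexx 0) sT)) G0).
have h01 : 0 <= (0 : R) < 1 by rewrite lexx ltr01.
have [_ [G [fG G0 GT]]] := cont_fam pg ler01 (gP 0 h01).
exact: sgerm_trans (sgerm_sym G0) GT.
Qed.

End Continuation.

(** * Normal form of the equation, and its form at infinity *)

Section Algebra.
Variable R : realType.
Local Notation C := (Cplx R).
Local Notation rc := (@rc R).
Local Notation nm := (@nm R).
Local Notation ev := (@ev R).

Lemma roots_seq (a : {poly C}) : a != 0 -> exists rs : seq C, forall x, a.[x] = 0 -> x \in rs.
Proof.
move=> a0; have [rs aE] := closed_field_poly_normal a; exists rs => x ax.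
have : root a x by apply/eqP.
by rewrite aE rootZ ?lead_coef_eq0 // root_prod_XsubC.
Qed.

(** The witness has a modulus larger than the sum of the moduli of the roots. *)
Lemma nonroot (a : {poly C}) : a != 0 -> exists y, a.[y] != 0.
Proof.
move=> /roots_seq[rs h]; pose M := \sum_(r <- rs) nm r.
exists (rc (1 + M)); apply/eqP => /h hin.
have M0 s : 0 <= \sum_(r <- s) nm r by apply: sumr_ge0 => *; exact: nm_ge0.
have MM : 0 <= 1 + M by rewrite addr_ge0 // M0.
have := nmrc (1 + M); rewrite ger0_norm // => E.
have : nm (rc (1 + M)) <= M.
  rewrite /M; elim: rs {h M MM M0 E} (rc _) hin => // r rs IH z.
  rewrite in_cons big_cons => /orP[/eqP ->|/IH h].
    by rewrite lerDl sumr_ge0 // => *; exact: nm_ge0.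
  by apply: (le_trans h); rewrite lerDr nm_ge0.
by rewrite E; lra.
Qed.

Lemma poly_hol (a : {poly C}) x e : hol_ball (fun z => a.[z]) x e.
Proof. by move=> z _; exact: poly_drv (drv_id id z). Qed.

Lemma nonroot_ball (a : {poly C}) x e : a != 0 -> 0 < e -> exists2 y, nm (y - x) < e & a.[y] != 0.
Proof.
move=> a0 e0; apply: contrapT => h; have [y /eqP] := nonroot a0; apply.
apply: (@identity_ball R (fun z => a.[z]) x (nm (y - x) + 1) x).
- exact: poly_hol.
- by rewrite subrr nm0 ltr_wpDl ?nm_ge0.
- by rewrite ltrDl.
exists e => // z hz; apply/eqP; apply: contrapT => /negP az; apply: h.
by exists z.
Qed.

Lemma ev_swap s x y : ev (swapXY s) x y = s.[y, x].
Proof. exact: horner2_swapXY. Qed.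

Lemma horner2_scale (a : {poly C}) (s : {poly {poly C}}) y x : (a *: s).[y, x] = a.[x] * s.[y, x].
Proof. by rewrite hornerZ hornerM. Qed.

Lemma horner2M (s t : {poly {poly C}}) y x : (s * t).[y, x] = s.[y, x] * t.[y, x].
Proof. by rewrite !hornerM. Qed.

(** Pseudo-division by the greatest common divisor in C[x][y], and a Bezout
identity: u s' + v t' is a nonzero polynomial d(x), so the common zeros of s'
and t' lie over the zeros of d. *)
Lemma coprime_form (s t : {poly {poly C}}) : t != 0 -> exists (a d : {poly C}) (g s' t' : {poly {poly C}}),
  [/\ a != 0, d != 0, t' != 0, (a *: s = s' * g) /\ (a *: t = t' * g) &
   forall x y, d.[x] != 0 -> s'.[y, x] = 0 -> t'.[y, x] = 0 -> False].
Proof.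
move=> t0; set g := gcdp s t.
have g0 : g != 0 by rewrite gcdp_eq0 (negPf t0) andbF.
have /Pdiv.WeakIdomain.dvdpP[[a1 s1] /= a10 e1] := dvdp_gcdl s t.
have /Pdiv.WeakIdomain.dvdpP[[a2 t1] /= a20 e2] := dvdp_gcdr s t.
have [[u v] /= /eqpP[[c1 c2] /= /andP[c10 c20] e3]] := Bezoutp s t.
rewrite -/g in e1 e2 e3.
exists (a1 * a2), (c2 * (a1 * a2)), g, (a2 *: s1), (a1 *: t1).
have es : (a1 * a2) *: s = a2 *: s1 * g by rewrite mulrC -scalerA e1 scalerAl.
have et : (a1 * a2) *: t = a1 *: t1 * g by rewrite -scalerA e2 scalerAl.
have a0 : a1 * a2 != 0 by rewrite mulf_neq0.
split => //; first by rewrite mulf_neq0.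
  apply/eqP => h; move: et; rewrite h mul0r => /eqP.
  by rewrite -mul_polyC mulf_eq0 polyC_eq0 (negPf a0) (negPf t0).
have eb : c1 *: (u * (a2 *: s1) + v * (a1 *: t1)) = (c2 * (a1 * a2))%:P.
  apply: (mulIf g0); rewrite mul_polyC [c2 * _]mulrC -[(_ * c2) *: g]scalerA -e3.
  rewrite [_ *: (_ *: (_ + _))]scalerA [_ * c1]mulrC -[LHS]scalerAl -[RHS]scalerA; congr (_ *: _).
  by rewrite mulrDl scalerDr -!mulrA -es -et !scalerAr.
move=> x y dx sx tx; move/(congr1 (fun w => w.[y, x])): eb.
rewrite horner2_scale hornerD hornerD !horner2M sx tx !mulr0 addr0 mulr0 hornerC.
by move=> /esym/eqP; rewrite (negPf dx).
Qed.

(** The polynomial y^N s(1/y); N may exceed the degree, since s and t must be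
reversed with the same N. *)
Definition revp N (s : {poly {poly C}}) := \poly_(k < N.+1) s`_(N - k).

Lemma revpE N (s : {poly {poly C}}) (x u : C) : (size s <= N.+1)%N -> u != 0 -> (revp N s).[u, x] = u ^+ N * s.[u^-1, x].
Proof.
move=> hs u0; rewrite (horner_coef_wide _ hs).
rewrite /revp horner_poly (reindex_inj rev_ord_inj) /=.
rewrite !horner_sum mulr_sumr; apply: eq_bigr => -[i hi] _ /=.
rewrite subSS subKn // !hornerM -!polyC_exp !hornerC mulrCA; congr (_ * _).
by rewrite exprVn expfB_cond ?(negPf u0).
Qed.

(** Under y = 1 / u the equation q y' = p becomes q(x, 1/u) u' = - u^2 p(x,
1/u). Both sides are multiplied by u^N and divided by the common power u^j. *)
Definition at_infinity (p q p' q' : {poly {poly C}}) := exists (N j : nat), forall x u, u != 0 ->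
  ev q' x u * u ^+ j = u ^+ N * ev q x u^-1 /\
  ev p' x u * u ^+ j = - u ^+ 2 * (u ^+ N * ev p x u^-1).

(** Let rs, rt be the reversed polynomials, so that the equation is rt u' = -
u^2 rs. If u^2 divides rt, division leaves - rs, which does not vanish
identically at u = 0. Otherwise a factor u is left on the right: u = 0 is itself
a solution, through regular points. *)
Lemma infinity_form (s t : {poly {poly C}}) : t != 0 ->
  exists (p' q' : {poly {poly C}}) (b : {poly C}), [/\ b != 0,
    at_infinity (swapXY s) (swapXY t) p' q' &
   (forall x, b.[x] != 0 -> ev p' x 0 != 0) \/
   ((forall x, ev p' x 0 = 0) /\ (forall x, b.[x] != 0 -> ev q' x 0 != 0))].
Proof.
move=> t0; pose N := (maxn (size s) (size t)).-1.
have NE : N.+1 = maxn (size s) (size t).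
  by rewrite prednK // leq_max orbC lt0n size_poly_eq0 t0.
have sN : (size s <= N.+1)%N by rewrite NE leq_maxl.
have tN : (size t <= N.+1)%N by rewrite NE leq_maxr.
pose rs := revp N s; pose rt := revp N t.
have [rt0|rt0] := eqVneq (rt.[0]) 0; last first.
  exists (swapXY (- 'X ^+ 2 * rs)), (swapXY rt), rt.[0]; split => //.
    exists N, 0%N => x u u0; rewrite !ev_swap expr0 !mulr1 horner2M !revpE //; split=> //.
    by rewrite hornerN hornerXn hornerN -polyC_exp hornerC.
  right; split=> x; rewrite ev_swap.
    by rewrite horner2M hornerN hornerXn -polyC_exp expr0n /= hornerN hornerC oppr0 mul0r.
  by [].
have /factor_theorem[rt1] : root rt 0 by apply/eqP.
rewrite subr0 => rtE.
have [rt10|rt10] := eqVneq (rt1.[0]) 0; last first.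
  exists (swapXY (- 'X * rs)), (swapXY rt1), rt1.[0]; split => //.
    exists N, 1%N => x u u0; rewrite !ev_swap expr1 horner2M !revpE //; split.
      have := @revpE N t x u tN u0; rewrite -/rt rtE horner2M hornerX hornerC => <-.
      by [].
    rewrite hornerN hornerX hornerN hornerC.
    by move: s.[u^-1, x] (u ^+ N) => e w; rewrite expr2; ring.
  right; split=> x; rewrite ev_swap.
    by rewrite horner2M hornerN hornerX hornerN hornerC oppr0 mul0r.
  by [].
have /factor_theorem[rt2] : root rt1 0 by apply/eqP.
rewrite subr0 => rt1E.
exists (swapXY (- rs)), (swapXY rt2), rs.[0]; split.
- rewrite horner_coef0 coef_poly /= subn0.
  have tNc : t`_N = 0.
    by have := rt0; rewrite horner_coef0 coef_poly /= subn0.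
  have sz : size s = N.+1.
    apply/eqP; rewrite eqn_leq sN NE /= geq_max leqnn /= leqNgt; apply/negP => h.
    have h2 : size t = N.+1 by rewrite NE; apply/esym/maxn_idPr/ltnW.
    have : lead_coef t = 0 by rewrite /lead_coef h2.
    by move/eqP; rewrite lead_coef_eq0 (negPf t0).
  have -> : s`_N = lead_coef s by rewrite /lead_coef sz.
  by rewrite lead_coef_eq0 -size_poly_eq0 sz.
- exists N, 2%N => x u u0; rewrite !ev_swap -!revpE // -/rt rtE rt1E !horner2M hornerX hornerC.
  by rewrite !hornerN; split; rewrite ?expr2; ring.
left=> x bx; rewrite ev_swap !hornerN oppr_eq0.
by [].
Qed.

Section Inversion.
Variables (p q p' q' : {poly {poly C}}).
Hypothesis hinf : at_infinity p q p' q'.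

Lemma ode_inv f z : f z != 0 -> ode p q f z -> ode p' q' (fun w => (f w)^-1) z.
Proof.
move=> f0 [d [df e]]; exists (- (d / (f z * f z))); split; first exact: drvV.
have [N [j h]] := hinf; have u0 : (f z)^-1 != 0 by rewrite invr_eq0.
have [h1 h2] := h z _ u0; rewrite !invrK in h1 h2.
apply: (mulIf (expf_neq0 j u0)); rewrite h2 -e mulrAC h1.
have -> : (f z)^-1 ^+ 2 = (f z)^-1 * (f z)^-1 by rewrite expr2.
by rewrite invfM; ring.
Qed.

Lemma inv_ode U z : U z != 0 -> ode p' q' U z -> ode p q (fun w => (U w)^-1) z.
Proof.
move=> U0 [d [dU e]]; exists (- (d / (U z * U z))); split; first exact: drvV.
have [N [j h]] := hinf; have [h1 h2] := h z _ U0.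
have n0 : - U z ^+ 2 * U z ^+ N != 0 by rewrite mulf_neq0 ?oppr_eq0 ?expf_neq0.
apply: (mulfI n0); rewrite -[RHS]mulrA -h2 -e.
have -> : - U z ^+ 2 * U z ^+ N * (ev q z (U z)^-1 * - (d / (U z * U z))) =
  (U z ^+ N * ev q z (U z)^-1) * (d * (U z ^+ 2 / (U z * U z))) by ring.
by rewrite -expr2 divff ?expf_neq0 // mulr1 -h1; ring.
Qed.

Lemma inf_nonzero x : (exists y, ev q x y != 0) -> exists y, ev q' x y != 0.
Proof.
move=> [y0 hy]; apply: contrapT => hn; have {}hn u : ev q' x u = 0.
  by apply/eqP; apply: contrapT => /negP h; apply: hn; exists u.
have qx0 : q.[x%:P] * 'X != 0.
  rewrite mulf_neq0 ?polyX_eq0 //; apply/eqP => h.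
  by move: hy; rewrite /ev h horner0 eqxx.
have [y] := nonroot qx0; rewrite hornerM hornerX mulf_eq0 negb_or => /andP[qy y1].
have u0 : y^-1 != 0 by rewrite invr_eq0.
have [N [j h]] := hinf; have [h1 _] := h x _ u0.
move: h1; rewrite hn mul0r invrK => /esym/eqP.
by rewrite mulf_eq0 expf_eq0 (negPf u0) andbF /= (negPf qy).
Qed.

End Inversion.

(** The reduced equation holds where a(x) <> 0; both sides being holomorphic, it
holds on the whole disc. *)
Lemma reduce_solution (P Q p q g : {poly {poly C}}) (a : {poly C}) x0 y0 f : a != 0 ->
  (forall x y, a.[x] * ev P x y = ev p x y * ev g x y) ->
  (forall x y, a.[x] * ev Q x y = ev q x y * ev g x y) ->
  Q.[x0, y0] != 0 -> local_solution P Q x0 y0 f ->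
  exists2 e : R, 0 < e & forall z, nm (z - x0) < e -> ode p q f z.
Proof.
move=> a0 eP eQ Q0 [f0 /nearC[e e0 df]].
have {}df z : nm (z - x0) < e -> drv id f z (ev P z (f z) / ev Q z (f z)).
  by move=> /df /cdP.
have x00 : nm (x0 - x0) < e by rewrite subrr nm0.
have [d hd] := ev_drv Q (drv_id id x0) (df _ x00).
have q0 : 0 < nm (ev Q x0 (f x0)) by rewrite nm_gt0 f0.
have [e1 e10 h1] := drv_cont hd q0.
pose r := Num.min e e1; have r0 : 0 < r by rewrite lt_min e0.
have re z : nm (z - x0) < r -> nm (z - x0) < e by rewrite lt_min => /andP[].
have Qz z : nm (z - x0) < r -> ev Q z (f z) != 0.
  rewrite lt_min => /andP[_ /h1]; apply: contraTneq => ->.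
  by rewrite sub0r nmN ltxx.
pose W z := ev q z (f z) * (ev P z (f z) / ev Q z (f z)) - ev p z (f z).
have dW : hol_ball W x0 r.
  move=> z hz; have dz := df z (re z hz).
  have [d1 k1] := ev_drv q (drv_id id z) dz; have [d2 k2] := ev_drv P (drv_id id z) dz.
  have [d3 k3] := ev_drv Q (drv_id id z) dz; have [d4 k4] := ev_drv p (drv_id id z) dz.
  by eexists; apply: drvB (drvM k1 (drvM k2 (drvV _ k3))) k4; exact: Qz.
have aW z : nm (z - x0) < r -> a.[z] != 0 -> W z = 0.
  move=> hz az; have Qn := Qz z hz.
  have hg : ev g z (f z) != 0.
    have : a.[z] * ev Q z (f z) != 0 by rewrite mulf_neq0.
    by rewrite eQ mulf_eq0 negb_or => /andP[].
  apply: (mulIf hg); rewrite mul0r /W mulrBl -eP mulrAC -eQ.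
  have -> : a.[z] * ev Q z (f z) * (ev P z (f z) / ev Q z (f z)) = a.[z] * ev P z (f z) * (ev Q z (f z) / ev Q z (f z)) by ring.
  by rewrite divff // mulr1 subrr.
exists r => // z hz; exists (ev P z (f z) / ev Q z (f z)); split; first exact/df/re.
apply/eqP; rewrite -subr_eq0; apply/eqP; rewrite -/(W z).
have [w hw aw] := nonroot_ball x0 a0 r0.
apply: (@identity_ball R W x0 r w) => //.
have [d' hd'] := poly_drv a (drv_id id w); have aw0 : 0 < nm a.[w] by rewrite nm_gt0.
have [e2 e20 h2] := drv_cont hd' aw0.
exists (Num.min e2 (r - nm (w - x0))); first by rewrite lt_min e20 subr_gt0.
move=> v; rewrite lt_min => /andP[v1 v2]; apply: aW.
  by have := nm_tri v w x0; lra.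
apply: contraTneq (h2 v v1) => ->; by rewrite sub0r nmN ltxx.
Qed.

Lemma ev_nonzero_lead (t : {poly {poly C}}) x : (lead_coef t).[x] != 0 -> exists y, ev (swapXY t) x y != 0.
Proof.
move=> h; have h0 : (swapXY t).[x%:P] != 0.
  apply/eqP => e; move: h; have := congr1 (fun p : {poly C} => p`_(size t).-1) e.
  rewrite horner_swapXY coef_map coef0 /= => E.
  by rewrite /lead_coef /horner_eval in E *; rewrite E eqxx.
by have [y hy] := nonroot h0; exists y.
Qed.

(** S collects the points over which the reduced coefficients have a common zero
or q vanishes identically, and those to be avoided at infinity. *)
Lemma normal_form (P Q : {poly {poly C}}) : Q != 0 ->
  exists (p q p' q' : {poly {poly C}}) (S : seq C),
  [/\ forall x0 y0 f, Q.[x0, y0] != 0 -> local_solution P Q x0 y0 f ->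
        exists2 e : R, 0 < e & forall z, nm (z - x0) < e -> ode p q f z,
      forall x y, x \notin S -> ev p x y = 0 -> ev q x y = 0 -> False,
      forall x, x \notin S -> exists y, ev q x y != 0,
      at_infinity p q p' q' &
      (forall x, x \notin S -> ev p' x 0 != 0) \/
      ((forall x, ev p' x 0 = 0) /\ (forall x, x \notin S -> ev q' x 0 != 0))].
Proof.
move=> Q0; have t0 : swapXY Q != 0 by rewrite swapXY_eq0.
have [a [d [g [s' [t' [a0 d0 t'0 [es et] cop]]]]]] := coprime_form (swapXY P) t0.
have [p' [q' [b [b0 hinf hb]]]] := infinity_form s' t'0.
have lt0 : lead_coef t' != 0 by rewrite lead_coef_eq0.
have [r1 h1] := roots_seq d0; have [r2 h2] := roots_seq b0; have [r3 h3] := roots_seq lt0.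
exists (swapXY s'), (swapXY t'), p', q', (r1 ++ r2 ++ r3).
have nS x : x \notin r1 ++ r2 ++ r3 -> [/\ d.[x] != 0, b.[x] != 0 & (lead_coef t').[x] != 0].
  rewrite !mem_cat !negb_or => /and3P[n1 n2 n3].
  by split; apply/eqP => h; [move: (h1 _ h)|move: (h2 _ h)|move: (h3 _ h)]; apply/negP.
split => //.
- move=> x0 y0 f; apply: (@reduce_solution P Q _ _ (swapXY g) a) => //.
    move=> x y; rewrite !ev_swap -horner2M -es horner2_scale.
    by rewrite -ev_swap swapXYK.
  move=> x y; rewrite !ev_swap -horner2M -et horner2_scale.
  by rewrite -ev_swap swapXYK.
- by move=> x y /nS[dx _ _]; rewrite !ev_swap; exact: cop.
- by move=> x /nS[_ _ lx]; exact: ev_nonzero_lead.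
case: hb => [hb|[hb1 hb2]]; [left|right; split => //].
  by move=> x /nS[_ bx _]; exact: hb.
by move=> x /nS[_ bx _]; exact: hb2.
Qed.

End Algebra.

(** * Uniqueness of solutions, integral curves *)

Section OdeUniqueness.
Variable R : realType.
Local Notation C := (Cplx R).
Local Notation rc := (@rc R).
Local Notation nm := (@nm R).
Local Notation ev := (@ev R).
Implicit Types (p q : {poly {poly C}}).

Definition odeg p q (f : C -> C) (z : C) := exists2 e : R, 0 < e & forall w, nm (w - z) < e -> ode p q f w.

Lemma ode_geq p q f h z : sgerm z f h -> ode p q f z -> ode p q h z.
Proof.
move=> g [d [df e]]; exists d; split; first exact: sgerm_drv g df.
by rewrite -(sgerm_at g).
Qed.

Lemma odeg_geq p q f h z : sgerm z f h -> odeg p q f z -> odeg p q h z.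
Proof.
move=> /sgerm_open[e e0 he] [e' e'0 h']; exists (Num.min e e'); first by rewrite lt_min e0.
by move=> w; rewrite lt_min => /andP[/he g /h']; exact: ode_geq.
Qed.

Lemma near_bounds (F : C -> C) z d : drv id F z d -> F z != 0 ->
  exists2 e : R, 0 < e & forall w, nm (w - z) < e -> nm (F z) / 2 < nm (F w).
Proof.
move=> dF F0; have h : 0 < nm (F z) / 2 by rewrite divr_gt0 // nm_gt0.
have [e e0 he] := drv_cont dF h; exists e => // w /he h1.
by have := nm_sub (F z) (F w); rewrite nmB; lra.
Qed.

Lemma near_bounded (F : C -> C) z d : drv id F z d ->
  exists2 e : R, 0 < e & forall w, nm (w - z) < e -> nm (F w) <= nm (F z) + 1.
Proof.
move=> dF; have [e e0 he] := drv_cont dF ltr01; exists e => // w /he h1.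
by have := nm_sub (F w) (F z); lra.
Qed.

(** The difference of two solutions satisfies a linear differential inequality,
as q does not vanish at the initial point. *)
Lemma ode_unique p q f h z0 : odeg p q f z0 -> odeg p q h z0 -> f z0 = h z0 ->
  ev q z0 (f z0) != 0 -> sgerm z0 f h.
Proof.
move=> [e1 e10 of_] [e2 e20 oh] fh q0.
have [df [hdf _]] := of_ z0 ltac:(by rewrite subrr nm0).
have [dh [hdh _]] := oh z0 ltac:(by rewrite subrr nm0).
have [dq1 hq1] := ev_drv q (drv_id id z0) hdf; have [dq2 hq2] := ev_drv q (drv_id id z0) hdh.
have q0' : ev q z0 (h z0) != 0 by rewrite -fh.
have [r1 r10 b1] := near_bounds hq1 q0; have [r2 r20 b2] := near_bounds hq2 q0'.
have [r3 r30 b3] := near_bounded hdf; have [r4 r40 b4] := near_bounded hdh.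
pose B := nm z0 + nm (f z0) + 1.
have B0 : 0 <= B by rewrite !addr_ge0 ?nm_ge0.
have [L [L0 QL]] := lipb_ev q B0; have [K [K0 PK]] := lipb_ev p B0.
set c := nm (ev q z0 (f z0)) / 2 in b1 *; rewrite -fh -/c in b2.
have c0 : 0 < c by rewrite divr_gt0 // nm_gt0.
pose r := Num.min (Num.min e1 e2) (Num.min (Num.min r1 r2) (Num.min (Num.min r3 r4) 1)).
have r0 : 0 < r by rewrite !lt_min e10 e20 r10 r20 r30 r40 /=.
have /choice[w' w'P] : forall z, exists d, nm (z - z0) < r ->
   drv id (fun z => f z - h z) z d /\ nm d <= ((K + K / c * L) / c) * nm (f z - h z).
  move=> z; have [hz|] := boolP (nm (z - z0) < r); last by exists 0.
  have := hz; rewrite !lt_min => /andP[/andP[/of_[d [hd ed]] /oh[d' [hd' ed']]]].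
  move=> /andP[/andP[/b1 n1 /b2 n2] /andP[/andP[/b3 n3 /b4 n4] n5]].
  exists (d - d') => _; split; first exact: drvB.
  have Bz : nm z <= B by have := nm_sub z z0; have := nm_ge0 (f z0); rewrite /B; lra.
  have Bf : nm (f z) <= B by have := nm_ge0 z0; rewrite /B; lra.
  have Bh : nm (h z) <= B by have := nm_ge0 z0; rewrite -fh in n4; rewrite /B; lra.
  have [p1 _] := PK _ _ _ _ Bz Bf Bz Bh; have [_ p2] := PK _ _ _ _ Bz Bh Bz Bf.
  have [q1 _] := QL _ _ _ _ Bz Bf Bz Bh.
  rewrite subrr nm0 add0r in p1 q1.
  have d'K : nm d' <= K / c.
    rewrite ler_pdivlMr // -ed' nmM in p2 *; apply: le_trans p2; rewrite mulrC.
    by rewrite ler_wpM2r ?nm_ge0 // ltW.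
  have E : ev q z (f z) * (d - d') = (ev p z (f z) - ev p z (h z)) - d' * (ev q z (f z) - ev q z (h z)).
    by rewrite -ed -ed'; ring.
  have h1 : nm (ev q z (f z) * (d - d')) <= (K + K / c * L) * nm (f z - h z).
    rewrite E; apply: (le_trans (nmD _ _)); rewrite nmN nmM [X in _ <= X]mulrDl; apply: lerD => //.
    by rewrite -mulrA; apply: ler_pM; rewrite ?nm_ge0.
  rewrite mulrAC ler_pdivlMr //; apply: le_trans h1; rewrite nmM mulrC.
  by rewrite ler_wpM2r ?nm_ge0 // ltW.
have [|||e e0 he] := @gronwall R (fun z => f z - h z) w' z0 r ((K + K / c * L) / c) r0.
- by move=> z /w'P[].
- by move=> z /w'P[].
- by rewrite fh subrr.
by exists e => // w /he /eqP; rewrite subr_eq0 => /eqP.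
Qed.

Lemma ev_swapXY s u x : ev (swapXY s) u x = ev s x u.
Proof. exact: horner2_swapXY. Qed.

(** Both X(u(z)) and z satisfy dx/du = q / p along u(z), with the same initial
value; the difference is zero by a linear differential inequality. *)
Lemma inverse_branch p q u X z0 : odeg p q u z0 -> odeg (swapXY q) (swapXY p) X (u z0) -> X (u z0) = z0 ->
  ev p z0 (u z0) != 0 -> ev q z0 (u z0) != 0 -> sgerm z0 (fun z => X (u z)) id.
Proof.
move=> [e1 e10 ou] [e2 e20 oX] Xz p0 q0.
have [du [hdu _]] := ou z0 ltac:(by rewrite subrr nm0).
have [dX [hdX _]] := oX (u z0) ltac:(by rewrite subrr nm0).
have [e3 e30 h3] := drv_cont hdu e20.
pose a z := X (u z).
have hda : drv id a z0 (dX * du) by exact: drv_comp hdu hdX.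
have [d1 hd1] := ev_drv p hda hdu; have [d2 hd2] := ev_drv q (drv_id id z0) hdu.
have a0 : a z0 = z0 by [].
have p0' : ev p (a z0) (u z0) != 0 by rewrite a0.
have [r1 r10 b1] := near_bounds hd1 p0'; have [r2 r20 b2] := near_bounds hd2 q0.
have [r3 r30 b3] := near_bounded hdu; have [r4 r40 b4] := near_bounded hda.
pose B := nm z0 + nm (u z0) + 1.
have B0 : 0 <= B by rewrite !addr_ge0 ?nm_ge0.
have [L [L0 QL]] := lipb_ev q B0; have [K [K0 PK]] := lipb_ev p B0.
set c1 := nm _ / 2 in b1; set c2 := nm _ / 2 in b2.
have c10 : 0 < c1 by rewrite divr_gt0 // nm_gt0.
have c20 : 0 < c2 by rewrite divr_gt0 // nm_gt0.
pose r := Num.min (Num.min e1 e3) (Num.min (Num.min r1 r2) (Num.min (Num.min r3 r4) 1)).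
have r0 : 0 < r by rewrite !lt_min e10 e30 r10 r20 r30 r40 /=.
have /choice[w' w'P] : forall z, exists d, nm (z - z0) < r ->
   drv id (fun z => a z - z) z d /\ nm d <= ((L * K + K * L) / (c1 * c2)) * nm (a z - z).
  move=> z; have [hz|] := boolP (nm (z - z0) < r); last by exists 0.
  have := hz; rewrite !lt_min => /andP[/andP[/ou[d [hd ed]] /h3 /oX[d' [hd' ed']]]].
  move=> /andP[/andP[/b1 n1 /b2 n2] /andP[/andP[/b3 n3 /b4 n4] n5]].
  exists (d' * d - 1) => _; split; first by apply: drvB (drv_id id z); exact: drv_comp hd hd'.
  have Bz : nm z <= B by have := nm_sub z z0; have := nm_ge0 (u z0); rewrite /B; lra.
  have Bu : nm (u z) <= B by have := nm_ge0 z0; rewrite /B; lra.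
  have Ba : nm (a z) <= B by have := nm_ge0 (u z0); rewrite a0 in n4; rewrite /B; lra.
  have [p1 _] := PK _ _ _ _ Ba Bu Bz Bu; have [_ p2] := PK _ _ _ _ Bz Bu Bz Bu.
  have [q1 _] := QL _ _ _ _ Ba Bu Bz Bu; have [_ q2] := QL _ _ _ _ Bz Bu Bz Bu.
  rewrite subrr nm0 addr0 in p1 q1; rewrite !ev_swapXY -/(a z) in ed'.
  have E : ev p (a z) (u z) * ev q z (u z) * (d' * d - 1) =
     (ev q (a z) (u z) - ev q z (u z)) * ev p z (u z) - (ev p (a z) (u z) - ev p z (u z)) * ev q z (u z).
    rewrite mulrBr mulr1.
    have -> : ev p (a z) (u z) * ev q z (u z) * (d' * d) = (ev p (a z) (u z) * d') * (ev q z (u z) * d) by ring.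
    by rewrite ed ed'; ring.
  have h1 : nm (ev p (a z) (u z) * ev q z (u z) * (d' * d - 1)) <= (L * K + K * L) * nm (a z - z).
    rewrite E; apply: (le_trans (nmD _ _)); rewrite nmN !nmM [X in _ <= X]mulrDl.
    by apply: lerD; rewrite [X in _ <= X]mulrAC; apply: ler_pM; rewrite ?nm_ge0.
  rewrite mulrAC ler_pdivlMr ?(mulr_gt0 c10 c20) //; apply: le_trans h1; rewrite [X in _ <= X]nmM mulrC.
  rewrite ler_wpM2r ?nm_ge0 // nmM; apply: ler_pM; rewrite ?ltW //.
have [|||e e0 he] := @gronwall R (fun z => a z - z) w' z0 r ((L * K + K * L) / (c1 * c2)) r0.
- by move=> z /w'P[].
- by move=> z /w'P[].
- by rewrite a0 subrr.
by exists e => // w /he /eqP; rewrite subr_eq0 => /eqP.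
Qed.

(** Conversely, a right inverse of the integral curve is a solution, by the
chain rule. *)
Lemma branch_ode p q u X z du : drv id u z du -> ode (swapXY q) (swapXY p) X (u z) ->
  sgerm z (fun z => X (u z)) id -> ode p q u z.
Proof.
move=> hdu [d [hd ed]] hg; have Xz : X (u z) = z := sgerm_at hg.
have e1 : d * du = 1 := drv_uniq (sgerm_drv hg (drv_comp hdu hd)) (drv_id id z).
exists du; split => //; rewrite !ev_swapXY Xz in ed.
by rewrite -ed -mulrA e1 mulr1.
Qed.

End OdeUniqueness.

(** * Compactness of closed discs *)

Section Compactness.
Variable R : realType.
Local Notation C := (Cplx R).
Local Notation rc := (@rc R).
Local Notation nm := (@nm R).

Variable bo : (C -> Prop) -> Prop.
Hypothesis boS : forall A B : C -> Prop, (forall z, A z -> B z) -> bo B -> bo A.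
Hypothesis boU : forall A B : C -> Prop, bo A -> bo B -> bo (fun z => A z \/ B z).
Hypothesis bo_loc : forall u, exists2 e : R, 0 < e & bo (fun z => nm (z - u) < e).

(** A class of sets that is closed under subsets and finite unions, and contains
a neighbourhood of every point, contains all bounded sets. Real induction gives
it for horizontal strips first, then for a square. *)
Lemma compact_ideal (M : R) : bo (fun z => nm z <= M).
Proof.
have [M0|M0] := ltP M 0.
  have [e _ h] := bo_loc 0; apply: boS h => z hz.
  by have := lt_le_trans M0 (nm_ge0 z); rewrite ltNge hz.
have MM : - M <= M by lra.
pose re (z : C) := complex.Re (z : R[i]); pose im (z : C) := complex.Im (z : R[i]).
have nmb z u : nm (z - u) <= `|re z - re u| + `|im z - im u|.
  by apply: (le_trans (nm_ReIm _)); rewrite /re /im; move: z u => [? ?] [? ?].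
have mid (a b c : R) (e : R) : `|a - c| < e -> `|b - c| < e -> forall t : R, a <= t <= b -> `|t - c| < e.
  rewrite !ltr_norml => /andP[h1 h2] /andP[h3 h4] t /andP[h5 h6]; rewrite ltr_norml; apply/andP; split; lra.
have strip y : exists2 e : R, 0 < e & bo (fun z => `|im z - y| < e /\ - M <= re z <= M).
  pose P t := exists2 e : R, 0 < e & bo (fun z => `|im z - y| < e /\ - M <= re z <= t).
  suff : P M by [].
  apply: (@real_ind R P (- M) M) => //.
    have [e e0 h] := bo_loc (Complex (- M) y : R[i]).
    exists e => //; apply: boS h => z [h1 h2]; apply: (le_lt_trans (nmb _ _)).
    have -> : re z = - M by apply/eqP; rewrite eq_le andbC.
    have -> : re (Complex (- M) y : R[i]) = - M by [].
    by rewrite subrr normr0 add0r.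
  move=> s _; have [e e0 h] := bo_loc (Complex s y : R[i]).
  have e2 : 0 < e / 2 by rewrite divr_gt0.
  exists (e / 2) => // s1 s2 _ s12 _ h1 h2 [e' e'0 h'].
  exists (Num.min e' (e / 2)); first by rewrite lt_min e'0.
  apply: boS (boU h' h) => z [hz /andP[z1 z2]]; move: hz; rewrite lt_min => /andP[n1 n2].
  have [zs|zs] := leP (re z) s1; first by left; rewrite z1.
  right; apply: (le_lt_trans (nmb _ _)); rewrite /re /im /= in zs z2 n2 *.
  have : `|complex.Re (z : R[i]) - s| < e / 2 by apply: (mid s1 s2) => //; rewrite z2 ltW.
  lra.
pose P t := bo (fun z => - M <= im z <= t /\ - M <= re z <= M).
have : P M.
  apply: (@real_ind R P (- M) M) => //.
    have [e e0 h] := strip (- M); apply: boS h => z [h1 h2]; split => //.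
    have -> : im z = - M by apply/eqP; rewrite eq_le andbC.
    by rewrite subrr normr0.
  move=> s _; have [e e0 h] := strip s; exists e => // s1 s2 _ s12 _ h1 h2 P1.
  apply: boS (boU P1 h) => z [/andP[z1 z2] z3].
  have [zs|zs] := leP (im z) s1; first by left; rewrite z1.
  by right; split => //; apply: (mid s1 s2) => //; rewrite z2 ltW.
apply: boS => z hz; split.
  by rewrite -ler_norml (le_trans (Im_nm _)).
by rewrite -ler_norml (le_trans (Re_nm _)).
Qed.

End Compactness.

Section Uniformity.
Variable R : realType.
Local Notation C := (Cplx R).
Local Notation nm := (@nm R).

(** Compactness in the form in which it is used: a condition that holds with
locally uniform constants holds with a uniform constant on discs. *)
Lemma compact_uniform (A : R -> C -> Prop) (M : R) :
  (forall r r' u, 0 < r' -> r' <= r -> A r u -> A r' u) ->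
  (forall u, exists2 e : R, 0 < e & exists2 r : R, 0 < r & forall u', nm (u' - u) < e -> A r u') ->
  exists2 r : R, 0 < r & forall u, nm u <= M -> A r u.
Proof.
move=> Aanti Aloc; apply: (@compact_ideal R (fun B => exists2 r : R, 0 < r & forall u, B u -> A r u)).
- by move=> B B' BB [r r0 h]; exists r => // u /BB /h.
- move=> B B' [r r0 h] [r' r'0 h']; exists (Num.min r r'); first by rewrite lt_min r0.
  move=> u [/h|/h']; apply: Aanti; rewrite ?lt_min ?r0 //; first by rewrite ge_min lexx.
  by rewrite ge_min lexx orbT.
move=> u; have [e e0 [r r0 h]] := Aloc u; exists e => //.
by exists r.
Qed.

End Uniformity.

(** * The solution has a limit at the end of the path *)

Section Eventually.
Variable R : realType.

Definition evt (P : R -> Prop) := exists2 T : R, 0 <= T < 1 & forall s, T < s < 1 -> P s.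

Lemma evt_and P Q : evt P -> evt Q -> evt (fun s => P s /\ Q s).
Proof.
move=> [T /andP[T0 T1] h] [T' /andP[T'0 T'1] h']; exists (Num.max T T').
  by rewrite le_max T0 gt_max T1.
by move=> s; rewrite gt_max => /andP[/andP[h1 h2] h3]; split; [apply: h|apply: h']; apply/andP.
Qed.

Lemma evt_mono (P Q : R -> Prop) : (forall s, 0 <= s < 1 -> P s -> Q s) -> evt P -> evt Q.
Proof.
move=> PQ [T /andP[T0 T1] h]; exists T; first by rewrite T0.
move=> s /[dup] hs /andP[s1 s2]; apply: PQ (h s hs).
by rewrite s2 (le_trans T0) // ltW.
Qed.

Lemma evt_false : evt (fun=> False) -> False.
Proof. by move=> [T /andP[T0 T1] h]; apply: (h ((T + 1) / 2)); apply/andP; split; lra. Qed.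

Lemma evt_near (P : R -> Prop) : evt P <-> \forall t \near 1^'-, P t.
Proof. exact: iff_sym (near1m P). Qed.

End Eventually.

Section Persistence.
Variable R : realType.
Local Notation C := (Cplx R).
Local Notation nm := (@nm R).
Local Notation ev := (@ev R).

(** By the identity theorem for q(z, F) F' - p(z, F), which is holomorphic
because F' is. *)
Lemma ode_ball (p q : {poly {poly C}}) F a r z0 : hol_ball F a r -> nm (z0 - a) < r -> odeg p q F z0 ->
  forall z, nm (z - a) < r -> ode p q F z.
Proof.
move=> dF h0 [e e0 o0].
have [F' dF' ddF'] := drv_hol dF.
pose W z := ev q z (F z) * F' z - ev p z (F z).
have dW : hol_ball W a r.
  move=> z hz; have [d hd] := ddF' z hz; have dz := dF' z hz.
  have [d1 k1] := ev_drv q (drv_id id z) dz; have [d2 k2] := ev_drv p (drv_id id z) dz.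
  by eexists; exact: drvB (drvM k1 hd) k2.
move=> z hz; exists (F' z); split; first exact: dF'.
apply/eqP; rewrite -subr_eq0; apply/eqP; rewrite -/(W z).
apply: (@identity_ball R W a r z0) => //.
exists (Num.min e (r - nm (z0 - a))); first by rewrite lt_min e0 subr_gt0.
move=> w; rewrite lt_min => /andP[/o0[d [hd ed]] hw].
have wr : nm (w - a) < r by have := nm_tri w z0 a; lra.
by rewrite /W (drv_uniq (dF' w wr) hd) ed subrr.
Qed.

Lemma ode_odeg (p q : {poly {poly C}}) F a r z : (forall w, nm (w - a) < r -> ode p q F w) ->
  nm (z - a) < r -> odeg p q F z.
Proof.
move=> h hz; exists (r - nm (z - a)); first by rewrite subr_gt0.
by move=> w hw; apply: h; have := nm_tri w z a; lra.
Qed.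

Lemma ode_persist (p q : {poly {poly C}}) gamma T G : germ_fam gamma 0 T G -> odeg p q (G 0) (gamma 0) ->
  forall s, 0 <= s <= T -> odeg p q (G s) (gamma s).
Proof.
move=> fG o0; apply: (@fam_ind R gamma 0 T G (fun s f => odeg p q f (gamma s)) fG) => //.
  by move=> s f g; exact: odeg_geq.
move=> s F e hs e0 dF _ [eta eta0 he]; exists eta => // s1 s2 s10 s12 s2T h1 h2 o1.
have n1 : nm (gamma s1 - gamma s) < e by apply: he; rewrite // s10 (le_trans s12).
have n2 : nm (gamma s2 - gamma s) < e by apply: he; rewrite // (le_trans s10).
exact: ode_odeg (ode_ball dF n1 o1) n2.
Qed.

End Persistence.

Section Limit.
Variable R : realType.
Local Notation C := (Cplx R).
Local Notation rc := (@rc R).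
Local Notation nm := (@nm R).
Local Notation ev := (@ev R).
Variables (p q p' q' : {poly {poly C}}) (S : seq C).
Hypothesis cop : forall x y, x \notin S -> ev p x y = 0 -> ev q x y = 0 -> False.
Hypothesis qnz : forall x, x \notin S -> exists y, ev q x y != 0.
Hypothesis hinf : at_infinity p q p' q'.
Hypothesis hcase : (forall x, x \notin S -> ev p' x 0 != 0) \/
      ((forall x, ev p' x 0 = 0) /\ (forall x, x \notin S -> ev q' x 0 != 0)).
Variables (f : C -> C) (gamma : R -> C) (g : R -> C -> C).
Hypothesis pg : path_cont gamma.
Hypothesis fg : forall T, T < 1 -> germ_fam gamma 0 T g.
Hypothesis g0f : sgerm (gamma 0) f (g 0).
Hypothesis og : forall s, 0 <= s < 1 -> odeg p q (g s) (gamma s).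
Hypothesis nc : ~ continuable gamma 1 f.
Local Notation x1 := (gamma 1).
Hypothesis x1S : x1 \notin S.

Local Notation y := (fun s => g s (gamma s)).

Lemma gamma_lim (e : R) : 0 < e -> exists2 T, 0 <= T < 1 & forall s, T < s <= 1 -> nm (gamma s - x1) < e.
Proof.
move=> e0; have h1 : 0 <= (1 : R) <= 1 by rewrite ler01 lexx.
have [eta eta0 h] := pg h1 e0; exists (Num.max 0 (1 - eta)).
  by rewrite le_max lexx gt_max ltr01 gtrBl.
move=> s /andP[]; rewrite gt_max => /andP[s0 s1] s2; apply: h; first by rewrite s2 ltW.
by rewrite ltr_norml; apply/andP; split; lra.
Qed.

Lemma gamma_evt (e : R) : 0 < e -> evt (fun s => nm (gamma s - x1) < e).
Proof.
move=> /gamma_lim[T hT h]; exists T => // s /andP[s1 s2]; apply: h.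
by rewrite s1 ltW.
Qed.

Lemma away_S : exists2 r : R, 0 < r & forall z, nm (z - x1) < r -> z \notin S.
Proof.
elim: S x1S => [|a s IH]; first by exists 1.
rewrite in_cons negb_or => /andP[xa /IH[r r0 h]].
have ha : 0 < nm (x1 - a) by rewrite nm_gt0 subr_eq0.
exists (Num.min r (nm (x1 - a))); first by rewrite lt_min r0.
move=> z; rewrite lt_min in_cons negb_or => /andP[/h -> h2]; rewrite andbT.
by apply: contraTneq h2 => ->; rewrite nmB ltxx.
Qed.

Lemma evt_S : evt (fun s => gamma s \notin S).
Proof.
have [r r0 h] := away_S; apply: evt_mono (gamma_evt r0) => s _; exact: h.
Qed.

(** Where q vanishes along the solution, so does p; there are no such points
near x1. *)
Lemma evt_q : evt (fun s => ev q (gamma s) (y s) != 0).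
Proof.
apply: evt_mono evt_S => s hs nS; apply/eqP => q0.
have [e e0 o] := og hs; have [|d [_ ed]] := o (gamma s); first by rewrite subrr nm0.
by apply: (cop nS _ q0); rewrite -ed q0 mul0r.
Qed.

Lemma y_cont s (e : R) : 0 <= s < 1 -> 0 < e -> exists2 eta : R, 0 < eta &
  forall s', 0 <= s' < 1 -> `|s' - s| < eta -> nm (y s' - y s) < e.
Proof.
move=> /andP[s0 s1] e0; have [T sT T1] := between s1.
have hs : 0 <= s <= T by rewrite s0 ltW.
have [F [r [eta [r0 eta0 dF hF]]]] := fg T1 hs.
have [|d hd] := dF (gamma s); first by rewrite subrr nm0.
have [r' r'0 hr'] := drv_cont hd e0.
have s01 : 0 <= s <= 1 by rewrite s0 ltW.
have [eta' eta'0 he'] := pg s01 r'0.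
exists (Num.min (T - s) (Num.min eta eta')); first by rewrite !lt_min subr_gt0 sT eta0.
move=> s' /andP[s'0 s'1]; rewrite !lt_min => /and3P[h1 h2 h3].
have s'T : 0 <= s' <= T by rewrite s'0; move: h1; rewrite ltr_norml => /andP[_]; lra.
have [_ g1] := hF s' s'T h2; have [|_ g2] := hF s hs; first by rewrite subrr normr0.
rewrite (sgerm_at g1) (sgerm_at g2); apply: hr'; apply: he' => //.
by rewrite s'0 ltW.
Qed.

(** A holomorphic function around x1 that has the germ of the solution at some s
< 1 would continue it up to the end of the path. *)
Lemma no_ext s F (r : R) : 0 <= s < 1 -> hol_ball F x1 r -> (forall t, s <= t <= 1 -> nm (gamma t - x1) < r) ->
  sgerm (gamma s) (g s) F -> False.
Proof.
move=> /andP[s0 s1] dF hr gF; apply: nc; exists F.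
have fs := fg s1.
apply: (cont_ext (cont_geql (fam_cont s0 fs) (sgerm_sym g0f)) (ltW s1) dF hr gF).
Qed.

(** A value of the solution close to ys would start one of the solutions on the
fixed disc around x1. *)
Lemma avoid_regular ys : ev q x1 ys != 0 -> exists2 eta : R, 0 < eta & evt (fun s => eta <= nm (y s - ys)).
Proof.
move=> q0; have [rho [eta [/andP[rho0 _] eta0 ex]]] := @ode_exists R p q x1 ys 1 ltr01 q0.
exists eta => //.
have [T /andP[T0 T1] hT] := gamma_lim rho0.
have : evt (fun s => T < s) by exists T; [rewrite T0|move=> s /andP[]].
move=> eT; apply: evt_mono (evt_and eT evt_q) => s hs [Ts qs].
rewrite leNgt; apply/negP => hy.
have [|H [Hs HP]] := ex (gamma s) (y s) _ hy; first by apply: hT; rewrite Ts; have /andP[_ /ltW] := hs.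
apply: (@no_ext s H rho hs).
- by move=> z /HP[_ _ [d [hd _]]]; exists d.
- by move=> t /andP[t1 t2]; apply: hT; rewrite t2 andbT (lt_le_trans Ts).
apply: ode_unique (og hs) _ _ qs => //.
apply: (@ode_odeg R p q H x1 rho) => [w /HP[] //|].
by apply: hT; rewrite Ts; have /andP[_ /ltW] := hs.
Qed.

(** Case where u = 0 solves the equation at infinity. A value of u close to 0
starts a solution on a disc around x1, which has no zero by uniqueness; its
inverse extends y. *)
Lemma avoid_infinity : (forall x, ev p' x 0 = 0) -> ev q' x1 0 != 0 ->
  exists2 M : R, 0 < M & evt (fun s => nm (y s) <= M).
Proof.
move=> p'0 q'0; have [rho [eta [/andP[rho0 _] eta0 ex]]] := @ode_exists R p' q' x1 0 1 ltr01 q'0.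
exists eta^-1; first by rewrite invr_gt0.
have [T /andP[T0 T1] hT] := gamma_lim rho0.
have : evt (fun s => T < s) by exists T; [rewrite T0|move=> s /andP[]].
move=> eT; apply: evt_mono (evt_and eT evt_q) => s hs [Ts qs].
rewrite leNgt; apply/negP => hy.
have y0 : 0 < nm (y s) by apply: lt_trans hy; rewrite invr_gt0.
have yn0 : y s != 0 by rewrite -nm_gt0.
have hu : nm ((y s)^-1 - 0) < eta by rewrite subr0 nmV -[eta]invrK ltf_pV2 ?posrE // invr_gt0.
have sr : nm (gamma s - x1) < rho by apply: hT; rewrite Ts; have /andP[_ /ltW] := hs.
have [H [Hs HP]] := ex (gamma s) (y s)^-1 sr hu.
have dH : hol_ball H x1 rho by move=> z /HP[_ _ [d [hd _]]]; exists d.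
have Hn0 z : nm (z - x1) < rho -> H z != 0.
  move=> hz; apply/eqP => Hz.
  have [_ qz _] := HP z hz; rewrite Hz in qz.
  have o1 : odeg p' q' H z by apply: (@ode_odeg R p' q' H x1 rho) => // w /HP[].
  have o2 : odeg p' q' (fun=> 0) z.
    exists 1 => // w _; exists 0; split; first exact: drv_cst.
    by rewrite mulr0 p'0.
  have [|e e0 he] := ode_unique o1 o2 Hz; first by rewrite Hz.
  have := @identity_ball R H x1 rho z (gamma s) dH hz sr.
  rewrite Hs => h; have /eqP := h (ex_intro2 _ _ e e0 he).
  by rewrite invr_eq0 (negPf yn0).
apply: (@no_ext s (fun z => (H z)^-1) rho hs).
- by move=> z hz; have [d hd] := dH z hz; eexists; apply: drvV (Hn0 z hz) hd.
- by move=> t /andP[t1 t2]; apply: hT; rewrite t2 andbT (lt_le_trans Ts).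
apply: ode_unique (og hs) _ _ qs; last by rewrite Hs invrK.
apply: (@ode_odeg R p q _ x1 rho) => // w hw.
by apply: (inv_ode hinf); [exact: Hn0|have [] := HP w hw].
Qed.

(** Intermediate value property of the distance to c. *)
Lemma no_crossing c (r : R) : evt (fun s => nm (y s - c) != r) ->
  evt (fun s => nm (y s - c) < r) \/ evt (fun s => r < nm (y s - c)).
Proof.
move=> [T /andP[T0 T1] h].
have [[t /andP[t1 t2] yt]|no] := pselect (exists2 t, T < t < 1 & nm (y t - c) < r); last first.
  right; exists T; first by rewrite T0.
  move=> s hs; rewrite lt_neqAle eq_sym h //= leNgt; apply/negP => hy; apply: no.
  by exists s.
left; exists t; first by rewrite t2 (le_trans T0) // ltW.
move=> s /andP[s1 s2].
apply: (@real_ind R (fun s => nm (y s - c) < r) t s (ltW s1) yt) => w /andP[tw ws].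
have Tw : T < w < 1 by rewrite (lt_le_trans t1) // (le_lt_trans ws).
have w01 : 0 <= w < 1 by rewrite (le_lt_trans ws) // andbT (le_trans T0) // ltW // (lt_le_trans t1).
have d0 : 0 < `|nm (y w - c) - r| by rewrite normr_gt0 subr_eq0 h.
have [eta eta0 he] := y_cont w01 d0.
exists eta => // a b ta ab bs ha hb ya.
have a01 : 0 <= a < 1.
  by rewrite (le_lt_trans (le_trans ab bs)) // andbT (le_trans T0) // ltW // (lt_le_trans t1).
have b01 : 0 <= b < 1.
  by rewrite (le_lt_trans bs) // andbT (le_trans T0) // ltW // (lt_le_trans t1) // (le_trans ta).
have na := he a a01 ha; have nb := he b b01 hb.
have na' := nm_tri (y w) (y a) c; have nb' := nm_tri (y b) (y w) c.
rewrite (nmB (y w) (y a)) in na'.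
move: d0 na nb na' nb'; case: (ltrgt0P (nm (y w - c) - r)) => hw d0 na nb na' nb'; lra.
Qed.

Lemma compact_avoid (K : C -> Prop) (M : R) : (forall u, K u -> nm u <= M) ->
  (forall u, exists2 e : R, 0 < e & evt (fun s => forall u', nm (u' - u) < e -> K u' -> y s != u')) ->
  evt (fun s => ~ K (y s)).
Proof.
move=> KM Kl.
have [|u|r r0 h] := @compact_uniform R (fun r u => K u -> forall s, 1 - r < s < 1 -> 0 <= s -> y s != u) M.
- move=> r r' u _ r'r h Ku s /andP[s1 s2]; apply: h => //; rewrite s2 andbT; lra.
- have [e e0 [T /andP[T0 T1] hT]] := Kl u; exists e => //; exists (1 - T); first lra.
  move=> u' hu' Ku' s /andP[s1 s2] _; apply: hT => //; rewrite s2 andbT; lra.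
exists (Num.max 0 (1 - r)); first by rewrite le_max lexx gt_max ltr01 gtrBl.
move=> s; rewrite gt_max => /andP[/andP[s1 s2] s3] Ky.
by have /eqP := h (y s) (KM _ Ky) Ky s ltac:(by rewrite s2) (ltW s1); apply.
Qed.

Lemma avoid_loc u : ev q x1 u != 0 ->
  exists2 e : R, 0 < e & evt (fun s => forall u', nm (u' - u) < e -> y s != u').
Proof.
move=> /avoid_regular[eta eta0 h]; exists eta => //; apply: evt_mono h => s _ hs u' hu'.
by apply: contraTneq hs => ->; rewrite -ltNge.
Qed.

Lemma circle_avoid c (r : R) : 0 <= r -> (forall u, nm (u - c) = r -> ev q x1 u != 0) ->
  evt (fun s => nm (y s - c) != r).
Proof.
move=> r0 hr.
suff : evt (fun s => ~ nm (y s - c) = r) by apply: evt_mono => s _ h; apply/eqP.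
apply: (@compact_avoid (fun u => nm (u - c) = r) (r + nm c)).
  by move=> u hu; have := nm_sub u c; lra.
move=> u; have [hu|hu] := eqVneq (nm (u - c)) r.
  have [e e0 h] := avoid_loc (hr u hu); exists e => //; apply: evt_mono h => s _ h u' h1 _; exact: h.
have d0 : 0 < `|nm (u - c) - r| by rewrite normr_gt0 subr_eq0.
exists `|nm (u - c) - r| => //; exists 0; first by rewrite lexx ltr01.
move=> s _ u' h1 h2; exfalso.
have t1 := nm_tri u' u c; have t2 := nm_tri u u' c; rewrite (nmB u u') in t2.
move: d0 h1; case: (ltrgt0P (nm (u - c) - r)) => hw d0 h1; lra.
Qed.

(** The coordinate of the sphere in use, y or 1 / y; both are involutive. *)
Definition chart (inf : bool) (w : C) : C := if inf then w^-1 else w.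
Definition chart_dom (inf : bool) (w : C) := inf -> w != 0.

(** If the values do not converge to a zero of q(x1, .), they stay away from
each zero, hence leave every compact set. *)
Lemma limit_exists : exists (inf : bool) (s1 : C), [/\ inf -> s1 = 0, ~~ inf -> ev q x1 s1 = 0,
   ev (if inf then p' else p) x1 s1 != 0 &
   forall e : R, 0 < e -> evt (fun s => chart_dom inf (y s) /\ nm (chart inf (y s) - s1) < e)].
Proof.
have [y0 hy0] := qnz x1S.
have qx0 : q.[x1%:P] != 0.
  by apply/eqP => h; move: hy0; rewrite /ev h horner0 eqxx.
have [rs hrs] := roots_seq qx0.
have {}hrs u : ev q x1 u = 0 -> u \in rs by exact: hrs.
have isol c (s : seq C) : exists2 r : R, 0 < r & forall u, u \in s -> u != c -> r <= nm (u - c).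
  elim: s => [|a s [r r0 h]]; first by exists 1.
  have [->|ac] := eqVneq a c.
    by exists r => // u; rewrite in_cons => /orP[/eqP ->|/h //]; rewrite eqxx.
  have ha : 0 < nm (a - c) by rewrite nm_gt0 subr_eq0.
  exists (Num.min r (nm (a - c))); first by rewrite lt_min r0.
  by move=> u; rewrite in_cons ge_min => /orP[/eqP -> _|/h hu /hu ->]; rewrite ?lexx ?orbT.
have [[c [cq hc]]|nofin] := pselect (exists c, ev q x1 c = 0 /\ forall e : R, 0 < e -> evt (fun s => nm (y s - c) < e)).
  exists false, c; split => //.
    by apply/eqP => pc0; exact: cop x1S pc0 cq.
  by move=> e /hc; apply: evt_mono => s _ h; split.
have away c : ev q x1 c = 0 -> exists2 r : R, 0 < r & evt (fun s => r < nm (y s - c)).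
  move=> cq; apply: contrapT => hn; apply: nofin; exists c; split => // e e0.
  have [r r0 hr] := isol c rs.
  (* a circle around c, inside the disc of radius e, that encloses no other zero *)
  pose m := Num.min e r / 2.
  have m0 : 0 < m by rewrite divr_gt0 // lt_min e0.
  have [me mr] : m < e /\ m < r.
    have : Num.min e r <= e by rewrite ge_min lexx.
    have : Num.min e r <= r by rewrite ge_min lexx orbT.
    by rewrite /m in m0 *; split; lra.
  have [|h|h] := no_crossing (c := c) (r := m).
  - apply: circle_avoid; first exact: ltW.
    move=> u hu; apply/eqP => /hrs hin; have := hr u hin; rewrite hu => h.
    have uc : u != c by rewrite -subr_eq0 -nm_gt0 hu.
    by have := h uc; lra.
  - by apply: evt_mono h => s _ h; apply: lt_trans me.
  by exfalso; apply: hn; exists m.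
have bounded_no (M : R) : evt (fun s => nm (y s) <= M) -> False.
  move=> hM; have : evt (fun s => ~ nm (y s) <= M).
    apply: (@compact_avoid (fun u => nm u <= M) M) => // u.
    have [qu|qu] := eqVneq (ev q x1 u) 0.
      have [r r0 h] := away u qu; exists r => //; apply: evt_mono h => s _ h u' h1 _.
      by apply: contraTneq h => ->; rewrite -leNgt ltW.
    have [e e0 h] := avoid_loc qu; exists e => //; apply: evt_mono h => s _ h u' h1 _; exact: h.
  by move=> hM'; apply: (@evt_false R); apply: evt_mono (evt_and hM hM') => s _ [].
have large (M : R) : evt (fun s => M < nm (y s)).
  pose M' := Num.max M (1 + \sum_(r <- rs) nm r).
  have sum0 (s : seq C) : 0 <= \sum_(r <- s) nm r by apply: sumr_ge0 => *; exact: nm_ge0.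
  have M'0 : 0 <= M' by rewrite le_max; apply/orP; right; rewrite addr_ge0.
  have rsM u : u \in rs -> nm u < M'.
    move=> hu; rewrite lt_max; apply/orP; right.
    suff : nm u <= \sum_(r <- rs) nm r by lra.
    elim: rs hu {hrs M' M'0 bounded_no away} => // a s IH.
    rewrite in_cons big_cons => /orP[/eqP ->|/IH h]; first by rewrite lerDl.
    by apply: (le_trans h); rewrite lerDr nm_ge0.
  have [|h|h] := no_crossing (c := 0) (r := M').
  - apply: circle_avoid => // u; rewrite subr0 => hu; apply/eqP => /hrs /rsM.
    by rewrite hu ltxx.
  - by exfalso; apply: (bounded_no M'); apply: evt_mono h => s _; rewrite subr0 => /ltW.
  by apply: evt_mono h => s _; rewrite subr0; apply: le_lt_trans; rewrite le_max lexx.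
exists true, 0; split => //.
  case: hcase => [h|[h1 h2]]; first exact: h.
  have [M _ hM] := avoid_infinity h1 (h2 _ x1S).
  by exfalso; exact: bounded_no hM.
move=> e e0; apply: evt_mono (large e^-1) => s _ h.
have y0' : 0 < nm (y s) by apply: lt_trans h; rewrite invr_gt0.
split; first by move=> _; rewrite -nm_gt0.
by rewrite subr0 /chart nmV -[e]invrK ltf_pV2 ?posrE // invr_gt0.
Qed.

End Limit.

(** * Inverse branches of an integral curve *)

Section Chart.
Variable R : realType.
Local Notation C := (Cplx R).
Local Notation nm := (@nm R).
Local Notation ev := (@ev R).

Lemma chartK inf : involutive (@chart R inf).
Proof. by case: inf => w //; rewrite /chart invrK. Qed.

Lemma chart_domV inf (w : C) : chart_dom inf w -> chart_dom inf (chart inf w).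
Proof. by case: inf => // h _; rewrite invr_eq0 h. Qed.

Lemma chart_drv inf (w : C) : chart_dom inf w -> exists d, drv id (chart inf) w d.
Proof.
case: inf => [h|_]; last by exists 1; exact: drv_id.
by exists (- (w^-1 * w^-1)); apply: drv_inv; exact: h.
Qed.

Lemma chart_dom_open inf (w : C) : chart_dom inf w ->
  exists2 e : R, 0 < e & forall z, nm (z - w) < e -> chart_dom inf z.
Proof.
case: inf => [h|_]; last by exists 1.
have w0 : 0 < nm w by rewrite nm_gt0 h.
exists (nm w) => // z hz _; apply: contraTneq hz => ->.
by rewrite sub0r nmN ltxx.
Qed.

Variables (p q p' q' : {poly {poly C}}) (inf : bool).
Hypothesis hinf : at_infinity p q p' q'.
Local Notation P1 := (if inf then p' else p).
Local Notation Q1 := (if inf then q' else q).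

Lemma chart_ode F z : chart_dom inf (F z) -> ode p q F z -> ode P1 Q1 (fun w => chart inf (F w)) z.
Proof. by case: inf => // h; apply: (ode_inv hinf); exact: h. Qed.

Lemma chart_odeg F z : chart_dom inf (F z) -> odeg p q F z -> odeg P1 Q1 (fun w => chart inf (F w)) z.
Proof.
move=> hd [e e0 o]; have [d [hdF _]] := o z ltac:(by rewrite subrr nm0).
have [e1 e10 h1] := chart_dom_open hd; have [e2 e20 h2] := drv_cont hdF e10.
exists (Num.min e e2); first by rewrite lt_min e0.
by move=> w; rewrite lt_min => /andP[/o ow /h2 /h1]; move/chart_ode; apply.
Qed.

End Chart.

Section Branch.
Variable R : realType.
Local Notation C := (Cplx R).
Local Notation rc := (@rc R).
Local Notation nm := (@nm R).
Local Notation ev := (@ev R).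
Variables (p q p' q' : {poly {poly C}}) (inf : bool).
Hypothesis hinf : at_infinity p q p' q'.
Local Notation P1 := (if inf then p' else p).
Local Notation Q1 := (if inf then q' else q).
Local Notation ch := (@chart R inf).
Variables (x1 s1 : C) (X : C -> C) (rho : R).
Hypothesis rho0 : 0 < rho.
Hypothesis s1inf : inf -> s1 = 0.
Hypothesis s1fin : ~~ inf -> ev q x1 s1 = 0.
Hypothesis Xode : forall u, nm (u - s1) < rho -> ode (swapXY Q1) (swapXY P1) X u.
Hypothesis XP : forall u, nm (u - s1) < rho -> ev P1 (X u) u != 0.
Hypothesis Xs1 : X s1 = x1.
Hypothesis Qnz : exists y, ev Q1 x1 y != 0.

Let s1s1 : nm (s1 - s1) < rho.
Proof. by rewrite subrr nm0. Qed.

Lemma X_hol : hol_ball X s1 rho.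
Proof. by move=> u /Xode[d [hd _]]; exists d. Qed.

Lemma X_drv u : nm (u - s1) < rho -> exists2 d, drv id X u d & ev P1 (X u) u * d = ev Q1 (X u) u.
Proof. by move=> /Xode[d [hd]]; rewrite !ev_swapXY => e; exists d. Qed.

Lemma evQX_hol : hol_ball (fun u => ev Q1 (X u) u) s1 rho.
Proof. by move=> u /X_hol[d hd]; exact: ev_drv hd (drv_id id u). Qed.

(** Otherwise q(x1, .) would vanish on a disc, hence identically. *)
Lemma X_not_cst : ~ (forall u, nm (u - s1) < rho -> X u = x1).
Proof.
move=> h; have Q0 u : nm (u - s1) < rho -> ev Q1 x1 u = 0.
  move=> hu; have [d hd ed] := X_drv hu; rewrite (h u hu) in ed; rewrite -ed.
  have hn : 0 < rho - nm (u - s1) by rewrite subr_gt0.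
  have d0 : drv id X u 0.
    apply: drv_near hn _ (drv_cst id x1 u) => z hz; apply/esym/h.
    by have := nm_tri z u s1; lra.
  by rewrite (drv_uniq hd d0) mulr0.
have [w /eqP] := Qnz; apply.
apply: (@identity_ball R (fun u => ev Q1 x1 u) s1 (nm (w - s1) + 1) s1).
- by move=> z _; exact: ev_drv (drv_cst id x1 z) (drv_id id z).
- by rewrite subrr nm0 ltr_wpDl ?nm_ge0.
- by rewrite ltrDl.
by exists rho.
Qed.

(** The isolated zeros of X - x1 and of q(X(u), u), which has the same zeros as
the derivative of X. *)
Lemma isolated_data (e : R) : 0 < e -> exists (v delta : R), [/\ 0 < v <= e, v < rho, 0 < delta,
  forall u, 0 < nm (u - s1) <= v -> X u != x1 /\ ev Q1 (X u) u != 0 &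
  forall u, nm (u - s1) = v -> delta <= nm (X u - x1)].
Proof.
move=> e0.
have dXx : hol_ball (fun u => X u - x1) s1 rho.
  by move=> u /X_hol[d hd]; eexists; exact: drvB hd (drv_cst id x1 u).
have [Xc|[e1 e10 h1]] := zero_dichotomy rho0 dXx.
  by exfalso; apply: X_not_cst => u /Xc /eqP; rewrite subr_eq0 => /eqP.
have [Qc|[e2 e20 h2]] := zero_dichotomy rho0 evQX_hol.
  exfalso; apply: X_not_cst => u hu; apply: nm_le0.
  have := @mvi_ball R X (fun=> 0) s1 rho 0 u s1; rewrite mul0r Xs1; apply => //.
    move=> z hz; have [d hd ed] := X_drv hz; apply: (drv_eq hd).
    by move/eqP: ed; rewrite Qc // mulf_eq0 (negPf (XP hz)) => /eqP.
  by move=> z _; rewrite nm0.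
pose v := Num.min e (Num.min rho (Num.min e1 e2)) / 2.
have v0 : 0 < v by rewrite divr_gt0 // !lt_min e0 rho0 e10.
have m1 : Num.min e (Num.min rho (Num.min e1 e2)) <= e by rewrite ge_min lexx.
have m2 : Num.min e (Num.min rho (Num.min e1 e2)) <= rho by rewrite !ge_min lexx !orbT.
have m3 : Num.min e (Num.min rho (Num.min e1 e2)) <= e1 by rewrite !ge_min lexx !orbT.
have m4 : Num.min e (Num.min rho (Num.min e1 e2)) <= e2 by rewrite !ge_min lexx !orbT.
have iso u : 0 < nm (u - s1) <= v -> X u != x1 /\ ev Q1 (X u) u != 0.
  move=> /andP[u0 uv]; split; last by apply: h2; rewrite u0 /=; rewrite /v in v0 uv; lra.
  by rewrite -subr_eq0; apply: h1; rewrite u0 /=; rewrite /v in v0 uv; lra.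
have vr : v < rho by rewrite /v in v0 *; lra.
have [||delta delta0 hdelta] := @compact_uniform R (fun r u => nm (u - s1) = v -> r <= nm (X u - x1)) (v + nm s1).
- by move=> r r' u _ rr h /h; exact: le_trans.
- move=> u; have [uv|uv] := eqVneq (nm (u - s1)) v.
    have ur : nm (u - s1) < rho by rewrite uv.
    have [Xu _] : X u != x1 /\ _ := iso u ltac:(by rewrite uv v0 lexx).
    have hX : 0 < nm (X u - x1) / 2 by rewrite divr_gt0 // nm_gt0 subr_eq0.
    have [d hd] := X_hol ur; have [r r0 hr] := drv_cont hd hX.
    exists r => //; exists (nm (X u - x1) / 2) => // u' /hr h _.
    by have := nm_tri (X u) (X u') x1; rewrite (nmB (X u) (X u')); lra.
  have d0 : 0 < `|nm (u - s1) - v| by rewrite normr_gt0 subr_eq0.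
  exists `|nm (u - s1) - v| => //; exists 1 => // u' hu' h; exfalso.
  have t1 := nm_tri u' u s1; have t2 := nm_tri u u' s1; rewrite (nmB u u') in t2.
  by move: d0 hu'; case: (ltrgt0P (nm (u - s1) - v)) => hw d0 h5; lra.
have ve : v <= e by rewrite /v in v0 *; lra.
exists v, delta; split => //; first by rewrite v0.
move=> u hu; apply: hdelta => //; by have := nm_sub u s1; lra.
Qed.

Variables (v delta : R).
Hypothesis v0 : 0 < v.
Hypothesis vrho : v < rho.
Hypothesis Xiso : forall u, 0 < nm (u - s1) <= v -> X u != x1 /\ ev Q1 (X u) u != 0.
Hypothesis Xdelta : forall u, nm (u - s1) = v -> delta <= nm (X u - x1).

(** The germs that make up the singularity: the inverses of X, read in the
chart. *)
Definition branch (w : C) (F : C -> C) := exists2 e : R, 0 < e & hol_ball F w e /\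
  forall z, nm (z - w) < e -> [/\ chart_dom inf (F z), nm (ch (F z) - s1) < v & X (ch (F z)) = z].

Lemma branch_sgerm w F G : sgerm w F G -> branch w F -> branch w G.
Proof.
move=> [e e0 h] [e' e'0 [dF hF]]; exists (Num.min e e'); first by rewrite lt_min e0.
split=> z; rewrite lt_min => /andP[z1 z2]; last by rewrite -h //; exact: hF.
have [d hd] := dF z z2; exists d.
have hz : 0 < e - nm (z - w) by rewrite subr_gt0.
by apply: drv_near hz _ hd => u hu; apply: h; have := nm_tri u z w; lra.
Qed.

Lemma branch_at w F : branch w F -> [/\ chart_dom inf (F w), nm (ch (F w) - s1) < v & X (ch (F w)) = w].
Proof. by move=> [e e0 [_ h]]; apply: h; rewrite subrr nm0. Qed.

Lemma ch_drv F w : (exists d, drv id F w d) -> chart_dom inf (F w) -> exists d, drv id (fun z => ch (F z)) w d.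
Proof. by move=> [d hd] /chart_drv[d' hd']; eexists; exact: drv_comp hd hd'. Qed.

Lemma Xch_drv F w : (exists d, drv id F w d) -> chart_dom inf (F w) -> nm (ch (F w) - s1) < rho ->
  exists d, drv id (fun z => X (ch (F z))) w d.
Proof.
by move=> hF hd hv; have [d h] := ch_drv hF hd; have [d' h'] := X_hol hv; eexists; exact: drv_comp h h'.
Qed.

Lemma branch_ball F a r w : hol_ball F a r ->
  (forall z, nm (z - a) < r -> chart_dom inf (F z) /\ nm (ch (F z) - s1) < v) ->
  nm (w - a) < r -> branch w F -> forall z, nm (z - a) < r -> branch z F.
Proof.
move=> dF hF hw [e e0 [_ hb]] z hz.
have dX : hol_ball (fun z => X (ch (F z)) - z) a r.
  move=> u hu; have [h1 h2] := hF u hu.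
  have [d hd] := Xch_drv (dF u hu) h1 (lt_trans h2 vrho).
  by eexists; exact: drvB hd (drv_id id u).
have XE u : nm (u - a) < r -> X (ch (F u)) = u.
  move=> hu; apply/eqP; rewrite -subr_eq0; apply/eqP.
  apply: (@identity_ball R (fun z => X (ch (F z)) - z) a r w u dX hw hu).
  by exists e => // t /hb[_ _ ->]; rewrite subrr.
exists (r - nm (z - a)); first by rewrite subr_gt0.
split; first by apply: hol_ballS dF _; lra.
move=> u hu; have ua : nm (u - a) < r by have := nm_tri u z a; lra.
by have [h1 h2] := hF u ua; split => //; exact: XE.
Qed.

(** On a disc around c where the values stay in the chart and in the disc around
s1, the identity theorem propagates the property. Otherwise no germ near c has
it: F(c) is outside the chart, or the value is outside the disc, or on its
boundary, where X is at distance at least delta from x1. *)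
Lemma branch_local F c (e : R) : 0 < e -> hol_ball F c e -> nm (c - x1) < delta ->
  exists2 e' : R, 0 < e' & forall w z, nm (w - c) < e' -> nm (z - c) < e' -> branch w F -> branch z F.
Proof.
move=> e0 dF hc; have dFc : exists d, drv id F c d by apply: dF; rewrite subrr nm0.
have [d hd] := dFc.
have [dom|ndom] := pselect (chart_dom inf (F c)); last first.
  have F0 : F c = 0 /\ inf.
    by move: ndom; rewrite /chart_dom; case: inf => h; [split => //; apply/eqP; apply: contrapT => /negP h'; apply: h|case: h].
  have [Fc hi] := F0.
  have vi : 0 < v^-1 by rewrite invr_gt0.
  have [e' e'0 h] := drv_cont hd vi; exists e' => // w z /h hw _ /branch_at[h1 h2 _]; exfalso.
  rewrite Fc subr0 in hw; rewrite s1inf // subr0 /chart hi nmV in h2.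
  have Fw : 0 < nm (F w) by rewrite nm_gt0; exact: h1.
  have : nm (F w) * (nm (F w))^-1 < v^-1 * v by apply: ltr_pM; rewrite ?nm_ge0 ?invr_ge0 ?nm_ge0.
  by rewrite mulfV ?gt_eqF // mulVf ?gt_eqF // ltxx.
have [d1 hd1] := ch_drv dFc dom.
have [hv|hv|hv] := ltgtP (nm (ch (F c) - s1)) v.
- have hv' : 0 < v - nm (ch (F c) - s1) by rewrite subr_gt0.
  have [r1 r10 h1] := chart_dom_open dom; have [r2 r20 h2] := drv_cont hd r10.
  have [r3 r30 h3] := drv_cont hd1 hv'.
  pose r := Num.min e (Num.min r2 r3); exists r; first by rewrite !lt_min e0 r20.
  move=> w z hw hz bw; apply: (@branch_ball F c r w) => //.
    by move=> u; rewrite lt_min => /andP[/dF].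
  move=> u; rewrite !lt_min => /and3P[_ /h2 u2 /h3 u3]; split; first exact: h1.
  by have := nm_tri (ch (F u)) (ch (F c)) s1; lra.
- have hv' : 0 < nm (ch (F c) - s1) - v by rewrite subr_gt0.
  have [r r0 h] := drv_cont hd1 hv'; exists r => // w z /h hw _ /branch_at[_ h2 _]; exfalso.
  by have := nm_tri (ch (F c)) (ch (F w)) s1; rewrite (nmB (ch (F c)) (ch (F w))); lra.
have Xc := Xdelta hv.
have hr : nm (ch (F c) - s1) < rho by rewrite hv.
have [d2 hd2] := Xch_drv dFc dom hr.
have n0 : 0 < nm (X (ch (F c)) - c).
  by have := nm_tri (X (ch (F c))) c x1; lra.
have hd3 := drvB hd2 (drv_id id c).
have [r r0 h] := drv_cont hd3 n0; exists r => // w z /h hw _ /branch_at[_ _ Xw]; exfalso.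
by move: hw; rewrite Xw subrr sub0r nmN ltxx.
Qed.

Lemma branch_keep sigma G : germ_fam sigma 0 1 G -> (forall s, 0 <= s <= 1 -> nm (sigma s - x1) < delta) -> path_cont sigma ->
  branch (sigma 0) (G 0) -> forall s, 0 <= s <= 1 -> branch (sigma s) (G s).
Proof.
move=> fG hs pcs b0; apply: (@fam_ind R sigma 0 1 G (fun s F => branch (sigma s) F) fG) => //.
  by move=> s F H; exact: branch_sgerm.
move=> s F e hs01 e0 dF _ _; have [e' e'0 h] := branch_local e0 dF (hs s hs01).
have [eta eta0 he] := pcs s hs01 e' e'0; exists eta => // a b a0 ab b1 ha hb.
by apply: h; apply: he; rewrite // ?a0 ?(le_trans a0) ?b1 ?(le_trans ab).
Qed.

(** A branch would take the value s1 at x1. At infinity this is not a finite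
value; at a finite zero of q(x1, .) the derivative of X vanishes, and the chain
rule gives 0 = 1. *)
Lemma branch_x1 F : ~ branch x1 F.
Proof.
move=> bF; have [h1 h2 h3] := branch_at bF.
have us1 : ch (F x1) = s1.
  apply/eqP; rewrite -subr_eq0 -nm_eq0; apply/negPn/negP => h.
  have h' : 0 < nm (ch (F x1) - s1) by rewrite lt_neqAle eq_sym h nm_ge0.
  by have [/eqP] := Xiso (u := ch (F x1)) ltac:(by rewrite h' ltW).
have [hi|hi] := boolP inf.
  have F0 : F x1 = 0 by rewrite -[F x1](chartK inf) us1 s1inf // /chart hi invr0.
  by have := h1 hi; rewrite F0 eqxx.
have [e e0 [dF hF]] := bF; have [|d hd] := dF x1; first by rewrite subrr nm0.
have [dX hX eX] := X_drv s1s1.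
have Q0 : ev Q1 (X s1) s1 = 0 by rewrite Xs1 (negPf hi) s1fin.
have dX0 : dX = 0.
  by move/eqP: eX; rewrite Q0 mulf_eq0 (negPf (XP s1s1)) => /eqP.
have chE z : ch z = z by rewrite /chart (negPf hi).
rewrite -us1 chE in hX.
have h := drv_comp hd hX; rewrite dX0 mul0r in h.
have h' : drv id (fun z => X (F z)) x1 1.
  apply: drv_near e0 _ (drv_id id x1) => z hz.
  by have [_ _] := hF z hz; rewrite chE.
by have := drv_uniq h h' => /eqP; rewrite eq_sym oner_eq0.
Qed.

Lemma branch_odeg w F : branch w F -> odeg P1 Q1 (fun z => ch (F z)) w.
Proof.
move=> [e e0 [dF hF]]; exists e => // z hz; have [h1 h2 h3] := hF z hz.
have [du hdu] := ch_drv (dF z hz) h1.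
apply: (branch_ode hdu); first by apply: Xode; exact: lt_trans vrho.
exists (e - nm (z - w)); first by rewrite subr_gt0.
by move=> u hu; have [] := hF u _; first by have := nm_tri u z w; lra.
Qed.

Lemma branch_value_neq w F : w != x1 -> branch w F -> 0 < nm (ch (F w) - s1) <= v.
Proof.
move=> wx /branch_at[h1 h2 h3]; rewrite (ltW h2) andbT nm_gt0 subr_eq0.
by apply: contraNneq wx => h; rewrite -h3 h Xs1.
Qed.

(** Both branches solve the equation, and q does not vanish away from x1. *)
Lemma branch_unique w F G : w != x1 -> branch w F -> branch w G -> F w = G w -> sgerm w F G.
Proof.
move=> wx bF bG FG.
have hv := branch_value_neq wx bF; have [_ Qw] := Xiso hv.
have [_ _ Xw] := branch_at bF; rewrite Xw in Qw.
have [|e e0 he] := ode_unique (branch_odeg bF) (branch_odeg bG) _ Qw; first by rewrite FG.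
by exists e => // z /he h; rewrite -[F z](chartK inf) h chartK.
Qed.

(** Each u over w in the disc is a regular point, where the existence theorem
gives an inverse of X on a disc of uniform radius; compactness of the disc
around s1 gives one radius for all of them. *)
Lemma branch_extends w : 0 < nm (w - x1) < delta -> exists2 r : R, 0 < r &
  forall w' F, nm (w' - w) < r -> branch w' F -> exists G, [/\ hol_ball G w r, sgerm w' F G &
     forall z, nm (z - w) < r -> branch z G].
Proof.
move=> /andP[w0 wd].
have wx : w != x1 by rewrite -subr_eq0 -nm_gt0.
pose A (r : R) (u : C) := forall w' F, nm (w' - w) < r -> branch w' F -> ch (F w') = u -> exists G, [/\ hol_ball G w r, sgerm w' F G &
     forall z, nm (z - w) < r -> branch z G].
have [||r r0 hA] := @compact_uniform R A (v + nm s1).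
- move=> r r' u _ rr hA w' F hw' bF uE; have [G [dG gG bG]] := hA w' F (lt_le_trans hw' rr) bF uE.
  exists G; split => //; first by move=> z hz; apply: dG; exact: lt_le_trans rr.
  by move=> z hz; apply: bG; exact: lt_le_trans rr.
- move=> u; have [uv|uv] := ltP v (nm (u - s1)).
    exists (nm (u - s1) - v); first by rewrite subr_gt0.
    exists 1 => // u' hu' w' F hw' bF uE; exfalso.
    have [_ h _] := branch_at bF; rewrite uE in h.
    by have := nm_tri u u' s1; rewrite (nmB u u'); lra.
  have ur : nm (u - s1) < rho by exact: le_lt_trans vrho.
  have [Xu|Xu] := eqVneq (X u) w; last first.
    have X0 : 0 < nm (X u - w) / 2 by rewrite divr_gt0 // nm_gt0 subr_eq0.
    have [d hd] := X_hol ur; have [e e0 he] := drv_cont hd X0.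
    exists e => //; exists (nm (X u - w) / 2) => // u' /he hu' w' F hw' bF uE; exfalso.
    have [_ _ h] := branch_at bF; rewrite uE in h; rewrite h in hu'.
    by have := nm_tri (X u) w' w; rewrite (nmB (X u) w'); lra.
  have us1 : 0 < nm (u - s1).
    by rewrite nm_gt0 subr_eq0; apply: contraNneq wx => us; rewrite -Xu us Xs1.
  have uv' : nm (u - s1) < v.
    rewrite lt_neqAle uv andbT; apply/eqP => h; have := Xdelta h; rewrite Xu; lra.
  have [_ Qw] : X u != x1 /\ ev Q1 (X u) u != 0 by apply: Xiso; rewrite us1.
  rewrite Xu in Qw.
  pose e := Num.min (v - nm (u - s1)) (nm (u - s1)).
  have e0 : 0 < e by rewrite lt_min us1 subr_gt0 uv'.
  have [r [eta [/andP[r0 _] eta0 ex]]] := ode_exists P1 e0 Qw.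
  exists eta => //; exists r => // u' hu' w' F hw' bF uE.
  have [H [Hw HP]] := ex w' u' hw' hu'.
  have Hv z : nm (z - w) < r -> nm (H z - s1) < v /\ 0 < nm (H z - s1).
    move=> hz; have [h _ _] := HP z hz; move: h; rewrite lt_min => /andP[h1 h2].
    have := nm_tri (H z) u s1; have := nm_tri u (H z) s1; rewrite (nmB u (H z)); split; lra.
  have Hdom z : nm (z - w) < r -> chart_dom inf (H z).
    move=> hz hi; have [_] := Hv z hz; rewrite s1inf // subr0 nm_gt0 //.
  have dH z : nm (z - w) < r -> exists d, drv id H z d.
    by move=> hz; have [_ _ [d [hd _]]] := HP z hz; exists d.
  pose G z := ch (H z).
  have dG : hol_ball G w r by move=> z hz; apply: ch_drv; [exact: dH|exact: Hdom].
  have og : sgerm w' (fun z => ch (F z)) H.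
    have [_ Qw'] := Xiso (branch_value_neq (w := w') (F := F) ltac:(
      apply/eqP => wE; move: bF; rewrite wE; exact: branch_x1) bF).
    have [_ _ XF] := branch_at bF; rewrite XF in Qw'.
    apply: (ode_unique (branch_odeg bF) _ _ Qw'); last by rewrite uE Hw.
    by apply: (@ode_odeg R P1 Q1 H w r) => // z /HP[].
  have gF : sgerm w' F G.
    by have [e' e'0 he'] := og; exists e' => // z /he' h; rewrite /G -h chartK.
  exists G; split => //.
  apply: (@branch_ball G w r w' dG) => //.
    move=> z hz; split; first exact/chart_domV/Hdom.
    by rewrite /G chartK; have [] := Hv z hz.
  exact: branch_sgerm gF bF.
exists r => // w' F hw' bF; apply: (hA (ch (F w'))) => //.
have [_ h _] := branch_at bF; have := nm_sub (ch (F w')) s1; lra.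
Qed.

Lemma branch_continuable sigma F : path_cont sigma -> (forall s, 0 <= s <= 1 -> 0 < nm (sigma s - x1) < delta) ->
  branch (sigma 0) F -> exists2 G, continuation sigma 1 F G & branch (sigma 1) G.
Proof.
move=> pcs hs b0.
pose P t := exists2 G, continuation sigma t F G & branch (sigma t) G.
suff : P 1 by [].
apply: (@real_ind R P 0 1); first exact: ler01.
  by have [e e0 [dF _]] := b0; exists F; first exact: cont0 e0 dF.
move=> s hs01; have [r r0 hr] := branch_extends (hs s hs01).
have [eta eta0 he] := pcs s hs01 r r0; exists eta; first exact: eta0.
move=> a b a0 ab b1 ha hb [G cG bG].
have na : nm (sigma a - sigma s) < r by apply: he; rewrite // a0 (le_trans ab).
have [H [dH gH bH]] := hr (sigma a) G na bG.
exists H; last by apply: bH; apply: he; rewrite // (le_trans a0) // b1.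
apply: (cont_ext cG ab dH _ gH) => t /andP[t1 t2]; apply: he.
  by rewrite (le_trans a0) // (le_trans t2).
by move: ha hb; rewrite !ltr_norml => /andP[? ?] /andP[? ?]; apply/andP; split; lra.
Qed.

(** The fibre is discrete because the derivative of X does not vanish on it, and
it lies in a compact disc. *)
Lemma fibre_finite z : 0 < nm (z - x1) < delta -> finite_set [set u | nm (u - s1) < v /\ X u = z].
Proof.
move=> /andP[z0 zd]; set Z := [set u | _].
have : finite_set ([set u | nm u <= v + nm s1] `&` Z).
  apply: (@compact_ideal R (fun B => finite_set ([set u | B u] `&` Z))).
  - move=> A B AB; apply: sub_finite_set => u [h1 h2]; split => //; exact: AB.
  - move=> A B fA fB; have : finite_set (([set u | A u] `&` Z) `|` ([set u | B u] `&` Z)).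
      by rewrite finite_setU.
    by apply: sub_finite_set => u [[h|h] h']; [left|right].
  have far u (e : R) : 0 < e -> (forall u', nm (u' - u) < e -> Z u' -> u' = u) ->
      exists2 e : R, 0 < e & finite_set ([set u' | nm (u' - u) < e] `&` Z).
    move=> e0 h; exists e => //; apply: (sub_finite_set _ (finite_set1 u)) => u' [h1 h2].
    exact: h.
  move=> u; have [uv|uv] := ltP v (nm (u - s1)).
    apply: (far u (nm (u - s1) - v)); first by rewrite subr_gt0.
    move=> u' hu' [h _]; exfalso.
    by have := nm_tri u u' s1; rewrite (nmB u u'); lra.
  have ur : nm (u - s1) < rho by exact: le_lt_trans vrho.
  have dXz : hol_ball (fun u => X u - z) u (rho - nm (u - s1)).
    move=> w hw; have [|d hd] := @X_hol w; first by have := nm_tri w u s1; lra.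
    by eexists; exact: drvB hd (drv_cst id z w).
  have rr : 0 < rho - nm (u - s1) by rewrite subr_gt0.
  have [Xc|[e e0 h]] := zero_dichotomy rr dXz; last first.
    apply: (far u e e0) => u' hu' [_ Xu']; apply/eqP; rewrite -subr_eq0 -nm_eq0.
    apply: contrapT => /negP h'.
    by have /eqP := h u' ltac:(by rewrite hu' lt_neqAle eq_sym h' nm_ge0); rewrite Xu' subrr.
  exfalso.
  have Xu : X u = z by apply/eqP; rewrite -subr_eq0; apply/eqP/Xc; rewrite subrr nm0.
  have us1 : 0 < nm (u - s1).
    rewrite nm_gt0 subr_eq0; apply/eqP => us; move: z0; rewrite -Xu us Xs1 subrr nm0 ltxx.
    by [].
  have [_ Qu] : X u != x1 /\ ev Q1 (X u) u != 0 by apply: Xiso; rewrite us1.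
  have [d hd ed] := X_drv ur.
  have d0 : drv id X u 0.
    apply: drv_near rr _ (drv_cst id z u) => w hw.
    by apply/esym/eqP; rewrite -subr_eq0; apply/eqP/Xc.
  by move: Qu; rewrite -ed (drv_uniq hd d0) mulr0 eqxx.
apply: sub_finite_set => u [h1 h2]; split => //=.
by have := nm_sub u s1; lra.
Qed.

End Branch.

(** * The structure of the singularity *)

Definition in_chart (R : realType) (inf : bool) (s1 : Cplx R) (e : R) (w : Cplx R) :=
  chart_dom inf w /\ nm (chart inf w - s1) < e.

(** The properties of the singularity that make it algebroid, with the limit s1
in the chart. The last one bounds the values of all the determinations on small
discs, not only those along the path. *)
Definition tame_singularity (R : realType) (f : Cplx R -> Cplx R) (gamma : R -> Cplx R)
    (inf : bool) (s1 : Cplx R) := [/\ inf -> s1 = 0,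
  exists2 r : R, 0 < r & evt (fun tau => forall h, continuation gamma tau f h ->
    (forall sigma, path_in (punctured_disc (gamma 1) (rc r)) sigma -> sigma 0 = gamma tau ->
       continuable sigma 1 h) /\
    (forall z, punctured_disc (gamma 1) (rc r) z ->
      finite_set (germ z @` multivalued (punctured_disc (gamma 1) (rc r)) (gamma tau) h z))) &
  forall e : R, 0 < e -> exists2 r : R, 0 < r & evt (fun tau => nm (gamma tau - gamma 1) < r /\
    forall h, continuation gamma tau f h ->
      (exists2 d : R, 0 < d & hol_ball h (gamma tau) d) /\
      forall sigma k, path_in (ball (gamma 1) (rc r)) sigma -> sigma 0 = gamma tau ->
        continuation sigma 1 h k -> in_chart inf s1 e (k (sigma 1)))].

Section AlongThePath.
Variable R : realType.
Local Notation C := (Cplx R).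
Local Notation rc := (@rc R).
Local Notation nm := (@nm R).
Local Notation ev := (@ev R).
Variables (p q p' q' : {poly {poly C}}) (S : seq C).
Hypothesis cop : forall x y, x \notin S -> ev p x y = 0 -> ev q x y = 0 -> False.
Hypothesis qnz : forall x, x \notin S -> exists y, ev q x y != 0.
Hypothesis hinf : at_infinity p q p' q'.
Hypothesis hcase : (forall x, x \notin S -> ev p' x 0 != 0) \/
      ((forall x, ev p' x 0 = 0) /\ (forall x, x \notin S -> ev q' x 0 != 0)).
Variables (f : C -> C) (gamma : R -> C) (g : R -> C -> C).
Hypothesis pg : path_cont gamma.
Hypothesis fg : forall T, T < 1 -> germ_fam gamma 0 T g.
Hypothesis g0f : sgerm (gamma 0) f (g 0).
Hypothesis gu : forall T h, T < 1 -> continuation gamma T f h -> sgerm (gamma T) (g T) h.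
Hypothesis og : forall s, 0 <= s < 1 -> odeg p q (g s) (gamma s).
Hypothesis nc : ~ continuable gamma 1 f.
Local Notation x1 := (gamma 1).
Hypothesis x1S : x1 \notin S.

Lemma chart_q (inf : bool) x w : chart_dom inf w -> ev q x w != 0 -> ev (if inf then q' else q) x (chart inf w) != 0.
Proof.
case: inf => // h qw; have w0 : w != 0 by exact: h.
have u0 : w^-1 != 0 by rewrite invr_eq0.
have [N [j hj]] := hinf; have [h1 _] := hj x _ u0; rewrite invrK in h1.
apply/eqP => h0; move: h1; rewrite /chart in h0 *; rewrite h0 mul0r => /esym/eqP.
by rewrite mulf_eq0 expf_eq0 (negPf u0) andbF (negPf qw).
Qed.

Lemma chart_qnz (inf : bool) x : x \notin S -> exists y, ev (if inf then q' else q) x y != 0.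
Proof. by case: inf => /qnz // h; exact: (inf_nonzero hinf h). Qed.

(** One germ is inverted by the existence theorem for dX/du = q / p, whose
solutions near (s1, x1) are defined on a fixed disc around s1; the identity
X(u(z)) = z is then continued along the path. Letting the parameter tend to 1
gives X(s1) = x1. *)
Lemma integral_curve (inf : bool) (s1 : C) : ev (if inf then p' else p) x1 s1 != 0 ->
  (forall e : R, 0 < e -> evt (fun s => chart_dom inf (g s (gamma s)) /\ nm (chart inf (g s (gamma s)) - s1) < e)) ->
  exists (X : C -> C) (rho : R), [/\ 0 < rho,
    forall u, nm (u - s1) < rho -> ode (swapXY (if inf then q' else q)) (swapXY (if inf then p' else p)) X u /\
      ev (if inf then p' else p) (X u) u != 0, X s1 = x1 &
    evt (fun s => sgerm (gamma s) (fun z => X (chart inf (g s z))) id)].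
Proof.
set P1 := if inf then p' else p; set Q1 := if inf then q' else q => P10 lim.
have P1s : ev (swapXY P1) s1 x1 != 0 by rewrite ev_swapXY.
have [rho [eta [/andP[rho0 _] eta0 ex]]] := @ode_exists R (swapXY Q1) (swapXY P1) s1 x1 1 ltr01 P1s.
have [T /andP[T0 T1] hT] := evt_and (evt_and (lim rho rho0) (gamma_evt pg eta0)) (evt_q cop pg og x1S).
pose s0 := (T + 1) / 2.
have [Ts0 s01] : T < s0 /\ s0 < 1 by rewrite /s0; split; lra.
have s00 : 0 <= s0 by lra.
have hs0 : T < s0 < 1 by rewrite Ts0.
have h01 : 0 <= s0 < 1 by rewrite s00.
have [[[dom0 v0] n0] q0] := hT s0 hs0.
have [X [X0 XP]] := ex _ _ v0 n0.
have XP1 u : nm (u - s1) < rho -> ode (swapXY Q1) (swapXY P1) X u /\ ev P1 (X u) u != 0.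
  by move=> /XP[_ h1 h2]; rewrite ev_swapXY in h1; split.
have b0 : sgerm (gamma s0) (fun z => X (chart inf (g s0 z))) id.
  have [_ hp] := XP1 _ v0; rewrite X0 in hp.
  apply: (@inverse_branch R P1 Q1 (fun z => chart inf (g s0 z)) X (gamma s0)) => //.
  - exact: (chart_odeg hinf dom0 (og h01)).
  - apply: (@ode_odeg R _ _ X s1 rho) => // w /XP1[] //.
  exact: chart_q.
have bs s : s0 <= s < 1 -> sgerm (gamma s) (fun z => X (chart inf (g s z))) id.
  move=> /andP[s0s ss1].
  have fs : germ_fam gamma s0 s g by exact: (fam_sub (fg ss1)).
  apply: (@fam_ind R gamma s0 s g (fun s F => sgerm (gamma s) (fun z => X (chart inf (F z))) id) fs _ _ b0 s).
  - move=> t F H [e e0 hFH] hF; apply: (sgerm_trans _ hF); exists e => // w /hFH ->.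
    by [].
  - move=> t F e /andP[s0t ts] e0 dF gF [eta' eta'0 he'].
    have t01 : T < t < 1 by rewrite (lt_le_trans Ts0) // (le_lt_trans ts).
    have [[[dom vt] _] _] := hT t t01; rewrite (sgerm_at gF) in dom vt.
    have [d hd] := dF (gamma t) ltac:(by rewrite subrr nm0).
    have [r1 r10 hr1] := chart_dom_open dom; have [r2 r20 hr2] := drv_cont hd r10.
    have [d1 hd1] := chart_drv dom; have v' : 0 < rho - nm (chart inf (F (gamma t)) - s1) by rewrite subr_gt0.
    have [r3 r30 hr3] := drv_cont (drv_comp hd hd1) v'.
    pose r := Num.min e (Num.min r2 r3).
    have r0 : 0 < r by rewrite !lt_min e0 r20.
    have dX : hol_ball (fun z => X (chart inf (F z))) (gamma t) r.
      move=> z; rewrite !lt_min => /and3P[/dF[d2 hd2] /hr2/hr1 domz /hr3 hz].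
      have hu : nm (chart inf (F z) - s1) < rho.
        by have := nm_tri (chart inf (F z)) (chart inf (F (gamma t))) s1; lra.
      have [d3 hd3] := chart_drv domz; have [[d4 [hd4 _]] _] := XP1 _ hu.
      by eexists; exact: drv_comp (drv_comp hd2 hd3) hd4.
    have did : hol_ball (@id C) (gamma t) r by move=> z _; exists 1; exact: drv_id.
    have t01' : 0 <= t <= 1 by have /andP[_ /ltW t1'] := t01; rewrite t1' (le_trans s00).
    have [eta2 eta20 he2] := pg t01' r0.
    exists eta2 => // a b s0a ab bs ha hb.
    apply: (sgerm_ball dX did); apply: he2 => //.
      by rewrite (le_trans s00) // (le_trans ab) // (le_trans bs) // ltW.
    by rewrite (le_trans s00) ?(le_trans s0a) // (le_trans bs) // ltW.
  by rewrite s0s lexx.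
exists X, rho; split => //; last first.
  by exists s0 => // s /andP[h1 h2]; apply: bs; rewrite h2 ltW.
have s1s1 : nm (s1 - s1) < rho by rewrite subrr nm0.
apply: nm_small => e e0.
have e2 : 0 < e / 2 by rewrite divr_gt0.
have [[d [hd _]] _] := XP1 _ s1s1.
have [r r0 hr] := drv_cont hd e2.
have es0 : evt (fun s => s0 < s) by exists s0 => // s /andP[].
have [T' /andP[T'0 T'1] hT'] := evt_and (evt_and (lim r r0) (gamma_evt pg e2)) es0.
have [|[[_ h1] h2] h3] := hT' ((T' + 1) / 2); first by apply/andP; split; lra.
set s := (T' + 1) / 2 in h1 h2 h3.
have := sgerm_at (bs s ltac:(by rewrite (ltW h3) /s /=; lra)) => /= Xs.
have := hr _ h1; rewrite Xs => h4.
by have := nm_tri (X s1) (gamma s) x1; rewrite (nmB (X s1) (gamma s)); lra.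
Qed.

Lemma const_cont (c : C) h (e : R) : 0 < e -> hol_ball h c e -> continuation (fun=> c) 1 h h.
Proof.
move=> e0 dh; have ps := is_pathP (@is_path_cst R c).
have fh : germ_fam (fun=> c) 0 1 (fun=> h).
  apply: (@fam_cst R (fun=> c) 0 1 c e h) => //.
  by move=> s _; rewrite subrr nm0.
exact: (fam_cont ler01 fh).
Qed.

Lemma singularity_structure : exists inf s1, tame_singularity f gamma inf s1.
Proof.
have [inf [s1 [hi hfin hP lim]]] := limit_exists cop qnz hinf hcase pg fg g0f og nc x1S.
have [X [rho [rho0 XP Xs1 bX]]] := integral_curve hP lim.
have Xode u : nm (u - s1) < rho -> ode (swapXY (if inf then q' else q)) (swapXY (if inf then p' else p)) X u.
  by move=> /XP[].
have XPn u : nm (u - s1) < rho -> ev (if inf then p' else p) (X u) u != 0 by move=> /XP[].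
have Qn := chart_qnz inf x1S.
have is_branch (v delta : R) : 0 < v -> v < rho -> 0 < delta -> evt (fun tau => nm (gamma tau - x1) < delta /\
    forall h, continuation gamma tau f h -> branch inf s1 X v (gamma tau) h).
  move=> v0 vr d0.
  have := evt_and (evt_and (lim v v0) bX) (gamma_evt pg d0).
  apply: evt_mono => s hs [[[dom hv] [e e0 gX]] hd]; split => // h ch.
  have /andP[s0 s1'] := hs.
  apply: (branch_sgerm (gu s1' ch)).
  have hss : 0 <= s <= s by rewrite s0 lexx.
  have [e1 e10 dg] := fam_hol (fg s1') hss.
  have [d hdr] := dg (gamma s) ltac:(by rewrite subrr nm0).
  have [r1 r10 hr1] := chart_dom_open dom; have [r2 r20 hr2] := drv_cont hdr r10.
  have [d1 hd1] := chart_drv dom; have v' : 0 < v - nm (chart inf (g s (gamma s)) - s1) by rewrite subr_gt0.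
  have [r3 r30 hr3] := drv_cont (drv_comp hdr hd1) v'.
  exists (Num.min (Num.min e e1) (Num.min r2 r3)); first by rewrite !lt_min e0 e10 r20.
  split=> z; rewrite !lt_min => /andP[/andP[z1 z2] /andP[/hr2/hr1 z3 /hr3 z4]]; first exact: dg.
  split => //; last exact: gX.
  by have := nm_tri (chart inf (g s z)) (chart inf (g s (gamma s))) s1; lra.
have keep (v delta : R) sigma h k : 0 < v -> v < rho -> 0 < delta ->
   (forall u, nm (u - s1) = v -> delta <= nm (X u - x1)) -> path_cont sigma ->
   (forall s, 0 <= s <= 1 -> nm (sigma s - x1) < delta) ->
   branch inf s1 X v (sigma 0) h -> continuation sigma 1 h k -> branch inf s1 X v (sigma 1) k.
  move=> v0 vr d0 Xd ps hs bh ck.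
  have [_ [G [fG G0 G1]]] := cont_fam ps (lexx 1) ck.
  apply: (branch_sgerm G1).
  apply: (branch_keep hi Xode v0 vr Xd fG hs ps) => //; last by rewrite ler01 lexx.
  exact: (branch_sgerm (sgerm_sym G0) bh).
exists inf, s1; split; first by [].
- have [v [delta [/andP[v0 _] vr d0 Xiso Xd]]] := isolated_data rho0 Xode XPn Xs1 Qn ltr01.
  exists delta => //; apply: evt_mono (is_branch v delta v0 vr d0) => tau ht [hd hb] h ch.
  have bh := hb h ch.
  have punct z : punctured_disc x1 (rc delta) z -> 0 < nm (z - x1) < delta.
    move=> [h1 h2]; rewrite ballrc in h1; rewrite h1 andbT nm_gt0 subr_eq0.
    by apply/eqP => h3; apply: h2.
  split.
    move=> sigma [/is_pathP ps hs] h0.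
    have [|G cG _] := branch_continuable rho0 hi hfin Xode XPn Xs1 vr Xiso Xd ps (fun s hs01 => punct _ (hs s hs01)) (F := h).
      by rewrite h0.
    by exists G.
  move=> z hz; have /andP[z0 zd] := punct z hz.
  have zx : z != x1 by rewrite -subr_eq0 -nm_gt0.
  have /choice[Fu FuP] : forall u, exists k, (exists k', branch inf s1 X v z k' /\ chart inf (k' z) = u) ->
      branch inf s1 X v z k /\ chart inf (k z) = u.
    move=> u; have [[k hk]|no] := pselect (exists k', branch inf s1 X v z k' /\ chart inf (k' z) = u).
      by exists k.
    by exists id.
  have fin := fibre_finite Xode Xs1 vr Xiso (punct z hz).
  apply: (sub_finite_set _ (finite_image (fun u => germ z (Fu u)) fin)) => _ [k [sigma [[/is_pathP ps hs] h0 h1 ck]] <-].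
  have bk : branch inf s1 X v z k.
    rewrite -h1; apply: (keep v delta sigma h k) => //; last by rewrite h0.
    by move=> s /hs /punct /andP[].
  have [_ k2 k3] := branch_at bk.
  exists (chart inf (k z)) => //=.
  have [bF FE] := FuP (chart inf (k z)) (ex_intro _ k (conj bk erefl)).
  have g_eq : sgerm z (Fu (chart inf (k z))) k.
    apply: (branch_unique Xode Xs1 vr Xiso zx bF bk).
    by rewrite -[LHS](chartK inf) FE chartK.
  rewrite /germ; apply/seteqP; split=> l /= /sgermP hl; apply/sgermP.
    exact: sgerm_trans (sgerm_sym g_eq) hl.
  exact: sgerm_trans g_eq hl.
move=> e e0; have [v [delta [/andP[v0 ve] vr d0 Xiso Xd]]] := isolated_data rho0 Xode XPn Xs1 Qn e0.
exists delta => //; apply: evt_mono (is_branch v delta v0 vr d0) => tau ht [hd hb]; split => // h ch.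
have bh := hb h ch; split; first by have [e' e'0 [dh _]] := bh; exists e'.
move=> sigma k [/is_pathP ps hs] h0 ck.
have bk : branch inf s1 X v (sigma 1) k.
  apply: (keep v delta sigma h k) => //; last by rewrite h0.
  by move=> s /hs; rewrite ballrc.
have [k1 k2 _] := branch_at bk; split => //; exact: lt_le_trans ve.
Qed.

End AlongThePath.

(** * The sphere and the theorem *)

Section Sphere.
Variable R : realType.
Local Notation C := (Cplx R).
Local Notation rc := (@rc R).
Local Notation nm := (@nm R).

Lemma ball_openC (a : C) (r : R) : open (ball a (rc r)).
Proof.
rewrite openE => z; rewrite ballrc => hz; apply/nearC.
exists (r - nm (z - a)); first by rewrite subr_gt0.
by move=> w hw; rewrite ballrc; have := nm_tri w z a; lra.
Qed.

Lemma ball_connectedC (a : C) (r : R) : 0 < r -> connected (ball a (rc r)).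
Proof.
move=> r0; pose seg (z : C) := (fun t : R => a + rc t * (z - a)) @` `[0, 1]%classic.
have segc z : connected (seg z).
  apply: connected_continuous_connected; first exact: segment_connected.
  apply: continuous_subspaceT => t; apply/cvgrPdist_lt => e /gt0rc[e' e'0 ->].
  have : drv rc (fun t : R => a + rc t * (z - a)) t (1 * (z - a)).
    apply: drv_eq (drvD (drv_cst rc a t) (drvM (drv_id rc t) (drv_cst rc (z - a) t))) _.
    by rewrite mulr0 addr0 add0r.
  move=> /rd_cont /(_ e' e'0)[d d0 hd]; apply/nearR; exists d => // s /hd h.
  by rewrite nmE ltrc nmB.
rewrite (_ : ball a (rc r) = \bigcup_(z in ball a (rc r)) seg z).
  apply: bigcup_connected => [|z _]; last exact: segc.
  by exists a => z _; exists 0; [rewrite /= in_itv /= lexx ler01|rewrite rmorph0 mul0r addr0].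
apply/seteqP; split=> z.
  move=> hz; exists z => //; exists 1; first by rewrite /= in_itv /= lexx ler01.
  by rewrite rmorph1 mul1r addrC subrK.
move=> [w hw [t]]; rewrite /= in_itv /= => ht <-; rewrite ballrc in hw; rewrite ballrc.
exact: seg_ball.
Qed.

Lemma compact_boundedC (W : set C) : compact W -> exists M : R, forall z, W z -> nm z <= M.
Proof.
move=> /compact_near_coveringP /(_ R (+oo)%R (fun M z => nm z <= M) _) [|M [_ hM]].
  move=> z _; have z1 : nm z < nm z + 1 by rewrite ltrDl.
  exists ([set w | nm (w - z) < 1], [set M | nm z + 1 < M]).
    split; first by apply/nearC; exists 1.
    by exists (nm z + 1); split => //; exact: num_real.
  by move=> [w M] [/= h1 h2]; have := nm_sub w z; lra.
by exists (M + 1) => z; apply: hM; rewrite ltrDl.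
Qed.

Definition sphere_point (inf : bool) (s1 : C) : one_point_compactification C :=
  if inf then None else Some s1.

Lemma nbhs_sphere_point (inf : bool) (s1 : C) (U : set (one_point_compactification C)) : (inf -> s1 = 0) ->
  nbhs (sphere_point inf s1) U ->
  exists2 e : R, 0 < e & forall w, in_chart inf s1 e w -> U (Some w).
Proof.
case: inf => [->//|_] hU.
  have [W [cW _] WU] := hU; have [M hM] := compact_boundedC cW.
  exists (`|M| + 1)^-1; first by rewrite invr_gt0 ltr_wpDl.
  move=> w [w0]; have {}w0 := w0 isT; rewrite subr0 /chart nmV ltf_pV2 ?posrE ?nm_gt0 ?ltr_wpDl // => hw.
  apply: WU; left; exists w => //= /hM h; have := ler_norm M; lra.
have /nearC[e e0 he] : nbhs s1 (Some @^-1` U) by exact: hU.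
by exists e => // w [_ h]; exact: he.
Qed.

(** This is how two limits are told apart: the values of a common determination
would lie in both sets. *)
Lemma charts_disjoint (inf inf' : bool) (s1 s1' : C) : (inf -> s1 = 0) -> (inf' -> s1' = 0) ->
  sphere_point inf s1 <> sphere_point inf' s1' ->
  exists2 e : R, 0 < e & forall w, in_chart inf s1 e w -> in_chart inf' s1' e w -> False.
Proof.
(* if |w| is more than |a| + 2 then w is not within 1 of a *)
have mixed (a w : C) (e := (nm a + 2)^-1) : in_chart true 0 e w -> in_chart false a e w -> False.
  move=> [w0]; have {}w0 := w0 isT; have a2 : 0 < nm a + 2 by rewrite ltr_wpDl ?nm_ge0.
  rewrite subr0 /chart nmV ltf_pV2 ?posrE ?nm_gt0 // => h1 [_] /=; rewrite /chart => h2.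
  have : e <= 1 by rewrite /e invf_le1 //; have := nm_ge0 a; lra.
  by have := nm_sub w a; lra.
have mixed0 a : 0 < (nm a + 2)^-1 :> R by rewrite invr_gt0 ltr_wpDl ?nm_ge0.
case: inf => hs; case: inf' => hs' ne.
- by [].
- by exists (nm s1' + 2)^-1 => // w; rewrite hs //; exact: mixed.
- by exists (nm s1 + 2)^-1 => // w h1 h2; rewrite hs' // in h2; exact: mixed h2 h1.
have d0 : 0 < nm (s1 - s1').
  by rewrite nm_gt0 subr_eq0; apply/eqP => h; apply: ne; rewrite h.
exists (nm (s1 - s1') / 2); first by rewrite divr_gt0.
move=> w [_ h1] [_ h2]; rewrite /chart in h1 h2.
by have := nm_tri s1 w s1'; rewrite (nmB s1 w); lra.
Qed.

End Sphere.

Theorem mainTheorem1 (R : realType) (P Q : {poly {poly Cplx R}}) (Q_neq0 : Q != 0) :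
  exists Sigma : set (Cplx R), finite_set Sigma /\
    forall (x0 y0 : Cplx R) (f : Cplx R -> Cplx R),
      Q.[x0, y0] != 0 -> local_solution P Q x0 y0 f ->
      forall gamma : R -> Cplx R,
        leads_to_singularity x0 f gamma -> ~ algebroid x0 f gamma ->
        Sigma (gamma 1).
Proof.
have [p [q [p' [q' [S [hred cop qnz hinf hcase]]]]]] := normal_form P Q_neq0.
exists [set` S]; split; first exact: finite_seq.
move=> x0 y0 f Q0 sol gamma0 lead0 nalg; apply: contrapT => nS; apply: nalg.
have {}nS : gamma0 1 \notin S by apply/negP.
have structure gamma : leads_to_singularity x0 f gamma -> gamma 1 \notin S ->
    exists inf s1, tame_singularity f gamma inf s1.
  move=> lead xS; have [ip g0 _ nc] := lead; have pg := is_pathP ip.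
  have [g [fg gf gu]] := leads_fam lead pg.
  have of_ : odeg p q f (gamma 0).
    by rewrite g0; have [e e0 he] := hred x0 y0 f Q0 sol; exists e.
  have og s : 0 <= s < 1 -> odeg p q (g s) (gamma s).
    move=> /andP[s0 s1]; apply: (ode_persist (fg s s1) (odeg_geq gf of_)).
    by rewrite s0 lexx.
  exact: (singularity_structure cop qnz hinf hcase pg fg gf gu og nc xS).
have [inf [s1 [hi [r r0 hr] hval]]] := structure gamma0 lead0 nS.
split.
  exists (rc r); split; first by rewrite -(rmorph0 (@rc R)) ltrc.
    apply/evt_near; apply: evt_mono hr => tau _ H h ch sigma.
    exact: (H h ch).1.
  apply/evt_near; apply: evt_mono hr => tau _ H h ch z.
  exact: (H h ch).2.
exists (sphere_point inf s1) => gamma' lead' [ends same].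
have nS' : gamma' 1 \notin S by rewrite -ends.
have [inf' [s1' [hi' _ hval']]] := structure gamma' lead' nS'.
have trivial_value gamma i s (e r' : R) tau h : nm (gamma tau - gamma 1) < r' ->
   continuation gamma tau f h -> (exists2 e : R, 0 < e & hol_ball h (gamma tau) e) ->
   (forall sigma k, path_in (ball (gamma 1) (rc r')) sigma -> sigma 0 = gamma tau -> continuation sigma 1 h k ->
      in_chart i s e (k (sigma 1))) -> in_chart i s e (h (gamma tau)).
  move=> hd ch [e' e'0 dh] H.
  apply: (H (fun=> gamma tau) h); [|by []|exact: const_cont e'0 dh].
  by split; [exact: is_path_cst|move=> s' _; rewrite ballrc].
have sameP : sphere_point inf s1 = sphere_point inf' s1'.
  apply: contrapT => ne; have [e e0 dis] := charts_disjoint hi hi' ne.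
  have [r1 r10 h1] := hval e e0; have [r2 r20 h2] := hval' e e0.
  pose m := Num.min r1 r2; have m0 : 0 < m by rewrite lt_min r10.
  have x1m : ball (gamma0 1) (rc m) (gamma0 1) by rewrite ballrc subrr nm0.
  have /evt_near h3 := same _ (@ball_openC R (gamma0 1) m) (@ball_connectedC R (gamma0 1) m m0) x1m.
  have [ip _ _ _] := lead0; have pg0 := is_pathP ip.
  have [ip' _ _ _] := lead'; have pg' := is_pathP ip'.
  have h4 := gamma_evt pg0 m0.
  have [g [fg gf gu]] := leads_fam lead0 pg0; have [g' [fg' gf' gu']] := leads_fam lead' pg'.
  apply: (@evt_false R); apply: evt_mono (evt_and (evt_and h1 h2) (evt_and h3 h4)).
  move=> tau /andP[t0 t1] [[[n1 k1] [n2 k2]] [k3 n3]].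
  have c1 := cont_geql (fam_cont t0 (fg tau t1)) (sgerm_sym gf).
  have c2 := cont_geql (fam_cont t0 (fg' tau t1)) (sgerm_sym gf').
  have [d1 v1] := k1 _ c1; have [d2 v2] := k2 _ c2.
  have in1 := trivial_value gamma0 inf s1 e r1 tau _ n1 c1 d1 v1.
  have : multivalued (ball (gamma0 1) (rc m)) (gamma0 tau) (g tau) (gamma0 tau) (g tau).
    have [e' e'0 dg] := d1.
    exists (fun=> gamma0 tau); split; [|by []|by []|exact: const_cont e'0 dg].
    by split; [exact: is_path_cst|move=> s' _; rewrite ballrc].
  rewrite (k3 _ _ c1 c2) => -[sigma [[ps hs] s0 s1E cs]].
  apply: (dis _ in1); rewrite -s1E; apply: (v2 sigma (g tau) _ s0 cs).
  split => // s hs01; have := hs s hs01; rewrite !ballrc ends => h.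
  by apply: (lt_le_trans h); rewrite ge_min lexx orbT.
rewrite sameP => U hU; have [e e0 he] := nbhs_sphere_point hi' hU.
have [r2 r20 h2] := hval' e e0.
apply/evt_near; apply: evt_mono h2 => tau _ [n2 k2] h ch; apply: he.
by have [d2 v2] := k2 h ch; exact: (trivial_value gamma' inf' s1' e r2 tau h n2 ch d2 v2).
Qed.
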